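(* Let $(R,\mathfrak m)$ be a Cohen-Macaulay local ring with $\dim R=1$ admitting a fractional canonical ideal $K$, that is, an $R$-submodule $K$ of $\overline R$ with $R\subseteq K\subseteq\overline R$ and $K\cong \mathrm{K}_R$ as an $R$-module. Set $S=R[K]$ in $\mathrm{Q}(R)$ and $\mathfrak c=R:S$. Let $R$ be a generalized Gorenstein local ring and assume that $R$ is not a Gorenstein ring. Then the following assertions hold true. (1) $\{I\in\mathcal X_R\mid \mathfrak c\subsetneq I\}=\{(a)+\mathfrak c\mid a\in\mathfrak m \text{ such that } \mathfrak c=abS\text{ for some } b\in\mathfrak m\}$. In particular, $\mathfrak c\in\mathcal X_R$, once the set $\{I\in\mathcal X_R\mid\mathfrak c\subsetneq I\}$ is non-empty. (2) $\mu_R(I)=\mathrm{r}(R)+1$ for all $I\in\mathcal X_R$ such that $\mathfrak c\subseteq I$. (3) $\{I\in\mathcal X_R\mid\mathfrak c\subseteq I\}=\{I\in\mathcal X_R\mid\mu_R(I)\neq 2\}$. Therefore, if $R$ possesses minimal multiplicity, then the set $\mathcal X_R$ is totally ordered (with respect to inclusion), and $\mathfrak c$ is the smallest element of $\mathcal X_R$.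
   Context: Local rings are Noetherian. $\mathrm{Q}(R)$ denotes the total ring of fractions of $R$, $\overline R$ the integral closure of $R$ in $\mathrm{Q}(R)$, $\mathrm{K}_R$ the canonical module, $\mathrm{r}(R)$ the Cohen-Macaulay type of $R$, $\mu_R( * )$ the minimal number of generators, $\ell_R( * )$ the length. $R$ possesses minimal multiplicity if $\mathrm{v}(R)=\mathrm{e}(R)$, where $\mathrm{v}(R)=\mu_R(\mathfrak m)$ and $\mathrm{e}(R)=\lim_{n\to\infty}\ell_R(R/\mathfrak m^n)/n$. For $R$-submodules $X,Y$ of $\mathrm{Q}(R)$, $X:Y=\{x\in \mathrm{Q}(R)\mid xY\subseteq X\}$. The ring $S=R[K]$ is a birational finite extension of $R$, independent of the choice of $K$. An $\mathfrak m$-primary ideal $I$ of $R$ is called an Ulrich ideal if it contains a parameter ideal $Q=(a)$ of $R$ as a reduction and satisfies: (1) $I\neq Q$, (2) $I^2=QI$, and (3) $I/I^2$ is a free $R/I$-module. $\mathcal X_R$ denotes the set of all Ulrich ideals of $R$. Generalized Gorenstein local ring: a Cohen-Macaulay local ring $(R,\mathfrak m)$ with canonical module $\mathrm{K}_R$ is called a generalized Gorenstein local (GGL) ring if either $R$ is Gorenstein, or $R$ is not Gorenstein but there exist an exact sequence $0\to R\xrightarrow{\varphi}\mathrm{K}_R\to C\to 0$ of $R$-modules and an $\mathfrak m$-primary ideal $\mathfrak a$ of $R$ such that (i) $C$ is an Ulrich $R$-module with respect to $\mathfrak a$ and (ii) the induced homomorphism $R/\mathfrak a\otimes_R\varphi:R/\mathfrak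 a\to \mathrm{K}_R/\mathfrak a\mathrm{K}_R$ is injective. Here a nonzero finitely generated $R$-module $C$ is an Ulrich $R$-module with respect to $\mathfrak a$ if $C$ is a Cohen-Macaulay $R$-module, the multiplicity $\mathrm{e}^0_{\mathfrak a}(C)$ equals $\ell_R(C/\mathfrak aC)$, and $C/\mathfrak aC$ is a free $R/\mathfrak a$-module. (When $\dim R=1$, $C$ has finite length, $\mathrm{e}^0_{\mathfrak a}(C)=\ell_R(C)$, so the condition says that $\mathfrak aC=0$ and $C$ is a nonzero free $R/\mathfrak a$-module.) *)

(* Defs.v *)
From HB Require Import structures.
From mathcomp Require Import all_boot all_order all_algebra.
From mathcomp Require Import boolp classical_sets functions.

Set Implicit Arguments.
Unset Strict Implicit.
Unset Printing Implicit Defensive.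

Import Order.TTheory GRing.Theory Num.Theory.
Local Open Scope classical_set_scope.
Local Open Scope ring_scope.

(* Subsets of modules are classical sets.  An ideal of R is a submodule of
   the regular module R^o; R-modules are of type lmodType R. *)

Section Modules.
Variable R : comNzRingType.

Definition submod (V : lmodType R) (A : set V) : Prop :=
  A 0 /\ forall (r : R) (x y : V), A x -> A y -> A (r *: x + y).

Definition submod_span (V : lmodType R) (X : set V) : set V :=
  [set x | forall A : set V, submod A -> X `<=` A -> A x].

Definition gen_by (V : lmodType R) (n : nat) (A : set V) : Prop :=
  exists e : 'I_n -> V, A = submod_span (range e).

Definition fin_gen (V : lmodType R) (A : set V) : Prop :=
  exists n, gen_by n A.

(* minimal number of generators, 0 if A is not finitely generated *)
Definition mu (V : lmodType R) (A : set V) : nat :=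
  xget 0%N [set n | gen_by n A /\ forall k, gen_by k A -> (n <= k)%N].

Definition idprod (V : lmodType R) (I : set R) (A : set V) : set V :=
  submod_span [set r *: x | r in I & x in A].

Definition ideal (I : set R) : Prop := submod (I : set R^o).

Definition pideal (a : R) : set R := submod_span ([set a] : set R^o).

Definition ideal_add (I J : set R) : set R := [set x + y | x in I & y in J].

Definition ideal_mul (I J : set R) : set R := idprod I (J : set R^o).

Definition ideal_pow (I : set R) (n : nat) : set R :=
  iter n (ideal_mul I) setT.

Definition prime_ideal (P : set R) : Prop :=
  ideal P /\ P <> setT /\ forall x y, P (x * y) -> P x \/ P y.

Definition maximal_ideal (P : set R) : Prop :=
  ideal P /\ P <> setT /\
  forall J, ideal J -> P `<=` J -> J = P \/ J = setT.

Definition radical (I : set R) : set R := [set x | exists n, I (x ^+ n)].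

Definition primary_ideal (I : set R) : Prop :=
  ideal I /\ I <> setT /\ forall x y, I (x * y) -> I x \/ radical I y.

Definition primary_to (m I : set R) : Prop :=
  primary_ideal I /\ radical I = m.

Definition noetherian : Prop :=
  forall I : set R, ideal I -> fin_gen (I : set R^o).

Definition local_with (m : set R) : Prop :=
  maximal_ideal m /\ forall n, maximal_ideal n -> n = m.

Definition annihilator (M : lmodType R) : set R :=
  [set r | forall x : M, r *: x = 0].

Definition prime_chain (J : set R) (n : nat) : Prop :=
  exists P : nat -> set R,
    (forall i, (i <= n)%N -> prime_ideal (P i) /\ J `<=` P i) /\
    (forall i, (i < n)%N -> P i `<` P i.+1).

(* Krull dimension, as the dimension of R / Ann M *)
Definition has_dim (M : lmodType R) (d : nat) : Prop :=
  prime_chain (annihilator M) d /\ ~ prime_chain (annihilator M) d.+1.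

Definition regular_seq (m : set R) (M : lmodType R) (n : nat) : Prop :=
  exists x : nat -> R,
    let part i : set M :=
      idprod (submod_span (x @` [set j | (j < i)%N] : set R^o)) setT in
    (forall i, (i < n)%N -> m (x i)) /\
    (forall i, (i < n)%N -> forall y : M, part i (x i *: y) -> part i y) /\
    part n <> setT.

Definition has_depth (m : set R) (M : lmodType R) (d : nat) : Prop :=
  regular_seq m M d /\ ~ regular_seq m M d.+1.

Definition cohen_macaulay (m : set R) (M : lmodType R) : Prop :=
  (forall x : M, x = 0) \/ exists d, has_depth m M d /\ has_dim M d.

Definition cm_local_ring (m : set R) : Prop :=
  noetherian /\ local_with m /\ cohen_macaulay m R^o.

(* length of A / B, by means of a composition series from B to A *)
Definition has_length (V : lmodType R) (A B : set V) (n : nat) : Prop :=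
  exists N : nat -> set V,
    N 0%N = B /\ N n = A /\
    (forall i, (i <= n)%N -> submod (N i)) /\
    (forall i, (i < n)%N -> N i `<` N i.+1 /\
       forall L, submod L -> N i `<=` L -> L `<=` N i.+1 ->
         L = N i \/ L = N i.+1).

Definition len (V : lmodType R) (A B : set V) : nat :=
  xget 0%N [set n | has_length A B n].

Definition rat_lim (u : nat -> rat) (l : rat) : Prop :=
  forall eps : rat, 0 < eps ->
    exists n0 : nat, forall n, (n0 <= n)%N -> `|u n - l| < eps.

(* e is the multiplicity of M with respect to I:
   lim_n  s! * len(M / I^n M) / n^s  with s = dim M *)
Definition has_mult (I : set R) (M : lmodType R) (e : rat) : Prop :=
  exists s, has_dim M s /\
    rat_lim (fun n => (s`!)%:R *
               (len (setT : set M) (idprod (ideal_pow I n) setT))%:R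
               / (n%:R ^+ s)) e.

(* A / B is a free R/I-module with a finite basis (I A is contained in B in
   every use) *)
Definition free_quot (V : lmodType R) (I : set R) (A B : set V) : Prop :=
  exists (n : nat) (e : 'I_n -> V),
    (forall i, A (e i)) /\
    (forall x, A x -> exists r : 'I_n -> R, B (x - \sum_i r i *: e i)) /\
    (forall r : 'I_n -> R, B (\sum_i r i *: e i) -> forall i, I (r i)).

Definition injective_mod (E : lmodType R) : Prop :=
  forall (A B : lmodType R) (i : {linear A -> B}) (f : {linear A -> E}),
    injective i -> exists g : {linear B -> E}, forall x, g (i x) = f x.

Definition projective_mod (P : lmodType R) : Prop :=
  forall (A B : lmodType R) (p : {linear A -> B}) (f : {linear P -> B}),
    range p = setT -> exists g : {linear P -> A}, forall x, p (g x) = f x.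

Definition kernel (V W : lmodType R) (f : V -> W) : set V :=
  [set x | f x = 0].

Definition finite_injdim (M : lmodType R) : Prop :=
  exists (n : nat) (E : nat -> lmodType R) (f : {linear M -> E 0%N})
         (d : forall i, {linear E i -> E i.+1}),
    (forall i, injective_mod (E i)) /\
    injective f /\ range f = kernel (d 0%N) /\
    (forall i, range (d i) = kernel (d i.+1)) /\
    (forall i, (n < i)%N -> forall x : E i, x = 0).

(* Ext^i(N, M) has length l: the i-th cohomology of Hom(F, M), where F is a
   projective resolution of N.  Cochains live in the module of all functions
   from F i to M. *)
Definition ext_has_length (i : nat) (N M : lmodType R) (l : nat) : Prop :=
  exists (F : nat -> lmodType R) (eps : {linear F 0%N -> N})
         (d : forall i, {linear F i.+1 -> F i}),
    (forall i, projective_mod (F i)) /\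
    range eps = setT /\ range (d 0%N) = kernel eps /\
    (forall i, range (d i.+1) = kernel (d i)) /\
    let cocycles : set (F i -> M) :=
      [set f : F i -> M | exists g : {linear F i -> M},
                 f = (g : F i -> M) /\ forall x, g (d i x) = 0] in
    let coboundaries : set (F i -> M) :=
      match i return set (F i -> M) with
      | 0 => [set (fun=> 0)]
      | j.+1 => [set f | exists g : {linear F j -> M},
                           f = (fun x => g (d j x))]
      end in
    has_length cocycles coboundaries l.

Definition is_quotient (I : set R) (N : lmodType R) : Prop :=
  exists p : {linear R^o -> N}, range p = setT /\ kernel p = I.

(* Cohen-Macaulay type: length of Ext^t(R/m, M) with t = depth M *)
Definition has_cm_type (m : set R) (M : lmodType R) (r : nat) : Prop :=
  exists t, has_depth m M t /\
    exists N : lmodType R, is_quotient m N /\ ext_has_length t N M r.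

Definition cm_type (m : set R) (M : lmodType R) : nat :=
  xget 0%N [set r | has_cm_type m M r].

Definition gorenstein : Prop := finite_injdim R^o.

(* Bruns-Herzog's definition; the second clause says that W is maximal
   Cohen-Macaulay *)
Definition canonical_module (m : set R) (W : lmodType R) : Prop :=
  fin_gen (setT : set W) /\
  (exists d, has_depth m W d /\ has_dim W d /\ has_dim R^o d) /\
  has_cm_type m W 1%N /\ finite_injdim W.

Definition ulrich_module (m a : set R) (C : lmodType R) : Prop :=
  (exists x : C, x <> 0) /\ fin_gen (setT : set C) /\
  cohen_macaulay m C /\
  has_mult a C (len (setT : set C) (idprod a setT))%:R /\
  free_quot a (setT : set C) (idprod a setT).

(* the last clause is the injectivity of R/a -> W/aW induced by phi *)
Definition ggl_ring (m : set R) : Prop :=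
  cm_local_ring m /\
  exists W : lmodType R, canonical_module m W /\
    (gorenstein \/
     (~ gorenstein /\
      exists (C : lmodType R) (phi : {linear R^o -> W}) (psi : {linear W -> C})
             (a : set R),
        injective phi /\ range phi = kernel psi /\ range psi = setT /\
        primary_to m a /\ ulrich_module m a C /\
        forall r : R, idprod a (setT : set W) (phi r) -> a r)).

(* in dimension one a parameter ideal is an m-primary principal ideal *)
Definition parameter (m : set R) (a : R) : Prop :=
  m a /\ primary_to m (pideal a).

Definition reduction (J I : set R) : Prop :=
  J `<=` I /\ exists n, ideal_pow I n.+1 = ideal_mul J (ideal_pow I n).

(* Ulrich ideals, for R of dimension one *)
Definition ulrich_ideal (m I : set R) : Prop :=
  primary_to m I /\
  exists a, parameter m a /\ reduction (pideal a) I /\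
    I <> pideal a /\
    ideal_mul I I = ideal_mul (pideal a) I /\
    free_quot I (I : set R^o) (ideal_mul I I).

Definition minimal_multiplicity (m : set R) : Prop :=
  has_mult m R^o (mu (m : set R^o))%:R.

Section Fractions.
Variable Q : comUnitAlgType R.

Definition regular_elt (s : R) : Prop := forall x : R, s * x = 0 -> x = 0.

(* Q is the localization of R at its nonzerodivisors, via r |-> r%:A *)
Definition total_fractions : Prop :=
  injective (in_alg Q) /\
  (forall s, regular_elt s -> (s%:A : Q) \is a GRing.unit) /\
  (forall q : Q, exists a s, regular_elt s /\ q = a%:A / s%:A).

Definition base : set Q := range (in_alg Q).

Definition int_closure : set Q := [set x | integralOver (in_alg Q) x].

Definition colon (X Y : set Q) : set Q :=
  [set x | forall y, Y y -> X (x * y)].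

Definition subalg (A : set Q) : Prop :=
  submod A /\ A 1 /\ forall x y, A x -> A y -> A (x * y).

(* R[K] *)
Definition adjoin (K : set Q) : set Q :=
  [set x | forall A, subalg A -> K `<=` A -> A x].

Definition fractional_canonical_ideal (m : set R) (K : set Q) : Prop :=
  submod K /\ base `<=` K /\ K `<=` int_closure /\
  exists W : lmodType R, canonical_module m W /\
    exists f : {linear W -> Q}, injective f /\ range f = K.

(* R : R[K], which is contained in R since R[K] contains 1 ... *)
Definition conductorQ (K : set Q) : set Q := colon base (adjoin K).

(* ... and the same set viewed as an ideal of R *)
Definition conductor (K : set Q) : set R := in_alg Q @^-1` conductorQ K.

End Fractions.
End Modules.

(* Main.v *)
(* The regular fractional ideals of R in Q are called lattices.  For a canonical
   ideal K, the map X |-> K : X preserves lengths on lattices; hence K is unique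
   up to a unit of Q.  The GGL condition yields a canonical ideal L containing R
   such that L / R is free over R / c, where c = R : S and S = R[K] = R[L] = L^2;
   then S / R is free over R / c of rank r(R).

   An Ulrich ideal I with reduction (a) equals aA for the ring A = R : I, and A / R
   is free over R / I of rank mu(I) - 1.  If c <= I, comparing A / R with S / R
   gives mu(I) = r(R) + 1 and c :_R I = c + Rb with A = R + bS and c = abS.  If
   A / R has rank at least 2, duality forces c <= I.

   If R has minimal multiplicity, then m = zB with B = m : m for some z in m.  The
   residue field may be finite, so no principal reduction is available; instead
   x = sum_i x_i X^i, with the x_i generating m, serves as a reduction over R[X],
   and it is specialized at one maximal ideal of B at a time.  Then
   mu(I) = l(A / mA) = l(A / zA) = l(B / zB) is the same for all Ulrich ideals I,
   m included, so they all contain c, and m = (a) + c makes them a chain. *)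

Require Import Defs.
From HB Require Import structures.
From mathcomp Require Import all_boot all_order all_algebra.
From mathcomp Require Import boolp classical_sets functions.
From mathcomp Require Import ring lra zify.

Set Implicit Arguments.
Unset Strict Implicit.
Unset Printing Implicit Defensive.

Import Order.TTheory GRing.Theory Num.Theory.
Local Open Scope classical_set_scope.
Local Open Scope ring_scope.

(** The duality runs on one property of a canonical ideal: the socle of Q/K is simple. This comes
    from type one, by computing Ext^1(R/m, W) as the socle of W/xW for a W-regular x in m. Each
    simple factor then contributes at most one to the length of a dual. For the given K the quotient
    K/R need not be free, so the exact sequence of the GGL condition is embedded in Q with phi(1)
    sent to 1, and L is the image of its middle term. Integrality of K over R enters when R[K] is
    identified with R[L]. That S/L is one more copy of R/c is a count. If L/R has rank k + 1 and the
    socle of R/c has length rho, the duals of R + mS and L + mS give (k+2) rho <= rho + k + 1, so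
    rho is 1. Over R[X] the modules have infinite length. Degrees are truncated below n, and the
    error, a multiple of the size of x that does not depend on n, is beaten by taking n large.
    Minimal multiplicity makes the Hilbert function i |-> l(m^i/m^(i+1)) agree at 1 and at all large
    i; hence the cokernel of x on truncated polynomials of degree below n has length below n, and
    monic relations exist in it. *)

Definition sadd (R : comNzRingType) (V : lmodType R) (A B : set V) : set V :=
  [set x + y | x in A & y in B].

(** * Submodules as sets, sums and spans *)

Section Submodules.
Variables (R : comNzRingType) (V : lmodType R).
Implicit Types (A B C : set V) (x y : V).

Lemma submod0 A : submod A -> A 0. Proof. by case. Qed.

Lemma submodZ A (r : R) x : submod A -> A x -> A (r *: x).
Proof. by case=> A0 AL Ax; have := AL r _ _ Ax A0; rewrite addr0. Qed.

Lemma submodD A x y : submod A -> A x -> A y -> A (x + y).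
Proof. by case=> A0 AL Ax Ay; have := AL 1 _ _ Ax Ay; rewrite scale1r. Qed.

Lemma submodN A x : submod A -> A x -> A (- x).
Proof. by move=> sA Ax; rewrite -scaleN1r; apply: submodZ. Qed.

Lemma submodB A x y : submod A -> A x -> A y -> A (x - y).
Proof. by move=> sA Ax Ay; apply: submodD => //; apply: submodN. Qed.

Lemma submod_sum A (I : finType) (P : pred I) (F : I -> V) :
  submod A -> (forall i, P i -> A (F i)) -> A (\sum_(i | P i) F i).
Proof.
move=> sA AF; elim/big_ind: _ => //; first exact: submod0.
by move=> x y; apply: submodD.
Qed.

Lemma submodK A x y : submod A -> A x -> A (x + y) -> A y.
Proof. by move=> sA Ax Axy; rewrite -(addKr x y) addrC; apply: submodB. Qed.

Lemma submodI A B : submod A -> submod B -> submod (A `&` B).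
Proof.
move=> [A0 AL] [B0 BL]; split=> // r x y [Ax Bx] [Ay By].
by split; [apply: AL|apply: BL].
Qed.

Lemma submodT : submod (setT : set V). Proof. by []. Qed.

Lemma submod_zero : submod ([set 0] : set V).
Proof. by split=> // r x y -> ->; rewrite scaler0 addr0. Qed.

Lemma sadd_submod A B : submod A -> submod B -> submod (sadd A B).
Proof.
move=> sA sB; split; first by exists 0; [exact: submod0|exists 0; [exact: submod0|rewrite addr0]].
move=> r _ _ [x Ax [y By <-]] [x' Ax' [y' By' <-]].
exists (r *: x + x'); first by apply: submodD => //; apply: submodZ.
exists (r *: y + y'); first by apply: submodD => //; apply: submodZ.
by rewrite scalerDr addrACA.
Qed.

Lemma saddl A B : submod B -> A `<=` sadd A B.
Proof. by move=> sB x Ax; exists x => //; exists 0; [exact: submod0|rewrite addr0]. Qed.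

Lemma saddr A B : submod A -> B `<=` sadd A B.
Proof. by move=> sA x Bx; exists 0; [exact: submod0|exists x => //; rewrite add0r]. Qed.

Lemma sadd_min A B C : submod C -> A `<=` C -> B `<=` C -> sadd A B `<=` C.
Proof. by move=> sC AC BC _ [x /AC Cx [y /BC Cy <-]]; apply: submodD. Qed.

Lemma saddC A B : sadd A B = sadd B A.
Proof.
by rewrite eqEsubset; split=> _ [x Ax [y By <-]]; exists y => //; exists x => //; rewrite addrC.
Qed.

Lemma span_submod (X : set V) : submod (submod_span X).
Proof.
split=> [A sA _|r x y Hx Hy A sA XA]; first exact: submod0.
by apply: submodD => //; [apply: submodZ => //; apply: Hx|apply: Hy].
Qed.

Lemma sub_span (X : set V) : X `<=` submod_span X.
Proof. by move=> x Xx A _; apply. Qed.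

Lemma span_min (X A : set V) : submod A -> X `<=` A -> submod_span X `<=` A.
Proof. by move=> sA XA x; apply. Qed.

Lemma span_mono (X Y : set V) : X `<=` Y -> submod_span X `<=` submod_span Y.
Proof. by move=> XY x Xx A sA YA; apply: Xx => //; apply: subset_trans YA. Qed.

Lemma span_rangeP n (e : 'I_n -> V) x :
  submod_span (range e) x <-> exists r : 'I_n -> R, x = \sum_i r i *: e i.
Proof.
split=> [|[r ->]]; last first.
  have sS := span_submod (range e).
  by apply: (submod_sum sS) => i _; apply: (submodZ _ sS); apply: sub_span; exists i.
move: x; apply: (@span_min _ [set x | exists r : 'I_n -> R, x = \sum_i r i *: e i]); last first.
  move=> _ [i _ <-]; exists (fun j => (j == i)%:R).
  rewrite (bigD1 i) //= eqxx scale1r big1 ?addr0 // => j /negbTE ->.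
  by rewrite scale0r.
split; first by exists (fun=> 0); rewrite big1 // => i _; rewrite scale0r.
move=> r _ _ [a ->] [b ->]; exists (fun i => r * a i + b i).
by rewrite scaler_sumr -big_split; apply: eq_bigr => i _; rewrite scalerDl scalerA.
Qed.

End Submodules.

Opaque submod_span.

(** * Products of an ideal with a submodule, powers of ideals *)

Section IdealProducts.
Variable R : comNzRingType.
Implicit Types (I J : set R) (V : lmodType R).

Lemma idealM I r s : ideal I -> I s -> I (r * s).
Proof. exact: (@submodZ R R^o). Qed.

Lemma idealMr I r s : ideal I -> I s -> I (s * r).
Proof. by move=> iI Is; rewrite mulrC; apply: idealM. Qed.

Lemma idealD I r s : ideal I -> I r -> I s -> I (r + s).
Proof. exact: (@submodD R R^o). Qed.

Lemma idealN I r : ideal I -> I r -> I (- r).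
Proof. exact: (@submodN R R^o). Qed.

Lemma idealB I r s : ideal I -> I r -> I s -> I (r - s).
Proof. exact: (@submodB R R^o). Qed.

Lemma ideal0 I : ideal I -> I 0.
Proof. exact: (@submod0 R R^o). Qed.

Lemma ideal1 I : ideal I -> I 1 -> I = setT.
Proof.
move=> iI I1; rewrite eqEsubset; split=> // r _.
by rewrite -(mulr1 r); apply: idealM.
Qed.

Lemma pideal_ideal (a : R) : ideal (pideal a).
Proof. exact: (@span_submod R R^o). Qed.

Lemma pideal_gen (a : R) : pideal a a.
Proof. exact: (@sub_span R R^o). Qed.


Arguments pideal_gen : clear implicits.

Lemma pidealP (a x : R) : pideal a x <-> exists r, x = r * a.
Proof.
split=> [|[r ->]]; last exact (idealM r (pideal_ideal a) (pideal_gen a)).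
move: x; apply: (@span_min R R^o _ [set x : R | exists r, x = r * a]).
  split; first by exists 0; rewrite mul0r.
  by move=> r _ _ [a' ->] [b ->]; exists (r * a' + b); rewrite mulrDl -mulrA.
by move=> _ ->; exists 1; rewrite mul1r.
Qed.

Lemma idprod_submod V I (A : set V) : submod (idprod I A).
Proof. exact: span_submod. Qed.

Lemma idprod_in V I (A : set V) r x : I r -> A x -> idprod I A (r *: x).
Proof. by move=> Ir Ax; apply: sub_span; exists r => //; exists x. Qed.

Lemma idprod_min V I (A B : set V) : submod B ->
  (forall r x, I r -> A x -> B (r *: x)) -> idprod I A `<=` B.
Proof. by move=> sB IAB; apply: span_min => // _ [r Ir [x Ax <-]]; apply: IAB. Qed.

Lemma idprod_mono V I J (A B : set V) : I `<=` J -> A `<=` B ->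
  idprod I A `<=` idprod J B.
Proof.
move=> IJ AB; apply: idprod_min => [|r x Ir Ax]; first exact: idprod_submod.
by apply: idprod_in; [apply: IJ|apply: AB].
Qed.

Lemma idprod_sub V I (A : set V) : submod A -> idprod I A `<=` A.
Proof. by move=> sA; apply: idprod_min => // r x _; apply: submodZ. Qed.

Lemma ideal_mul_ideal I J : ideal (ideal_mul I J).
Proof. exact: idprod_submod. Qed.

Lemma ideal_mul_in I J r s : I r -> J s -> ideal_mul I J (r * s).
Proof. exact: (@idprod_in R^o). Qed.

Lemma ideal_pow_ideal I n : ideal (ideal_pow I n).
Proof. by case: n => [|n]; [exact: submodT|exact: ideal_mul_ideal]. Qed.

Lemma idprodA V I J (A : set V) :
  idprod I (idprod J A) = idprod (ideal_mul I J) A.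
Proof.
have s1 := idprod_submod I (idprod J A); have s2 := idprod_submod (ideal_mul I J) A.
rewrite eqEsubset; split.
  apply: idprod_min => // r x Ir.
  suff: idprod J A `<=` [set x | idprod (ideal_mul I J) A (r *: x)] by apply.
  apply: idprod_min => [|s y Js Ay] /=; last first.
    by rewrite scalerA; exact (idprod_in (ideal_mul_in Ir Js) Ay).
  split=> /=; first by rewrite scaler0; exact (submod0 s2).
  move=> s y z /= Hy Hz; rewrite scalerDr scalerA mulrC -scalerA.
  exact (submodD s2 (submodZ s s2 Hy) Hz).
apply: idprod_min => // r x IJr Ax.
suff: ideal_mul I J `<=` [set r | idprod I (idprod J A) (r *: x)] by apply.
apply: (@idprod_min R^o) => [|s t Is Jt] /=; last first.
  by rewrite -[s *: t]/(s * t) -scalerA; exact (idprod_in Is (idprod_in Jt Ax)).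
split=> /=; first by rewrite scale0r; exact (submod0 s1).
move=> s t u /= Ht Hu; rewrite scalerDl -[s *: t]/(s * t) -scalerA.
exact (submodD s1 (submodZ s s1 Ht) Hu).
Qed.

Lemma idprodT V (A : set V) : submod A -> idprod setT A = A.
Proof.
move=> sA; rewrite eqEsubset; split; first exact: idprod_sub.
by move=> x Ax; rewrite -(scale1r x); apply: idprod_in.
Qed.

Lemma ideal_mulC I J : ideal_mul I J = ideal_mul J I.
Proof.
have H (I' J' : set R) : ideal_mul I' J' `<=` ideal_mul J' I'.
  apply: (@idprod_min R^o) => [|r s I'r J's]; first exact: ideal_mul_ideal.
  by rewrite -[r *: s]/(r * s) mulrC; exact: ideal_mul_in.
by rewrite eqEsubset.
Qed.

Lemma ideal_powD I n k : ideal_pow I (n + k) = ideal_mul (ideal_pow I n) (ideal_pow I k).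
Proof.
elim: n => [|n IH]; first by rewrite add0n /= /ideal_mul idprodT //; exact: ideal_pow_ideal.
by rewrite addSn /= IH -[LHS]/(idprod I (idprod _ _)) idprodA.
Qed.

Lemma ideal_pow1 I : ideal I -> ideal_pow I 1 = I.
Proof. by move=> iI; rewrite -[ideal_pow I 1]/(ideal_mul I setT) ideal_mulC; exact: (@idprodT R^o). Qed.

End IdealProducts.

Arguments pideal_gen {R} a A _ _.

(** * Finite generation over Noetherian rings *)

Section FinitelyGenerated.
Variables (R : comNzRingType).
Implicit Types (V : lmodType R).

Lemma fin_gen_span V n (e : 'I_n -> V) : fin_gen (submod_span (range e)).
Proof. by exists n, e. Qed.

Lemma span_in V n (e : 'I_n -> V) i : submod_span (range e) (e i).
Proof. by apply/span_rangeP; exists (fun j => (j == i)%:R); rewrite (bigD1 i) //= eqxx scale1r big1 ?addr0 // => j /negbTE ->; rewrite scale0r. Qed.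

Lemma fin_gen_submod V (A : set V) : fin_gen A -> submod A.
Proof. by move=> [n [e ->]]; exact: span_submod. Qed.

Lemma span_range_sub V n (e : 'I_n -> V) (A : set V) :
  submod A -> (forall i, A (e i)) -> submod_span (range e) `<=` A.
Proof. by move=> sA Ae; apply: span_min => // _ [i _ <-]. Qed.

Lemma gen_byS V n (A : set V) : gen_by n.+1 A ->
  exists2 B, gen_by n B & exists x, A = sadd B (submod_span [set x]).
Proof.
move=> [e ->]; pose e' (i : 'I_n) := e (widen_ord (leqnSn n) i).
exists (submod_span (range e')); first by exists e'.
exists (e ord_max).
have s1 := span_submod (range e); have s2 := span_submod (range e').
have s3 := span_submod [set e ord_max]; have s4 := sadd_submod s2 s3.
rewrite eqEsubset; split.
  apply: span_range_sub => // i.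
  case: (unliftP ord_max i) => [j ->|->]; last first.
    by apply: (saddr s2); apply: sub_span.
  apply: (saddl s3); have -> : lift ord_max j = widen_ord (leqnSn n) j.
    by apply: val_inj; rewrite /= /bump leqNgt ltn_ord.
  exact (@span_in V n e' j).
apply: sadd_min => //; first by apply: span_range_sub => // i; exact: span_in.
by apply: span_min => // _ ->; exact: span_in.
Qed.

Lemma gen_by0 V (A : set V) : gen_by 0 A -> A = [set 0].
Proof.
move=> [e ->]; rewrite eqEsubset; split.
  by apply: span_min => [|_ [[]]//]; exact: submod_zero.
by move=> _ ->; exact: submod0 (span_submod _).
Qed.

Lemma gen_by_zero V : gen_by 0 ([set 0] : set V).
Proof.
exists (fun=> 0); rewrite eqEsubset; split.
  by move=> _ ->; exact: submod0 (span_submod _).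
by apply: span_min => [|_ [[]]//]; exact: submod_zero.
Qed.

Lemma gen_by_add V n k (A B : set V) : gen_by n A -> gen_by k B -> gen_by (n + k) (sadd A B).
Proof.
move=> [e ->] [f ->].
pose g (i : 'I_(n + k)) := match fintype.split i with inl j => e j | inr j => f j end.
have s1 := span_submod (range g); have s2 := span_submod (range e).
have s3 := span_submod (range f).
exists g; rewrite eqEsubset; split.
  apply: sadd_min => //; apply: span_range_sub => // i.
    have -> : e i = g (lshift k i) by rewrite /g; case: fintype.splitP => j /= E; [congr e; exact: val_inj|have := ltn_ord i; rewrite E ltnNge leq_addr].
    exact: span_in.
  have -> : f i = g (rshift n i).
    rewrite /g; case: fintype.splitP => j /= E; first by have := ltn_ord j; rewrite -E ltnNge leq_addr.
    by congr f; apply: val_inj => /=; apply/eqP; rewrite -(eqn_add2l n) E.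
  exact: span_in.
apply: span_range_sub => [|i]; first exact: sadd_submod.
by rewrite /g; case: fintype.splitP => j _; [apply: (saddl s3)|apply: (saddr s2)]; exact: span_in.
Qed.

Lemma gen_by1 V (x : V) : gen_by 1 (submod_span [set x]).
Proof.
exists (fun=> x); congr submod_span; rewrite eqEsubset; split => [_ ->|_ [i _ <-]//].
by exists ord0.
Qed.

Lemma span1P V (x y : V) : submod_span [set x] y <-> exists r, y = r *: x.
Proof.
split=> [|[r ->]]; last by apply: (submodZ r (span_submod _)); apply: sub_span.
move: y; apply: (@span_min _ _ _ [set y | exists r, y = r *: x]) => [|_ ->]; last by exists 1; rewrite scale1r.
split; first by exists 0; rewrite scale0r.
by move=> r _ _ [a ->] [b ->]; exists (r * a + b); rewrite scalerDl scalerA.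
Qed.

Lemma fin_gen_add V (A B : set V) : fin_gen A -> fin_gen B -> fin_gen (sadd A B).
Proof. by move=> [n gA] [k gB]; exists (n + k)%N; exact: gen_by_add. Qed.

Lemma span1_sub V (x : V) (A : set V) : submod A -> A x -> submod_span [set x] `<=` A.
Proof. by move=> sA Ax; apply: span_min => // _ ->. Qed.

Hypothesis noeth : noetherian R.

Lemma noetherian_submod V (A N : set V) : fin_gen A -> submod N -> N `<=` A -> fin_gen N.
Proof.
move=> [n gA] sN; elim: n A gA N sN => [|n IHn] A gA N sN NA.
  exists 0%N; have -> : N = [set 0].
    rewrite eqEsubset; split; first by rewrite -(gen_by0 gA).
    by move=> _ ->; exact: submod0.
  exact: gen_by_zero.
have [A' gA' [x defA]] := gen_byS gA.
have sA' : submod A' by apply: fin_gen_submod; exists n.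
(* The ideal of coefficients at the last generator x occurring in elements of N. Lifting its
   finitely many generators to N reduces the claim to N ∩ A', where induction applies. *)
pose J := [set r : R | exists2 a, A' a & N (a + r *: x)].
have iJ : ideal J.
  split; first by exists 0; [exact: submod0|rewrite scale0r addr0; exact: submod0].
  move=> r s t [a Aa Na] [b Ab Nb]; exists (r *: a + b); first exact (submodD sA' (submodZ r sA' Aa) Ab).
  rewrite -[r *: s]/(r * s) scalerDl -scalerA addrACA -scalerDr.
  exact (submodD sN (submodZ r sN Na) Nb).
have [q [r defJ]] := noeth iJ.
have Jr i : J (r i) by rewrite defJ; exact: span_in.
pose a i := s2val (cid2 (Jr i)).
have Aa i : A' (a i) by exact: (s2valP (cid2 (Jr i))).
pose b i := a i + r i *: x.
have Nb i : N (b i) by exact: (s2valP' (cid2 (Jr i))).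
have [p gp] := IHn A' gA' (N `&` A') (submodI sN sA') (@subIsetr _ _ _).
have -> : N = sadd (N `&` A') (submod_span (range b)).
  rewrite eqEsubset; split; last first.
    by apply: sadd_min => [//|? []//|]; exact: span_range_sub.
  move=> y Ny; have := NA _ Ny; rewrite defA => -[a' Aa' [_ /span1P[s ->] defy]].
  have : J s by exists a' => //; rewrite defy.
  rewrite defJ => /span_rangeP[t Es].
  have Nby : N (\sum_i t i *: b i) by apply: (submod_sum sN) => i _; exact (submodZ _ sN (Nb i)).
  exists (y - \sum_i t i *: b i); last first.
    by exists (\sum_i t i *: b i); [apply/span_rangeP; exists t|rewrite subrK].
  split; first exact: submodB.
  have -> : y - \sum_i t i *: b i = a' - \sum_i t i *: a i.
    rewrite -defy Es scaler_suml -addrA; congr (_ + _).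
    rewrite -!sumrN -big_split; apply: eq_bigr => i _ /=.
    by rewrite /b scalerDr scalerA opprD addrCA subrr addr0.
  by apply: (submodB sA') => //; apply: (submod_sum sA') => i _; exact (submodZ _ sA' (Aa i)).
by apply: fin_gen_add; [exists p|exact: fin_gen_span].
Qed.

(** Without a maximal element, choice produces a strictly increasing chain; its union is finitely
    generated, so it is reached at a finite stage. *)
Lemma noetherian_max V (M : set V) (P : set V -> Prop) : fin_gen M ->
  (forall A, P A -> submod A /\ A `<=` M) -> (exists A, P A) ->
  exists A, P A /\ forall B, P B -> A `<=` B -> B = A.
Proof.
move=> fM PM [A0 PA0]; apply: contrapT => nmax.
have step (A : {A | P A}) : exists B : {B | P B}, sval A `<=` sval B /\ sval B <> sval A.
  case: A => A PA; apply: contrapT => nB; apply: nmax; exists A; split=> // B PB AB.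
  by apply: contrapT => nBA; apply: nB; exists (exist _ B PB).
have [f fP] := choice step.
pose s n := sval (iter n f (exist _ A0 PA0)).
have ss n : submod (s n) by exact: (proj1 (PM _ (svalP (iter n f (exist _ A0 PA0))))).
have sM n : s n `<=` M.
  exact: (proj2 (PM _ (svalP (iter n f (exist _ A0 PA0))))).
have sS n : s n `<=` s n.+1 /\ s n.+1 <> s n by exact: fP.
have sle m n : (m <= n)%N -> s m `<=` s n.
  elim: n => [|n IH]; first by rewrite leqn0 => /eqP ->.
  rewrite leq_eqVlt => /orP[/eqP ->//|]; rewrite ltnS => /IH smn.
  exact: subset_trans smn (sS n).1.
pose U := [set x | exists n, s n x].
have sU : submod U.
  split; first by exists 0%N; exact: submod0 (ss _).
  move=> r x y [m sx] [n sy]; exists (maxn m n).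
  have sx' := sle _ _ (leq_maxl m n) _ sx; have sy' := sle _ _ (leq_maxr m n) _ sy.
  exact (submodD (ss _) (submodZ r (ss _) sx') sy').
have UM : U `<=` M by move=> x [n]; exact: sM.
have [k [e eU]] := noetherian_submod fM sU UM.
have Ue i : U (e i) by rewrite eU; exact: span_in.
have [g gP] := choice Ue.
have sUN : U `<=` s (\max_i g i)%N.
  rewrite {1}eU; apply: span_range_sub => // i; apply: sle (gP i).
  exact: (leq_bigmax i).
have [h1 h2] := sS (\max_i g i)%N; apply: h2; rewrite eqEsubset; split=> // x sx.
by apply: sUN; exists (\max_i g i).+1%N.
Qed.

End FinitelyGenerated.

(** * Composition series and additivity of length *)

Section Length.
Variables (R : comNzRingType).
Implicit Types (V W : lmodType R).

Definition simple_quot V (A B : set V) : Prop :=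
  [/\ submod A, submod B, B `<` A &
    forall L, submod L -> B `<=` L -> L `<=` A -> L = B \/ L = A].

Lemma has_length0 V (A B : set V) : has_length A B 0 <-> A = B /\ submod A.
Proof.
split=> [[N [N0 [NA [sN _]]]]|[<- sA]].
  by rewrite -N0 NA; split=> //; rewrite -NA; exact: sN.
by exists (fun=> A); split=> //; split=> //; split=> // i.
Qed.

Lemma has_lengthS V (A B : set V) n : has_length A B n.+1 <->
  exists2 A', simple_quot A A' & has_length A' B n.
Proof.
split=> [[N [N0 [NA [sN hN]]]]|[A' [sA sA' lA hA] [N [N0 [NA [sN hN]]]]]].
  exists (N n); last first.
    exists N; split=> //; split=> //; split=> i ilen; first by apply: sN; exact: leqW.
    by apply: hN; exact: ltnW.
  have [h1 h2] := hN n (ltnSn n); rewrite -NA.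
  by split=> //; apply: sN.
exists (fun i => if (i <= n)%N then N i else A).
split; first by rewrite leq0n.
split; first by rewrite ltnn.
split=> i ilen; first by case: ifP => // /sN.
have ilen' : (i <= n)%N by [].
rewrite ilen'; case: ltnP => [/hN//|nlei].
have -> : i = n by apply/eqP; rewrite eqn_leq ilen' nlei.
by rewrite NA; split=> // L; exact: hA.
Qed.

Lemma has_length_sub V (A B : set V) n : has_length A B n -> B `<=` A.
Proof.
elim: n A => [|n IH] A; first by move=> /has_length0[-> ?].
by move=> /has_lengthS[A' [_ _ [sA _] _] /IH BA']; exact: subset_trans sA.
Qed.

Lemma has_length_submod V (A B : set V) n : has_length A B n -> submod A /\ submod B.
Proof.
elim: n A => [|n IH] A; first by move=> /has_length0[-> ?].
by move=> /has_lengthS[A' [sA _ _ _] /IH[_ sB]].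
Qed.

Lemma has_length1 V (A B : set V) : has_length A B 1 <-> simple_quot A B.
Proof.
split; first by move=> /has_lengthS[A' sq /has_length0[<-]].
by move=> sq; apply/has_lengthS; exists B => //; apply/has_length0; case: sq.
Qed.

Lemma has_length_refl V (A : set V) : submod A -> has_length A A 0.
Proof. by move=> sA; apply/has_length0. Qed.

Lemma has_length_trans V (A B C : set V) n k :
  has_length A B n -> has_length B C k -> has_length A C (n + k).
Proof.
elim: n A => [|n IH] A; first by move=> /has_length0[-> ?].
move=> /has_lengthS[A' sq hA'] hB; apply/has_lengthS; exists A' => //; exact: IH.
Qed.

(* The relation [rho] plays the role of an isomorphism A / B -> A' / B'. *)
Lemma has_length_rel V W (rho : V -> W -> Prop) (A B : set V) (A' B' : set W) n :
  (forall r x x' y y', rho x y -> rho x' y' -> rho (r *: x + x') (r *: y + y')) ->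
  submod A' ->
  B' `<=` A' ->
  (forall x, A x -> exists2 y, A' y & rho x y) ->
  (forall y, A' y -> exists2 x, A x & rho x y) ->
  (forall x y, A x -> A' y -> rho x y -> B x <-> B' y) ->
  has_length A B n -> has_length A' B' n.
Proof.
move=> lin sA' BA' AA' A'A BB'.
elim: n A A' lin sA' BA' AA' A'A BB' => [|n IH] A A' lin sA' BA' AA' A'A BB'.
  move=> /has_length0[eAB sA]; apply/has_length0; split=> //.
  rewrite eqEsubset; split=> // y A'y; have [x Ax xy] := A'A _ A'y.
  by apply/(BB' x y) => //; rewrite -eAB.
move=> /has_lengthS[A1 [sA sA1 [A1A nA1A] mA] hA1].
pose A1' := [set y | A' y /\ exists2 x, A1 x & rho x y].
have linA x y x' y' : rho x y -> rho x' y' -> rho (x - x') (y - y').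
  by move=> h1 h2; have := lin (-1) _ _ _ _ h2 h1; rewrite !scaleN1r ![- _ + _]addrC.
have BA1 := has_length_sub hA1.
have key x x' y : A x -> A x' -> A' y -> rho x y -> rho x' y -> B (x - x').
  move=> Ax Ax' A'y h1 h2; have h3 := linA _ _ _ _ h1 h2; rewrite subrr in h3.
  apply/(BB' _ _ _ _ h3); [exact (submodB sA Ax Ax')|exact (submod0 sA')|].
  have [_ sB] := has_length_submod hA1.
  have [y0 A'y0 r0] := AA' 0 (submod0 sA).
  have := linA _ _ _ _ r0 r0; rewrite !subrr => r00.
  by apply/(BB' 0 0) => //; [exact (submod0 sA)|exact (submod0 sA')|exact (submod0 sB)].
have sA1' : submod A1'.
  split=> [|r y y' [A'y [x A1x xy]] [A'y' [x' A1x' xy']]].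
    split; first exact: submod0.
    have [y0 A'y0 r0] := AA' 0 (submod0 sA).
    by exists 0; [exact: submod0|have := linA _ _ _ _ r0 r0; rewrite !subrr].
  split; first exact (submodD sA' (submodZ r sA' A'y) A'y').
  exists (r *: x + x'); last exact: lin.
  exact (submodD sA1 (submodZ r sA1 A1x) A1x').
apply/has_lengthS; exists A1'; last first.
  apply: (IH A1) => //.
  - move=> y B'y; split; first exact: BA'.
    have [x Ax xy] := A'A _ (BA' _ B'y); exists x => //; apply: BA1.
    by apply/(BB' x y) => //; exact: BA'.
  - by move=> x A1x; have [y A'y xy] := AA' _ (A1A _ A1x); exists y => //; split=> //; exists x.
  - by move=> y [_ [x A1x xy]]; exists x.
  - by move=> x y A1x [A'y _]; apply: BB' => //; exact: A1A.
split=> //; first split; first by move=> y [].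
- move=> A'A1'; apply: nA1A => x Ax; have [y A'y xy] := AA' _ Ax.
  have [_ [x' A1x' x'y]] := A'A1' _ A'y.
  have := key _ _ _ Ax (A1A _ A1x') A'y xy x'y => /BA1 h.
  by rewrite -(subrK x' x); exact: submodD.
- move=> L sL A1L LA'; pose M := [set x | A x /\ exists2 y, L y & rho x y].
  have sM : submod M.
    split=> [|r x x' [Ax [y Ly xy]] [Ax' [y' Ly' xy']]].
      split; first exact: submod0.
      have [y0 A'y0 r0] := AA' 0 (submod0 sA).
      by exists 0; [exact: submod0|have := linA _ _ _ _ r0 r0; rewrite !subrr].
    split; first exact (submodD sA (submodZ r sA Ax) Ax').
    exists (r *: y + y'); last exact: lin.
    exact (submodD sL (submodZ r sL Ly) Ly').
  have A1M : A1 `<=` M.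
    move=> x A1x; split; first exact: A1A.
    have [y A'y xy] := AA' _ (A1A _ A1x); exists y => //; apply: A1L.
    by split=> //; exists x.
  have MA : M `<=` A by move=> x [].
  have [EM|EM] := mA M sM A1M MA; [left|right]; rewrite eqEsubset; split=> //.
    move=> y Ly; have A'y := LA' _ Ly; split=> //; have [x Ax xy] := A'A _ A'y.
    by exists x => //; rewrite -EM; split=> //; exists y.
  move=> y A'y; have [x Ax xy] := A'A _ A'y; have : M x by rewrite EM.
  move=> [_ [y' Ly' xy']]; have := linA _ _ _ _ xy xy'; rewrite subrr => h.
  have : B' (y - y').
    apply/(BB' 0 _ _ _ h); [exact (submod0 sA)|exact (submodB sA' A'y (LA' _ Ly'))|].
    by have [_ sB] := has_length_submod hA1; exact: submod0.
  move=> B'yy'; rewrite -(subrK y' y); apply: (submodD sL) => //; apply: A1L; split.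
    exact: BA'.
  have [x1 Ax1 r1] := A'A _ (BA' _ B'yy'); exists x1 => //; apply: BA1.
  by apply/(BB' _ _ Ax1 (BA' _ B'yy') r1).
Qed.

(** Second isomorphism theorem; the relation fed to [has_length_rel] is congruence modulo Y. *)
Lemma has_length_modular V (X Y : set V) n : submod X -> submod Y ->
  has_length X (X `&` Y) n -> has_length (sadd X Y) Y n.
Proof.
move=> sX sY; apply: (@has_length_rel _ _ (fun x y => Y (y - x))).
- move=> r x x' y y' h1 h2; rewrite opprD addrACA -scalerBr.
  exact (submodD sY (submodZ r sY h1) h2).
- exact: sadd_submod.
- exact: saddr.
- by move=> x Xx; exists x; [exact: saddl|rewrite subrr; exact: submod0].
- by move=> _ [x Xx [y Yy <-]]; exists x => //; rewrite addrAC subrr add0r.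
- move=> x y Xx _ Yyx; split=> [[_ Yx]|Yy]; first by rewrite -(subrK x y); exact: submodD.
  by split=> //; rewrite -(subKr y x); exact: submodB.
Qed.

(** Induction on the top simple factor A/A'. Either C lies in A', or C + A' = A; then C/(A' ∩ C) is
    that simple factor and A/C is A'/(A' ∩ C). Additivity and, below, uniqueness of the length both
    come from this. *)
Lemma has_length_split V (A B C : set V) n : submod C -> B `<=` C -> C `<=` A ->
  has_length A B n -> exists i j, [/\ has_length A C i, has_length C B j & n = (i + j)%N].
Proof.
elim: n A C => [|n IH] A C sC BC CA.
  move=> /has_length0[eAB sA]; exists 0%N, 0%N.
  have eC : C = A by rewrite eqEsubset; split=> //; rewrite eAB.
  by split=> //; apply/has_length0; rewrite eC.
move=> /has_lengthS[A' sq hA']; have [sA sA' [A'A nA'A] mA] := sq.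
have BA' := has_length_sub hA'.
have [CA'|nCA'] := pselect (C `<=` A').
  have [i [j [h1 h2 e]]] := IH _ _ sC BC CA' hA'; exists i.+1, j; split=> //.
    by apply/has_lengthS; exists A'.
  by rewrite e.
have eA : sadd C A' = A.
  have sub : sadd C A' `<=` A by exact: sadd_min.
  have [E|//] := mA _ (sadd_submod sC sA') (saddr sC) sub.
  by case: nCA'; rewrite -E; exact: saddl.
have BCA' : B `<=` A' `&` C by move=> x Bx; split; [exact: BA'|exact: BC].
have [i [j [h1 h2 e]]] := IH A' (A' `&` C) (submodI sA' sC) BCA' (@subIsetl _ _ _) hA'.
exists i, j.+1; split; last by rewrite e addnS.
  by have := has_length_modular sA' sC h1; rewrite saddC eA.
apply/has_lengthS; exists (A' `&` C) => //; split=> //; first exact: submodI.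
  split; first exact: subIsetr.
  by move=> CA'; apply: nCA' => x /CA'[].
move=> L sL AL LC.
have sub : sadd L A' `<=` A by apply: sadd_min => //; exact: subset_trans CA.
have [E|E] := mA _ (sadd_submod sL sA') (saddr sL) sub; [left|right]; rewrite eqEsubset; split=> //.
  by move=> x Lx; split; [rewrite -E; exact: saddl|exact: LC].
move=> x Cx; have : sadd L A' x by rewrite E; exact: CA.
move=> [y Ly [a A'a defx]]; rewrite -defx; apply: (submodD sL) => //; apply: AL; split=> //.
have -> : a = x - y by rewrite -defx addrAC subrr add0r.
by apply: (submodB sC) => //; exact: LC.
Qed.

Lemma has_length_simple V (A B : set V) n : simple_quot A B -> has_length A B n -> n = 1%N.
Proof.
move=> [sA sB [BA nBA] mA]; case: n => [|[|n]]//.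
  by move=> /has_length0[e _]; case: nBA; rewrite e.
move=> /has_lengthS[A' [_ sA' [A'A nA'A] _] /has_lengthS[A'' [_ _ [A''A' nA''] _] /has_length_sub BA'']].
have [|E|E] := mA _ sA' _ A'A; first exact: subset_trans A''A'.
  by case: nA''; rewrite E.
by case: nA'A; rewrite E.
Qed.

Lemma has_length_uniq V (A B : set V) n k : has_length A B n -> has_length A B k -> n = k.
Proof.
elim: n A k => [|n IH] A k.
  move=> /has_length0[-> _]; case: k => // k /has_lengthS[A' [_ _ [_ nBA] _] hA'].
  by case: nBA; exact: has_length_sub hA'.
move=> /has_lengthS[A' sq hA'] hk; have [_ sA' [A'A _] _] := sq.
have [i [j [h1 h2 ->]]] := has_length_split sA' (has_length_sub hA') A'A hk.
by rewrite (has_length_simple sq h1) (IH _ _ hA' h2).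
Qed.

Lemma len_eq V (A B : set V) n : has_length A B n -> len A B = n.
Proof.
move=> h; rewrite /len; apply: (@has_length_uniq _ A B) (h).
exact (xgetPex 0%N (ex_intro (fun n => has_length A B n) n h)).
Qed.

Definition fin_len V (A B : set V) := exists n, has_length A B n.

Lemma fin_len_trans V (A B C : set V) : fin_len A B -> fin_len B C -> fin_len A C.
Proof. by move=> [n h] [k h']; exists (n + k)%N; exact: has_length_trans h h'. Qed.

Lemma fin_len_refl V (A : set V) : submod A -> fin_len A A.
Proof. by exists 0%N; exact: has_length_refl. Qed.

Lemma fin_len_split V (A B C : set V) : submod C -> B `<=` C -> C `<=` A ->
  fin_len A B -> fin_len A C /\ fin_len C B.
Proof.
move=> sC BC CA [n hn]; have [i [j [h1 h2 _]]] := has_length_split sC BC CA hn.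
by split; [exists i|exists j].
Qed.

Lemma has_length_le V (A B C : set V) n j : submod C -> B `<=` C -> C `<=` A ->
  has_length A B n -> has_length C B j -> (j <= n)%N /\ (j = n -> C = A).
Proof.
move=> sC BC CA hn hj; have [i [j' [h1 h2 ->]]] := has_length_split sC BC CA hn.
rewrite (has_length_uniq hj h2) leq_addl; split=> // E.
have i0 : i = 0%N by apply/eqP; rewrite -(eqn_add2r j') -E.
by move: h1; rewrite i0 => /has_length0[].
Qed.

Lemma has_length_quot_le V (A B C : set V) n j : submod C -> B `<=` C -> C `<=` A ->
  has_length A B n -> has_length A C j -> (j <= n)%N /\ (j = n -> C = B).
Proof.
move=> sC BC CA hn hj; have [i [j' [h1 h2 ->]]] := has_length_split sC BC CA hn.
rewrite (has_length_uniq hj h1) leq_addr; split=> // E.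
have i0 : j' = 0%N by apply/eqP; rewrite -(eqn_add2l i) -E addn0.
by move: h2; rewrite i0 => /has_length0[].
Qed.

End Length.

(** * Lengths in free quotients *)

Section Combinations.
Variables (R : comNzRingType) (V : lmodType R).
Implicit Types (B : set V) (I J : set R).

(** This is B + J e_1 + ... + J e_n. Taking [J = setT] gives a whole module that is free modulo B;
    smaller J give the submodules whose lengths are compared. *)
Definition comb n B J (e : 'I_n -> V) : set V :=
  [set x | exists2 r : 'I_n -> R, (forall i, J (r i)) & B (x - \sum_i r i *: e i)].

Lemma comb_submod n B J (e : 'I_n -> V) : submod B -> ideal J -> submod (comb B J e).
Proof.
move=> sB iJ; split.
  exists (fun=> 0) => [_|]; first exact: ideal0.
  by rewrite big1 ?subr0 => [|i _]; [exact: submod0|rewrite scale0r].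
move=> r x y [a Ja Ba] [b Jb Bb]; exists (fun i => r * a i + b i) => [i|].
  exact (idealD iJ (idealM r iJ (Ja i)) (Jb i)).
have -> : \sum_i (r * a i + b i) *: e i = r *: (\sum_i a i *: e i) + \sum_i b i *: e i.
  by rewrite scaler_sumr -big_split; apply: eq_bigr => i _; rewrite scalerDl scalerA.
rewrite opprD addrACA -scalerBr; exact (submodD sB (submodZ r sB Ba) Bb).
Qed.

Lemma comb_sub n B J (e : 'I_n -> V) : ideal J -> B `<=` comb B J e.
Proof.
move=> iJ x Bx; exists (fun=> 0) => [_|]; first exact: ideal0.
by rewrite big1 ?subr0 // => i _; rewrite scale0r.
Qed.

Lemma comb_in n B J (e : 'I_n -> V) r i : submod B -> ideal J -> J r -> comb B J e (r *: e i).
Proof.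
move=> sB iJ Jr; exists (fun j => if j == i then r else 0) => [j|].
  by case: ifP => // _; exact: ideal0.
rewrite (bigD1 i) //= eqxx big1 ?addr0 ?subrr; first exact: submod0.
by move=> j /negbTE ->; rewrite scale0r.
Qed.

Lemma comb_min n B J (e : 'I_n -> V) (C : set V) : submod C -> B `<=` C ->
  (forall i r, J r -> C (r *: e i)) -> comb B J e `<=` C.
Proof.
move=> sC BC JC x [r Jr Bx]; rewrite -(subrK (\sum_i r i *: e i) x).
apply: (submodD sC); first exact: BC.
by apply: (submod_sum sC) => i _; exact: JC.
Qed.

(** The quotient is (J/I)^n: elements of I kill each e_i modulo B, and by independence the
    coefficients in J are determined modulo I. Each vector adds one copy of J/I. *)
Lemma comb_length n B I J (e : 'I_n -> V) rho : submod B -> ideal I -> ideal J ->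
  has_length (J : set R^o) I rho ->
  (forall i r, I r -> B (r *: e i)) ->
  (forall r : 'I_n -> R, (forall i, J (r i)) -> B (\sum_i r i *: e i) -> forall i, I (r i)) ->
  has_length (comb B J e) B (n * rho).
Proof.
move=> sB iI iJ hJI; elim: n e => [|n IH] e IB ind.
  apply/has_length0; have sc := comb_submod e sB iJ; split=> //.
  rewrite eqEsubset; split; last exact: comb_sub.
  by apply: comb_min => // -[[]].
pose e' (i : 'I_n) := e (widen_ord (leqnSn n) i).
pose ext (r : 'I_n -> R) (s : R) (i : 'I_n.+1) := if unlift ord_max i is Some j then r j else s.
have extE r s : \sum_i ext r s i *: e i = \sum_i r i *: e' i + s *: e ord_max.
  rewrite big_ord_recr /= {2}/ext unlift_none; congr (_ + _); apply: eq_bigr => i _; rewrite /e'.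
  have -> : widen_ord (leqnSn n) i = lift ord_max i by apply: val_inj; rewrite /= /bump leqNgt ltn_ord.
  by rewrite /ext liftK.
have ext_in r s (K : set R) : (forall i, K (r i)) -> K s -> forall i, K (ext r s i).
  by move=> Kr Ks i; rewrite /ext; case: unlift.
have IB' i r : I r -> B (r *: e' i) by exact: IB.
have ind' (r : 'I_n -> R) : (forall i, J (r i)) -> B (\sum_i r i *: e' i) -> forall i, I (r i).
  move=> Jr Br i; have := ind (ext r 0) (ext_in _ _ _ Jr (ideal0 iJ)).
  by rewrite extE scale0r addr0 => /(_ Br (lift ord_max i)); rewrite /ext liftK.
have h := IH e' IB' ind'; have sc' := comb_submod e' sB iJ.
have sc := comb_submod e sB iJ.
rewrite mulSn; apply: has_length_trans h.
have c'c : comb B J e' `<=` comb B J e.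
  apply: comb_min => //; first exact: comb_sub.
  by move=> i r; exact: comb_in.
apply: (@has_length_rel _ R^o V (fun r x => comb B J e' (x - r *: e ord_max)) J I) hJI => //.
- move=> r x x' y y' h1 h2; rewrite scalerDl -[r *: x]/(r * x) -scalerA opprD addrACA -scalerBr.
  exact (submodD sc' (submodZ r sc' h1) h2).
- move=> r Jr; exists (r *: e ord_max); first exact: comb_in.
  by rewrite subrr; exact: submod0.
- move=> x [r Jr Bx]; exists (r ord_max) => //.
  exists (fun i => r (widen_ord (leqnSn n) i)) => //.
  by move: Bx; rewrite big_ord_recr /= opprD [- _ - _]addrC addrA.
- move=> r x Jr _ cx; split=> [Ir|cx'].
    rewrite -(subrK (r *: e ord_max) x); apply: (submodD sc') => //.
    by apply: comb_sub => //; exact: IB.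
  have [a Ja Ba] : comb B J e' (r *: e ord_max) by rewrite -(subKr x (r *: _)); exact (submodB sc' cx' cx).
  have := ind (ext (fun i => - a i) r) (ext_in _ _ _ (fun i => idealN iJ (Ja i)) Jr).
  rewrite extE addrC (eq_bigr (fun i => - (a i *: e' i))) ?sumrN; last by move=> i _; rewrite scaleNr.
  by move=> /(_ Ba ord_max); rewrite /ext unlift_none.
Qed.

End Combinations.

(** * Nakayama, minimal generators and lengths over a local ring *)

Section Local.
Variables (R : comNzRingType) (m : set R).
Hypotheses (noeth : noetherian R) (loc : local_with m).
Implicit Types (V : lmodType R).

Lemma max_ideal : ideal m. Proof. by case: loc => [[]]. Qed.

Lemma max_proper : ~ m 1.
Proof. by case: loc => -[im [mT _]] _ /(ideal1 im). Qed.

Lemma noetherianT : fin_gen (setT : set R^o).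
Proof. exact: (noeth (@submodT R R^o)). Qed.

(** If r is not a unit, an ideal maximal among those containing r but not 1 is a maximal ideal,
    hence m. *)
Lemma local_unit (r : R) : ~ m r -> exists s, s * r = 1.
Proof.
move=> nmr; apply: contrapT => nu.
pose P (J : set R^o) := ideal J /\ J r /\ ~ J 1.
have [|||n [[iN [nr nn1]] maxn]] := @noetherian_max _ noeth R^o setT P.
- exact: noetherianT.
- by move=> A [].
- exists (pideal r); split; first exact: pideal_ideal.
  split; first exact: pideal_gen.
  by move=> /pidealP[s e]; apply: nu; exists s.
have /loc.2 e : maximal_ideal n; last by apply: nmr; rewrite -e.
split=> //; split; first by move=> e; apply: nn1; rewrite e.
move=> J iJ nJ; have [J1|nJ1] := pselect (J 1); first by right; exact: ideal1.
by left; apply: maxn => //; split=> //; split=> //; exact: nJ.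
Qed.

Lemma local_unit1B (r : R) : m r -> exists s, s * (1 - r) = 1.
Proof.
move=> mr; apply: local_unit => m1r; apply: max_proper.
by rewrite -(subrK r 1); exact: (idealD max_ideal).
Qed.

Lemma ideal_sub_max (J : set R) : ideal J -> ~ J 1 -> J `<=` m.
Proof.
move=> iJ nJ1 r Jr; apply: contrapT => /local_unit[s e]; apply: nJ1.
by rewrite -e; exact: idealM.
Qed.

Lemma max_prime r s : m (r * s) -> m r \/ m s.
Proof.
move=> mrs; have [|/local_unit[t e]] := pselect (m r); [by left|right].
by rewrite -(mul1r s) -e -mulrA; exact: (idealM _ max_ideal).
Qed.

Lemma residue_simple : simple_quot (setT : set R^o) m.
Proof.
split=> //; first exact: max_ideal.
  by split=> // h; apply: max_proper; exact: h.
move=> L sL mL _; have [L1|nL1] := pselect (L 1); [right|left].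
  exact: ideal1.
by rewrite eqEsubset; split=> //; exact: ideal_sub_max.
Qed.

Lemma residue_length : has_length (setT : set R^o) m 1.
Proof. by apply/has_length1; exact: residue_simple. Qed.

(** Noetherian form without determinants: if A is not inside N, choose L maximal among the
    submodules of A that contain N ∩ A and differ from A. Any x in A outside L gives A = L + Rx. *)
Lemma nakayama V (A N : set V) : fin_gen A -> submod N ->
  A `<=` sadd N (idprod m A) -> A `<=` N.
Proof.
move=> fA sN AN; apply: contrapT => nAN; have sA := fin_gen_submod fA.
pose P (L : set V) := submod L /\ L `<=` A /\ N `&` A `<=` L /\ ~ (A `<=` L).
have [|||L [[sL [LA [NL nAL]]] maxL]] := @noetherian_max _ noeth V A P => //.
- by move=> B [? []].
- exists (N `&` A); split; first exact: submodI.
  split; first exact: subIsetr.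
  by split=> // h; apply: nAN => x /h[].
have /existsNP[x /not_implyP[Ax nLx]] := nAL.
have s1 := span_submod [set x]; have sLx := sadd_submod sL s1.
have LxA : sadd L (submod_span [set x]) `<=` A by apply: sadd_min => //; exact: span1_sub.
have ALx : A `<=` sadd L (submod_span [set x]).
  apply: contrapT => nALx; apply: nLx; have -> : L = sadd L (submod_span [set x]).
    apply/esym; apply: maxL; last exact: saddl.
    by split=> //; split=> //; split=> //; exact: subset_trans (saddl s1).
  by apply: saddr => //; exact: sub_span.
(* C is L + mx, which contains mA because A = L + Rx. Then x lies in N + C, so (1 - r) x lies in L
   for some r in m, and 1 - r is a unit. *)
pose C := [set y | exists2 l, L l & exists2 r, m r & y = l + r *: x].
have sC : submod C.
  split; first by exists 0; [exact: submod0|exists 0; [exact: (ideal0 max_ideal)|rewrite scale0r addr0]].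
  move=> r _ _ [l Ll [s ms ->]] [l' Ll' [s' ms' ->]].
  exists (r *: l + l'); first exact (submodD sL (submodZ r sL Ll) Ll').
  exists (r * s + s'); first exact (idealD max_ideal (idealM r max_ideal ms) ms').
  by rewrite scalerDr scalerDl scalerA addrACA.
have mAC : idprod m A `<=` C.
  apply: idprod_min => // r y mr /ALx[l Ll [_ /span1P[s ->] <-]].
  exists (r *: l); first exact: submodZ.
  by exists (r * s); [exact: (idealMr _ max_ideal)|rewrite scalerDr scalerA].
have [n Nn [y mAy e]] := AN _ Ax; have [l Ll [r mr ey]] := mAC _ mAy.
have An : A n by rewrite -(addrK y n) e; apply: (submodB sA) => //; exact: (idprod_sub sA mAy).
have [s es] := local_unit1B mr; apply: nLx.
rewrite -(scale1r x) -es -scalerA scalerBl scale1r -{1}e ey addrA addrK.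
by apply: (submodZ _ sL); apply: (submodD sL) => //; apply: NL.
Qed.

Lemma simple_step V (B : set V) x : submod B -> (forall r, m r -> B (r *: x)) -> ~ B x ->
  simple_quot (sadd B (submod_span [set x])) B.
Proof.
move=> sB mx nBx; have s1 := span_submod [set x]; have sS := sadd_submod sB s1.
split=> //; first by split; [exact: saddl|move=> h; apply: nBx; apply: h; apply: saddr => //; exact: sub_span].
move=> L sL BL LS; have [LB|nLB] := pselect (L `<=` B); [left|right]; rewrite eqEsubset; split=> //.
have /existsNP[y /not_implyP[Ly nBy]] := nLB.
have [b Bb [_ /span1P[r ->] e]] := LS _ Ly.
have nmr : ~ m r by move=> mr; apply: nBy; rewrite -e; apply: (submodD sB) => //; exact: mx.
have [s es] := local_unit nmr.
have Lx : L x.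
  rewrite -(scale1r x) -es -scalerA; apply: (submodZ _ sL).
  by rewrite -(addKr b (r *: x)) e addrC; apply: (submodB sL) => //; exact: BL.
by apply: sadd_min => //; exact: span1_sub.
Qed.

(** Modulo B each generator is killed by m, so it contributes at most one simple factor. *)
Lemma has_length_gens V n (B A : set V) : submod B -> gen_by n A -> idprod m A `<=` B ->
  exists2 j, (j <= n)%N & has_length (sadd B A) B j.
Proof.
elim: n A => [|n IH] A sB gA mAB.
  exists 0%N => //; rewrite (gen_by0 gA); apply/has_length0.
  have sS := sadd_submod sB (@submod_zero R V); split=> //.
  rewrite eqEsubset; split; last by apply: saddl; exact: submod_zero.
  by apply: sadd_min => // _ ->; exact: submod0.
have [A' gA' [x defA]] := gen_byS gA.
have sA' : submod A' by apply: fin_gen_submod; exists n.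
have s1 := span_submod [set x].
have A'A : A' `<=` A by rewrite defA; exact: saddl.
have [j jn hj] := IH A' sB gA' (subset_trans (idprod_mono (@subset_refl _ _) A'A) mAB).
have sBA' := sadd_submod sB sA'.
have e : sadd (sadd B A') (submod_span [set x]) = sadd B A.
  rewrite defA eqEsubset; split.
    move=> _ [_ [b Bb [a Aa <-]] [y xy <-]]; exists b => //; exists (a + y); last by rewrite addrA.
    by exists a => //; exists y.
  move=> _ [b Bb [_ [a Aa [y xy <-]] <-]]; exists (b + a); first by exists b => //; exists a.
  by exists y => //; rewrite addrA.
have [h|h] := pselect (sadd B A' x).
  exists j; first exact: leqW.
  suff <- : sadd B A' = sadd B A by [].
  by rewrite -e eqEsubset; split; [exact: saddl|apply: sadd_min => //; exact: span1_sub].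
exists j.+1 => //; rewrite -e; apply/has_lengthS; exists (sadd B A') => //.
apply: simple_step => // r mr; apply: saddl => //; apply: mAB; apply: idprod_in => //.
by rewrite defA; apply: saddr => //; exact: sub_span.
Qed.

(** The hypothesis on [r] says that the e_i form a basis of A/mA over the residue field. A
    generating family of size k bounds the length of A/mA by k, so n is minimal. *)
Lemma mu_eq V n (e : 'I_n -> V) (A : set V) : A = submod_span (range e) ->
  (forall r : 'I_n -> R, idprod m A (\sum_i r i *: e i) -> forall i, m (r i)) ->
  mu A = n /\ has_length A (idprod m A) n.
Proof.
move=> defA ind; have s1 := idprod_submod m A.
have sA : submod A by rewrite defA; exact: span_submod.
have Ae i : A (e i) by rewrite defA; exact: span_in.
have hn : has_length A (idprod m A) n.
  have E : A = comb (idprod m A) setT e.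
    rewrite eqEsubset; split.
      rewrite {1}defA; apply: span_range_sub => [|i]; first exact: comb_submod.
      by rewrite -(scale1r (e i)); exact: comb_in.
    apply: comb_min => //; first exact: idprod_sub.
    by move=> i r _; exact: submodZ.
  rewrite -[n in has_length _ _ n]muln1 [X in has_length X _ _]E.
  apply: (comb_length (I := m)) => //.
  - exact: max_ideal.
  - exact: residue_length.
  - by move=> i r mr; apply: idprod_in => //; exact: Ae.
  - by move=> r _; exact: ind.
split=> //.
have le k : gen_by k A -> (n <= k)%N.
  move=> gA; have [j jk hj] := has_length_gens s1 gA (@subset_refl _ _).
  suff e' : sadd (idprod m A) A = A by rewrite e' in hj; rewrite (has_length_uniq hn hj).
  by rewrite eqEsubset; split; [apply: sadd_min => //; exact: idprod_sub|exact: saddr].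
have gA : gen_by n A by exists e.
have [h1 h2] := xgetPex 0%N (ex_intro (fun n => gen_by n A /\ forall k, gen_by k A -> (n <= k)%N) n (conj gA le)).
by apply/eqP; rewrite eqn_leq h2 // le.
Qed.

(** A further generator x contributes R/I with I = (B + A') : x, a quotient of R/J. *)
Lemma fin_len_gen V n (A B : set V) (J : set R) : ideal J -> fin_len (setT : set R^o) J ->
  submod B -> gen_by n A -> idprod J A `<=` B -> fin_len (sadd B A) B.
Proof.
move=> iJ fJ; elim: n A => [|n IH] A sB gA JAB.
  rewrite (gen_by0 gA); suff -> : sadd B [set 0] = B by exact: fin_len_refl.
  rewrite eqEsubset; split; last by apply: saddl; exact: submod_zero.
  by apply: sadd_min => // _ ->; exact: submod0.
have [A' gA' [x defA]] := gen_byS gA.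
have sA' : submod A' by apply: fin_gen_submod; exists n.
have s1 := span_submod [set x].
have A'A : A' `<=` A by rewrite defA; exact: saddl.
have fj := IH A' sB gA' (subset_trans (idprod_mono (@subset_refl _ _) A'A) JAB).
have sBA' := sadd_submod sB sA'.
apply: fin_len_trans fj.
pose I := [set r : R | sadd B A' (r *: x)].
have iI : ideal I.
  split; first by rewrite /I /= scale0r; exact: submod0.
  move=> r s t Is It; rewrite /I /= scalerDl -[r *: s]/(r * s) -scalerA.
  exact (submodD sBA' (submodZ r sBA' Is) It).
have JI : J `<=` I.
  move=> r Jr; apply: saddl => //; apply: JAB; apply: idprod_in => //.
  by rewrite defA; apply: saddr => //; exact: sub_span.
have [[k hk] _] := fin_len_split iI JI (@subsetT _ _) fJ; exists k.
have sA : submod A by rewrite defA; exact: sadd_submod.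
apply: (@has_length_rel _ R^o V (fun r y => sadd B A' (y - r *: x)) setT I) hk.
- move=> r a a' y y' h1 h2; rewrite scalerDl -[r *: a]/(r * a) -scalerA opprD addrACA -scalerBr.
  exact (submodD sBA' (submodZ r sBA' h1) h2).
- exact: sadd_submod.
- by move=> _ [b Bb [a A'a <-]]; exists b => //; exists a => //; exact: A'A.
- move=> r _; exists (r *: x); last by rewrite subrr; exact: submod0.
  apply: saddr => //; apply: (submodZ _ sA); rewrite defA; apply: saddr => //; exact: sub_span.
- move=> _ [b Bb [a Aa <-]]; move: Aa; rewrite defA => -[a' A'a' [_ /span1P[r ->] <-]].
  by exists r => //; rewrite addrA addrK; exists b => //; exists a'.
- move=> r y _ _ h; split=> [Ir|h'].
    by rewrite -(subrK (r *: x) y); exact: submodD.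
  by rewrite /I /= -(subKr y (r *: x)); exact: submodB.
Qed.

(** Every simple factor A/A' is killed by m: otherwise A = A' + mA, and Nakayama applied to a cyclic
    submodule Rx with A = A' + Rx gives A = A'. *)
Lemma has_length_pow V (A B : set V) n : has_length A B n -> idprod (ideal_pow m n) A `<=` B.
Proof.
elim: n A B => [|n IH] A B.
  by move=> /has_length0[<- sA]; exact: idprod_sub.
move=> /has_lengthS[A' [sA sA' [A'A nA'A] mA] hA'].
have mAA' : idprod m A `<=` A'.
  have s1 := idprod_submod m A; have s2 := sadd_submod sA' s1.
  have sub : sadd A' (idprod m A) `<=` A by apply: sadd_min => //; exact: idprod_sub.
  have [E|E] := mA _ s2 (saddl s1) sub; first by rewrite -E; exact: saddr.
  apply: idprod_min => // r x mr Ax; apply: contrapT => nA'x; apply: nA'A.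
  have sx := span_submod [set x].
  have Ax' : sadd A' (submod_span [set x]) = A.
    have sub' : sadd A' (submod_span [set x]) `<=` A by apply: sadd_min => //; exact: span1_sub.
    have [E'|//] := mA _ (sadd_submod sA' sx) (saddl sx) sub'.
    case: nA'x; apply: (submodZ _ sA'); rewrite -E'; apply: saddr => //; exact: sub_span.
  have fx : fin_gen (submod_span [set x]) by exists 1%N; exact: gen_by1.
  have : submod_span [set x] `<=` A'.
    apply: nakayama => // _ /span1P[t ->].
    have : A (t *: x) by exact: submodZ.
    rewrite -E => -[a A'a [y my <-]].
    suff : sadd A' (idprod m (submod_span [set x])) y.
      move=> [a' A'a' [y' my' <-]]; exists (a + a'); first exact: submodD.
      by exists y' => //; rewrite addrA.
    move: y my; have s3 := idprod_submod m (submod_span [set x]).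
    apply: idprod_min => [|s z ms]; first exact: sadd_submod.
    rewrite -Ax' => -[a' A'a' [w xw <-]]; rewrite scalerDr; exists (s *: a'); first exact: submodZ.
    by exists (s *: w) => //; exact: idprod_in.
  by move=> h; rewrite -Ax'; apply: sadd_min.
rewrite -[ideal_pow m n.+1]/(ideal_mul m (ideal_pow m n)) ideal_mulC -idprodA.
by apply: subset_trans (IH _ _ hA'); exact: idprod_mono.
Qed.

End Local.

(** * Depth and dimension; finite length of R/dR in dimension one *)

Section DimensionOne.
Variables (R : comNzRingType).

Lemma prime_chain_le (J : set R) n k : (k <= n)%N -> prime_chain J n -> prime_chain J k.
Proof.
move=> kn [P [h1 h2]]; exists P; split=> i ik; first by apply: h1; exact: leq_trans kn.
by apply: h2; exact: leq_trans kn.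
Qed.

Lemma has_dim_uniq (M : lmodType R) d d' : has_dim M d -> has_dim M d' -> d = d'.
Proof.
move=> [h1 n1] [h2 n2]; case: (ltngtP d d') => // lt.
  by case: n1; exact (prime_chain_le lt h2).
by case: n2; exact (prime_chain_le lt h1).
Qed.

Lemma regular_seq_le (m : set R) (M : lmodType R) n k : (k <= n)%N ->
  regular_seq m M n -> regular_seq m M k.
Proof.
move=> kn [x [h1 [h2 h3]]]; exists x; split=> [i ik|]; first by apply: h1; exact: leq_trans kn.
split=> [i ik|]; first by apply: h2; exact: leq_trans kn.
move=> e; apply: h3; rewrite eqEsubset; split=> // y _.
have XY : x @` [set j | (j < k)%N] `<=` x @` [set j | (j < n)%N].
  by move=> _ [j jk <-]; exists j => //; exact: leq_trans kn.
have : setT y by []; rewrite -{1}e => Ty.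
have sub := @span_mono R R^o _ _ XY.
exact (idprod_mono sub (@subset_refl _ _) Ty).
Qed.

Lemma has_depth_uniq (m : set R) (M : lmodType R) d d' :
  has_depth m M d -> has_depth m M d' -> d = d'.
Proof.
move=> [h1 n1] [h2 n2]; case: (ltngtP d d') => // lt.
  by case: n1; exact (regular_seq_le lt h2).
by case: n2; exact (regular_seq_le lt h1).
Qed.

Lemma regular_seq1 (m : set R) (M : lmodType R) : regular_seq m M 1 ->
  exists2 x, m x & forall y : M, x *: y = 0 -> y = 0.
Proof.
move=> [x [h1 [h2 _]]]; exists (x 0%N) => [|y xy0]; first exact: h1.
have := h2 0%N (leqnn _) y; rewrite xy0.
(* The ideal spanned by the empty prefix of the sequence is zero, so regularity of the first element
   modulo that prefix is regularity on M. *)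
set A := idprod _ _ => h; have : A y by apply: h; exact (submod0 (idprod_submod _ _)).
suff : A `<=` [set 0] by apply.
apply: idprod_min => [|r z]; first exact: submod_zero.
move=> r0 _; rewrite /= (_ : r = 0) ?scale0r //.
have s0 : @submod R R^o [set 0] by exact: submod_zero.
by apply: (span_min s0 _ r0) => t [].
Qed.

(** An ideal P maximal among those containing J and missing S is prime: for x, y outside P, both P +
    Rx and P + Ry meet S, and the product of two such elements of S would lie in P if xy did. *)
Lemma exists_prime_disjoint (J S : set R) : noetherian R -> ideal J ->
  S 1 -> (forall x y, S x -> S y -> S (x * y)) -> (forall x, J x -> ~ S x) ->
  exists P, [/\ prime_ideal P, J `<=` P & forall x, P x -> ~ S x].
Proof.
move=> noeth iJ adjoin1 adjoinM JS.
pose C (A : set R^o) := ideal A /\ J `<=` A /\ forall x, A x -> ~ S x.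
have [|||P [[iP [JP PS]] maxP]] := @noetherian_max _ noeth R^o setT C.
- exact: (noeth _ (@submodT R R^o)).
- by move=> A [].
- by exists J; split=> //; split=> // x Jx.
exists P; split=> //; split=> //; split=> [E|x y Pxy]; first by apply: (PS 1) => //; rewrite E.
have add z : ~ P z -> exists2 s, S s & exists2 p, P p & exists r, s = p + r * z.
  move=> nPz; apply: contrapT => nS.
  have sz := span_submod ([set z] : set R^o).
  have : sadd (P : set R^o) (submod_span [set z]) = P.
    apply: maxP; last exact: saddl.
    split; first exact: sadd_submod.
    split; first exact: subset_trans (saddl sz).
    move=> _ [p Pp [_ /span1P[r ->] <-]] Ss; apply: nS.
    by exists (p + r * z) => //; exists p => //; exists r.
  by move=> E; apply: nPz; rewrite -E; apply: (saddr iP); exact: sub_span.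
apply: contrapT => /not_orP[/add[s Ss [p Pp [r es]]] /add[t St [q Pq [u et]]]].
apply: (PS (s * t)); last exact: adjoinM.
rewrite es et mulrDl !mulrDr; apply: (idealD iP); apply: (idealD iP).
- exact: idealMr.
- exact: idealMr.
- exact: idealM.
- by rewrite mulrACA; exact: idealM.
Qed.

Lemma annihilator_regular_module : annihilator (R^o : lmodType R) = [set 0].
Proof.
rewrite eqEsubset; split=> [r|_ -> x]; last exact: scale0r.
by move=> /(_ (1 : R^o)); rewrite /= -[r *: _]/(r * 1) mulr1.
Qed.

Variable m : set R.
Hypotheses (noeth : noetherian R) (loc : local_with m) (dim1 : has_dim (R^o : lmodType R) 1).

Lemma max_prime_ideal : prime_ideal m.
Proof.
split; first exact: max_ideal loc.
split; last by move=> x y; exact: (max_prime noeth loc).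
by case: loc => [[_ []]].
Qed.

(** The products d^i u with u outside P avoid 0 since d is regular. A prime P0 missing all of them
    lies in P and omits d, so P different from m would give the chain P0 < P < m. *)
Lemma prime_regular (P : set R) d : prime_ideal P -> P d -> regular_elt d -> P = m.
Proof.
move=> prP Pd rd; have [iP [PT PM]] := prP.
have nP1 : ~ P 1 by move=> /(ideal1 iP).
apply: contrapT => nPm.
pose S := [set x | exists i u, ~ P u /\ x = d ^+ i * u].
have regX i : regular_elt (d ^+ i).
  by elim: i => [|i IH] x; rewrite ?mul1r // exprS -mulrA => /rd/IH.
have [||||P0 [prP0 _ P0S]] := @exists_prime_disjoint [set 0] S noeth.
- exact: (@submod_zero R R^o).
- by exists 0%N, 1; rewrite mul1r.
- move=> _ _ [i [u [Pu ->]]] [j [v [Pv ->]]]; exists (i + j)%N, (u * v).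
  by rewrite exprD mulrACA; split=> // /PM[].
- by move=> x -> [i [u [Pu]]] /esym /regX u0; apply: Pu; rewrite u0; exact: ideal0.
have P0P : P0 `<=` P.
  move=> x P0x; apply: contrapT => nPx; apply: (P0S _ P0x).
  by exists 0%N, x; rewrite mul1r.
have nP0d : ~ P0 d by move=> P0d; apply: (P0S _ P0d); exists 1%N, 1; rewrite mulr1.
have Pm : P `<=` m by exact: ideal_sub_max.
case: dim1 => _; apply; exists (fun i => if i is i'.+1 then if i' is _.+1 then m else P else P0).
split=> [i _|i].
  have h0 (P' : set R) : prime_ideal P' -> prime_ideal P' /\ annihilator (R^o : lmodType R) `<=` P'.
    move=> pr; split=> //; rewrite annihilator_regular_module => _ ->; exact: ideal0 pr.1.
  case: i => [|[|i]]; apply: h0 => //; exact: max_prime_ideal.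
case: i => [|[|i]] // _; split=> // h; first by apply: nP0d; exact: h.
by apply: nPm; rewrite eqEsubset.
Qed.

(** Noetherian induction. An ideal J containing d and maximal with R/J of infinite length is prime:
    if xy is in J and neither factor is, then J + Rx and J : x are larger, and (J + Rx)/J is R/(J :
    x). A prime containing d is m, and R/m is simple. *)
Lemma fin_len_regular d : regular_elt d -> fin_len (setT : set R^o) (pideal d).
Proof.
move=> rd; apply: contrapT => nfl.
pose C (A : set R^o) := ideal A /\ pideal d `<=` A /\ ~ fin_len (setT : set R^o) A.
have [|||J [[iJ [dJ nfJ]] maxJ]] := @noetherian_max _ noeth R^o setT C.
- exact: noetherianT.
- by move=> A [].
- by exists (pideal d); split; [exact: pideal_ideal|split].
have bigger (A : set R^o) : ideal A -> J `<=` A -> A <> J -> fin_len (setT : set R^o) A.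
  move=> iA JA AJ; apply: contrapT => nfA; apply: AJ; apply: maxJ => //.
  by split=> //; split=> //; exact: subset_trans JA.
have Jd : J d by apply: dJ; exact: pideal_gen.
suff prJ : prime_ideal J.
  apply: nfJ; rewrite (prime_regular prJ Jd rd); exists 1%N; exact: residue_length.
split=> //; split.
  by move=> E; apply: nfJ; rewrite E; exact: fin_len_refl.
move=> x y Jxy; apply: contrapT => /not_orP[nJx nJy]; apply: nfJ.
pose xs := submod_span ([set x] : set R^o).
have sx : submod xs by exact: span_submod.
pose I := [set r : R | J (r * x)].
have iI : ideal I.
  split; first by rewrite /I /= mul0r; exact: ideal0.
  move=> r s t Js Jt; rewrite /I /= mulrDl -mulrA.
  exact (idealD iJ (idealM r iJ Js) Jt).
have f1 : fin_len (setT : set R^o) (sadd (J : set R^o) xs).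
  apply: bigger; [exact: sadd_submod|exact: saddl|].
  by move=> E; apply: nJx; rewrite -E; apply: (saddr iJ); exact: sub_span.
have [k hk] : fin_len (setT : set R^o) I.
  apply: bigger => //; first by move=> r Jr; exact: idealMr.
  by move=> E; apply: nJy; rewrite -E /I /= mulrC.
apply: fin_len_trans f1 _; exists k.
apply: (@has_length_rel _ R^o R^o (fun r y => J (y - r * x)) setT I) hk.
- move=> r a a' z z' h1 h2; rewrite mulrDl -[r *: a]/(r * a) -mulrA opprD addrACA -[r *: z]/(r * z) -mulrBr.
  exact (idealD iJ (idealM r iJ h1) h2).
- exact: sadd_submod.
- exact: saddl.
- move=> r _; exists (r * x); last by rewrite subrr; exact: ideal0.
  by apply: (saddr iJ); apply/span1P; exists r.
- by move=> _ [b Jb [_ /span1P[r ->] <-]]; exists r => //; rewrite addrK.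
- move=> r z _ _ h; split=> [Ir|Jz].
    by rewrite -(subrK (r * x) z); exact: idealD.
  by rewrite /I /= -(subKr z (r * x)); exact: idealB.
Qed.

Lemma max_pow_regular d : regular_elt d -> exists n, ideal_pow m n `<=` pideal d.
Proof.
move=> /fin_len_regular[n hn]; exists n.
have := has_length_pow noeth loc hn; apply: subset_trans => x mx.
by rewrite -(mulr1 x); exact: (@idprod_in _ R^o).
Qed.

End DimensionOne.

(** * Orthogonals under a bilinear pairing with simple socle in the target *)

Section Pairing.
Variables (R : comNzRingType) (m : set R).
Hypotheses (noeth : noetherian R) (loc : local_with m).

(** The preimage of the socle of V/P. For a submodule P of Q it is P : m. *)
Definition socle_over (V : lmodType R) (P : set V) : set V :=
  [set w | forall r, m r -> P (r *: w)].

Lemma socle_over_submod (V : lmodType R) (P : set V) : submod P -> submod (socle_over P).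
Proof.
move=> sP; split=> [r _|r x y hx hy s ms]; first by rewrite scaler0; exact: submod0.
by rewrite scalerDr scalerA mulrC -scalerA; exact (submodD sP (submodZ r sP (hx _ ms)) (hy _ ms)).
Qed.

Lemma sub_socle (V : lmodType R) (P : set V) : submod P -> P `<=` socle_over P.
Proof. by move=> sP x Px r _; exact: submodZ. Qed.

Variables (U V W : lmodType R) (beta : U -> V -> W).
Hypothesis betal : forall r x x' y, beta (r *: x + x') y = r *: beta x y + beta x' y.
Hypothesis betar : forall r x y y', beta x (r *: y + y') = r *: beta x y + beta x y'.
Variable P : set W.
Hypothesis socP : has_length (socle_over P) P 1.

Definition perp (X : set U) : set V := [set v | forall x, X x -> P (beta x v)].

Let sP : submod P. Proof. by case: (has_length_submod socP). Qed.

Let beta0l y : beta 0 y = 0.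
Proof. by have := betal (-1) 0 0 y; rewrite scaler0 addr0 scaleN1r addNr. Qed.

Let beta0r x : beta x 0 = 0.
Proof. by have := betar (-1) x 0 0; rewrite scaler0 addr0 scaleN1r addNr. Qed.

Let betaZl r x y : beta (r *: x) y = r *: beta x y.
Proof. by have := betal r x 0 y; rewrite !addr0 beta0l addr0. Qed.

Lemma perp_submod X : submod (perp X).
Proof.
split=> [x _|r v v' hv hv' x Xx]; first by rewrite beta0r; exact: submod0.
by rewrite betar; exact (submodD sP (submodZ r sP (hv _ Xx)) (hv' _ Xx)).
Qed.

(** If Y/Y' is simple and generated by y, then v |-> beta(y, v) embeds perp(Y')/perp(Y) into the
    socle of W/P, which is simple. Each step of a composition series thus adds at most one. *)
Lemma perp_length (X Y : set U) n : has_length Y X n ->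
  exists2 j, (j <= n)%N & has_length (perp X) (perp Y) j.
Proof.
elim: n Y => [|n IH] Y.
  by move=> /has_length0[-> sY]; exists 0%N => //; apply: has_length_refl; exact: perp_submod.
move=> /has_lengthS[Y' sq hY']; have [j jn hj] := IH _ hY'.
have [sY sY' [Y'Y nYY'] mY] := sq.
have mYY' r y : m r -> Y y -> Y' (r *: y).
  move=> mr Yy; have /has_length1/has_length_pow := sq.
  by move=> /(_ _ noeth loc); rewrite ideal_pow1; [apply; exact: idprod_in|exact: max_ideal loc].
have /existsNP[y /not_implyP[Yy nY'y]] := nYY'.
have Yspan : Y `<=` sadd Y' (submod_span [set y]).
  have s1 := span_submod [set y].
  have sub : sadd Y' (submod_span [set y]) `<=` Y by apply: sadd_min => //; exact: span1_sub.
  have [E|<- //] := mY _ (sadd_submod sY' s1) (saddl s1) sub.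
  by case: nY'y; rewrite -E; apply: (saddr sY'); exact: sub_span.
have perpY v : perp Y' v -> P (beta y v) -> perp Y v.
  move=> hv Pyv _ /Yspan[y' Y'y' [_ /span1P[r ->] <-]].
  by rewrite addrC betal; exact (submodD sP (submodZ r sP Pyv) (hv _ Y'y')).
have perpYY' : perp Y `<=` perp Y' by move=> v hv x /Y'Y; exact: hv.
have socv v : perp Y' v -> socle_over P (beta y v).
  by move=> hv r mr; rewrite -betaZl; apply: hv; exact: mYY'.
have sp := perp_submod Y'.
suff [i i1 hi] : exists2 i, (i <= 1)%N & has_length (perp Y') (perp Y) i.
  by exists (j + i)%N; [rewrite -addn1; exact: leq_add|exact: has_length_trans hi].
(* The image of v |-> beta(y, v) together with P. By simplicity it is P, and the two orthogonals
   agree, or the whole socle, and they differ by one simple factor. *)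
pose L := [set w | socle_over P w /\ exists2 v, perp Y' v & P (beta y v - w)].
have sS := socle_over_submod sP.
have sL : submod L.
  split=> [|r w w' [hw [v pv Pv]] [hw' [v' pv' Pv']]].
    split; first exact: submod0.
    by exists 0; [exact: submod0|rewrite beta0r subrr; exact: submod0].
  split; first exact (submodD sS (submodZ r sS hw) hw').
  exists (r *: v + v'); first exact (submodD sp (submodZ r sp pv) pv').
  by rewrite betar opprD addrACA -scalerBr; exact (submodD sP (submodZ r sP Pv) Pv').
have PL : P `<=` L.
  move=> w Pw; split; first exact: sub_socle.
  by exists 0; [exact: submod0|rewrite beta0r sub0r; exact: submodN].
have [_ _ _ mS] : simple_quot (socle_over P) P by exact/has_length1.
have [E|E] := mS _ sL PL (fun w hw => hw.1).
  exists 0%N => //; apply/has_length0; split=> //.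
  rewrite eqEsubset; split=> // v pv; apply: perpY => //; rewrite -E; split; first exact: socv.
  by exists v => //; rewrite subrr; exact: submod0.
exists 1%N => //.
apply: (@has_length_rel _ _ _ (fun w v => P (beta y v - w)) _ _ _ _ _ _ _ _ _ _ _ socP) => //.
- by move=> r w w' v v' h h'; rewrite betar opprD addrACA -scalerBr; exact (submodD sP (submodZ r sP h) h').
- by move=> w; rewrite -E => -[].
- by move=> v pv; exists (beta y v); [exact: socv|rewrite subrr; exact: submod0].
- move=> w v _ pv Pv; split=> [Pw|pYv].
    by apply: perpY => //; rewrite -(subrK w (beta y v)); exact: submodD.
  by rewrite -(subKr (beta y v) w); apply: (submodB sP) => //; exact: pYv.
Qed.

End Pairing.

(** * Regular fractional ideals of R in Q *)

Section Lattices.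
Variables (R : comNzRingType) (m : set R) (Q : comUnitAlgType R).
Hypotheses (noeth : noetherian R) (loc : local_with m) (dim1 : has_dim (R^o : lmodType R) 1).
Hypothesis hQ : total_fractions Q.
Implicit Types (X Y Z K : set Q) (u q : Q).

Definition lattice X : Prop :=
  [/\ submod X, exists2 t, regular_elt t & X (t%:A) &
      exists2 s, regular_elt s & forall x, X x -> base (s *: x)].

Definition qscale u X : set Q := [set u * x | x in X].

Definition qmul X Y : set Q := submod_span [set x * y | x in X & y in Y].

Lemma algM (r s : R) : (r * s)%:A = r%:A * s%:A :> Q.
Proof. by rewrite mulr_algl scalerA. Qed.

Lemma baseP q : base q <-> exists r, q = r%:A.
Proof. by split=> [[r _ <-]|[r ->]]; exists r. Qed.

Lemma base_alg (r : R) : base (r%:A : Q). Proof. by exists r. Qed.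

Lemma base_submod : submod (@base R Q).
Proof.
split; first by exists 0; rewrite //= scale0r.
move=> r _ _ [a _ <-] [b _ <-]; exists (r * a + b) => //=.
by rewrite scalerDl scalerA.
Qed.

Lemma base1 : base (1 : Q). Proof. by exists 1; rewrite //= scale1r. Qed.

Lemma baseM q q' : base q -> base q' -> base (q * q').
Proof. by move=> [a _ <-] [b _ <-]; exists (a * b) => //=; rewrite algM. Qed.

Lemma alg_inj (r s : R) : r%:A = s%:A :> Q -> r = s.
Proof. by case: hQ => inj _ /inj. Qed.

Lemma regular_unit s : regular_elt s -> (s%:A : Q) \is a GRing.unit.
Proof. by case: hQ => _ [h _] /h. Qed.

Lemma unit_regular s : (s%:A : Q) \is a GRing.unit -> regular_elt s.
Proof.
move=> us r sr0; apply: alg_inj; rewrite scale0r; apply: (mulrI us).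
by rewrite mulr0 -algM sr0 scale0r.
Qed.

Lemma regularM (r s : R) : regular_elt r -> regular_elt s -> regular_elt (r * s).
Proof. by move=> rr rs x; rewrite -mulrA => /rr/rs. Qed.

Lemma regular1 : regular_elt (1 : R).
Proof. by move=> x; rewrite mul1r. Qed.

Lemma submod_mull X q : submod X -> submod [set x | X (q * x)].
Proof.
move=> sX; split=> /= [|r x y Xx Xy]; first by rewrite mulr0; exact: submod0.
by rewrite mulrDr -scalerAr; exact (submodD sX (submodZ r sX Xx) Xy).
Qed.

Lemma qscale_submod u X : submod X -> submod (qscale u X).
Proof.
move=> sX; split; first by exists 0; [exact: submod0|rewrite mulr0].
move=> r _ _ [x Xx <-] [y Xy <-]; exists (r *: x + y).
  exact (submodD sX (submodZ r sX Xx) Xy).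
by rewrite mulrDr scalerAr.
Qed.

Lemma qscale_in u X x : X x -> qscale u X (u * x). Proof. by exists x. Qed.

Lemma qscale_inv u X x : u \is a GRing.unit -> qscale u X x <-> X (u^-1 * x).
Proof.
move=> uu; split=> [[y Xy <-]|h]; first by rewrite mulKr.
by exists (u^-1 * x); rewrite ?mulVKr.
Qed.

Lemma qscale_mono u X Y : X `<=` Y -> qscale u X `<=` qscale u Y.
Proof. by move=> XY _ [x Xx <-]; apply: qscale_in; exact: XY. Qed.

Lemma qscale1 X : qscale 1 X = X.
Proof.
rewrite eqEsubset; split=> x; first by move=> [y Xy <-]; rewrite mul1r.
by move=> Xx; exists x; rewrite ?mul1r.
Qed.

Lemma qscaleM u v X : qscale u (qscale v X) = qscale (u * v) X.
Proof.
rewrite eqEsubset; split=> x; first by move=> [_ [y Xy <-] <-]; exists y; rewrite ?mulrA.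
by move=> [y Xy <-]; exists (v * y); [exact: qscale_in|rewrite mulrA].
Qed.

Lemma qmul_submod X Y : submod (qmul X Y). Proof. exact: span_submod. Qed.

Lemma qmul_in X Y x y : X x -> Y y -> qmul X Y (x * y).
Proof. by move=> Xx Yy; apply: sub_span; exists x => //; exists y. Qed.

Lemma qmul_min X Y Z : submod Z -> (forall x y, X x -> Y y -> Z (x * y)) -> qmul X Y `<=` Z.
Proof. by move=> sZ h; apply: span_min => // _ [x Xx [y Yy <-]]; exact: h. Qed.

Lemma colon_submod X Y : submod X -> submod (colon X Y).
Proof.
move=> sX; split=> [y _|r x x' hx hx' y Yy]; first by rewrite mul0r; exact: submod0.
by rewrite mulrDl -scalerAl; exact (submodD sX (submodZ r sX (hx _ Yy)) (hx' _ Yy)).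
Qed.

Lemma colon_anti X Y Z : Y `<=` Z -> colon X Z `<=` colon X Y.
Proof. by move=> YZ x hx y /YZ; exact: hx. Qed.

Lemma colon_qmul X Y Z : submod X -> colon (colon X Y) Z = colon X (qmul Y Z).
Proof.
move=> sX; rewrite eqEsubset; split=> x hx.
  have s1 := submod_mull x sX; apply: (qmul_min s1) => y z Yy Zz /=.
  by rewrite [y * z]mulrC mulrA; exact: hx.
by move=> z Zz y Yy; rewrite -mulrA [z * y]mulrC; apply: hx; exact: qmul_in.
Qed.

Lemma colon_qscale X Y u : u \is a GRing.unit -> colon X (qscale u Y) = qscale u^-1 (colon X Y).
Proof.
move=> uu; rewrite eqEsubset; split=> x hx.
  apply/qscale_inv; first by rewrite unitrV.
  by rewrite invrK => y Yy; rewrite mulrAC mulrC; apply: hx; exact: qscale_in.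
move=> _ [y Yy <-]; move: hx => [z hz <-].
by rewrite mulrACA mulVr // mul1r; exact: hz.
Qed.

Lemma unit_frac u : u \is a GRing.unit ->
  exists a s, [/\ regular_elt a, regular_elt s & u = a%:A / s%:A].
Proof.
case: hQ => _ [_ fr] uu; have [a [s [rs e]]] := fr u; exists a, s; split=> //.
apply: unit_regular; have -> : a%:A = u * s%:A by rewrite e divrK //; exact: regular_unit.
by rewrite unitrM uu regular_unit.
Qed.

Lemma lattice_base : lattice (@base R Q).
Proof.
split; first exact: base_submod.
  by exists 1; [exact: regular1|exact: base_alg].
by exists 1; [exact: regular1|move=> x; rewrite scale1r].
Qed.

Lemma lattice_submod X : lattice X -> submod X. Proof. by case. Qed.

Lemma lattice_sandwich X Y Z : lattice X -> lattice Z -> submod Y ->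
  X `<=` Y -> Y `<=` Z -> lattice Y.
Proof.
move=> [_ [t rt Xt] _] [_ _ [s rs Zs]] sY XY YZ; split=> //.
  by exists t => //; exact: XY.
by exists s => // x /YZ; exact: Zs.
Qed.

Lemma lattice_qscale u X : u \is a GRing.unit -> lattice X -> lattice (qscale u X).
Proof.
move=> uu [sX [t rt Xt] [s rs Xs]]; have [a [b [ra rb e]]] := unit_frac uu.
have ub := regular_unit rb.
split; first exact: qscale_submod.
  exists (a * t); first exact: regularM.
  exists (b *: t%:A); first exact: submodZ.
  by rewrite -[b *: _]mulr_algl e mulrA divrK // algM.
exists (b * s); first exact: regularM.
move=> _ [x Xx <-].
have -> : (b * s) *: (u * x) = a%:A * (s *: x).
  rewrite -[LHS]mulr_algl -[s *: x]mulr_algl algM e; move: (b%:A) ub => B uB.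
  by rewrite -[RHS](mulKr uB); ring.
by apply: baseM; [exact: base_alg|exact: Xs].
Qed.

Lemma lattice_absorb X Y : lattice X -> lattice Y ->
  exists2 d, regular_elt d & qscale (d%:A) Y `<=` X.
Proof.
move=> [sX [t rt Xt] _] [_ _ [s rs Ys]]; exists (t * s); first exact: regularM.
move=> _ [y Yy <-]; have /baseP[r e] := Ys _ Yy.
by rewrite mulr_algl mulrC -scalerA scalerA mulrC -scalerA e scalerA mulrC -scalerA; exact: submodZ.
Qed.

Lemma lattice_add X Y : lattice X -> lattice Y -> lattice (sadd X Y).
Proof.
move=> [sX [t rt Xt] [s rs Xs]] [sY _ [s' rs' Ys]]; split; first exact: sadd_submod.
  by exists t => //; exact: saddl.
exists (s * s'); first exact: regularM.
move=> _ [x Xx [y Yy <-]]; rewrite scalerDr; apply: (submodD base_submod).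
  by rewrite mulrC -scalerA; apply: (submodZ _ base_submod); exact: Xs.
by rewrite -scalerA; apply: (submodZ _ base_submod); exact: Ys.
Qed.

Lemma lattice_colon X Y : lattice X -> lattice Y -> lattice (colon X Y).
Proof.
move=> lX lY; have [d rd dY] := lattice_absorb lX lY.
have [sX _ [s rs Xs]] := lX; have [sY [t rt Yt] _] := lY.
split; first exact: colon_submod.
  by exists d => // y Yy; apply: dY; exact: qscale_in.
exists (t * s); first exact: regularM.
move=> q /(_ _ Yt) /Xs; rewrite mulrC mulr_algl scalerA mulrC.
by [].
Qed.

Lemma lattice_qmul X Y : lattice X -> lattice Y -> lattice (qmul X Y).
Proof.
move=> [sX [t rt Xt] [s rs Xs]] [sY [t' rt' Yt] [s' rs' Ys]].
split; first exact: qmul_submod.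
  by exists (t * t'); [exact: regularM|rewrite algM; exact: qmul_in].
exists (s * s'); first exact: regularM.
suff : qmul X Y `<=` [set z | base (s * s' *: z)] by [].
apply: qmul_min => [|x y Xx Yy] /=.
  split=> /= [|r z z' h h']; first by rewrite scaler0; exact: submod0 base_submod.
  rewrite scalerDr scalerA [_ * r]mulrC -[(r * _) *: _]scalerA.
  exact (submodD base_submod (submodZ r base_submod h) h').
have -> : s * s' *: (x * y) = (s *: x) * (s' *: y) by rewrite -scalerAl -scalerAr scalerA.
by apply: baseM; [exact: Xs|exact: Ys].
Qed.

Lemma lattice_fin_gen X : lattice X -> fin_gen X.
Proof.
move=> [sX _ [s rs Xs]]; have us := regular_unit rs.
pose J := [set r : R | X (s%:A^-1 * r%:A)].
have iJ : ideal J.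
  split; first by rewrite /J /= scale0r mulr0; exact: submod0.
  move=> r a b Ja Jb; rewrite /J /= scalerDl mulrDr -[r *: a]/(r * a) -scalerA -scalerAr.
  exact (submodD sX (submodZ r sX Ja) Jb).
have [n [e eJ]] := noeth iJ.
exists n, (fun i => s%:A^-1 * (e i)%:A); rewrite eqEsubset; split; last first.
  apply: span_range_sub => // i; suff : J (e i) by [].
  by rewrite eJ; exact: (@span_in _ R^o).
move=> x Xx; have /baseP[r er] := Xs _ Xx.
have ex : x = s%:A^-1 * r%:A by rewrite -er -[s *: x]mulr_algl mulKr.
have : J r by rewrite /J /= -ex.
rewrite eJ => /(@span_rangeP _ R^o)[c ec]; apply/span_rangeP; exists c.
rewrite ex ec scaler_suml mulr_sumr; apply: eq_bigr => i _.
by rewrite -[c i *: e i]/(c i * e i) -scalerA -scalerAr.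
Qed.

(** Some regular multiple dY lies in X, so each generator of Y contributes a quotient of R/dR. *)
Lemma lattice_fin_len X Y : lattice X -> lattice Y -> X `<=` Y -> fin_len Y X.
Proof.
move=> lX lY XY; have [d rd dY] := lattice_absorb lX lY.
have [n gY] := lattice_fin_gen lY.
have <- : sadd X Y = Y.
  rewrite eqEsubset; split; last by apply: saddr; exact: lattice_submod.
  by apply: sadd_min => //; exact: lattice_submod.
apply: (fin_len_gen (J := pideal d) (n := n)) => //.
- exact: pideal_ideal.
- exact: (fin_len_regular noeth loc dim1).
- exact: lattice_submod.
- apply: idprod_min => [|r y /pidealP[s ->] Yy]; first exact: lattice_submod.
  rewrite -scalerA; apply: (submodZ _ (lattice_submod lX)); apply: dY.
  by rewrite -[d *: y]mulr_algl; exact: qscale_in.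
Qed.

Lemma has_length_qscale u X Y n : u \is a GRing.unit ->
  has_length X Y n -> has_length (qscale u X) (qscale u Y) n.
Proof.
move=> uu h; have [sX sY] := has_length_submod h.
apply: (@has_length_rel _ _ _ (fun x y => y = u * x)) (h).
- by move=> r x x' _ _ -> ->; rewrite mulrDr scalerAr.
- exact: qscale_submod.
- exact: qscale_mono (has_length_sub h).
- by move=> x Xx; exists (u * x) => //; exact: qscale_in.
- by move=> _ [x Xx <-]; exists x.
- move=> x _ Xx _ ->; split=> [Yx|]; first exact: qscale_in.
  by move=> /(qscale_inv _ _ uu); rewrite mulKr.
Qed.

(** Compute l(Y/dX) through X and through dY: it is l(Y/X) + l(X/dX) and l(Y/dY) + l(dY/dX), and
    l(dY/dX) = l(Y/X). Hence l(X/dX) does not depend on the lattice. *)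
Lemma lattice_index_sub X Y d n : regular_elt d -> lattice X -> lattice Y -> X `<=` Y ->
  has_length X (qscale (d%:A) X) n -> has_length Y (qscale (d%:A) Y) n.
Proof.
move=> rd lX lY XY hX; have ud := regular_unit rd.
have [sX sY] := (lattice_submod lX, lattice_submod lY).
have dYY : qscale d%:A Y `<=` Y by move=> _ [y Yy <-]; rewrite mulr_algl; exact: submodZ.
have dXX : qscale d%:A X `<=` X by move=> _ [y Yy <-]; rewrite mulr_algl; exact: submodZ.
have [a ha] := lattice_fin_len lX lY XY.
have [k hk] := lattice_fin_len (lattice_qscale ud lY) lY dYY.
have h1 := has_length_trans hk (has_length_qscale ud ha).
have h2 := has_length_trans ha hX.
suff -> : n = k by [].
by apply/eqP; rewrite -(eqn_add2l a) (has_length_uniq h2 h1) addnC.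
Qed.

Lemma lattice_index X Y d n : regular_elt d -> lattice X -> lattice Y ->
  has_length X (qscale (d%:A) X) n -> has_length Y (qscale (d%:A) Y) n.
Proof.
move=> rd lX lY hX; have [e re eX] := lattice_absorb lY lX.
have ud := regular_unit rd; have ue := regular_unit re.
apply: (lattice_index_sub rd (lattice_qscale ue lX) lY eX).
by rewrite qscaleM mulrC -qscaleM; exact: has_length_qscale.
Qed.

(** * The dual X |-> K : X *)

Section Duality.
Variable K : set Q.
Hypotheses (lK : lattice K) (socK : has_length (socle_over m K) K 1).

Lemma colon_length_le X Y n : has_length Y X n ->
  exists2 j, (j <= n)%N & has_length (colon K X) (colon K Y) j.
Proof.
have b1 (r : R) (x x' y : Q) : y * (r *: x + x') = r *: (y * x) + y * x'.
  by rewrite mulrDr scalerAr.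
have b2 (r : R) (x y y' : Q) : (r *: y + y') * x = r *: (y * x) + y' * x.
  by rewrite mulrDl scalerAl.
exact: (@perp_length R m noeth loc Q Q Q (fun x y => y * x) b1 b2 K socK X Y n).
Qed.

Lemma colon_base : colon K (@base R Q) = K.
Proof.
have sK := lattice_submod lK; rewrite eqEsubset; split=> x.
  by move=> /(_ _ base1); rewrite mulr1.
by move=> Kx _ [r _ <-]; rewrite mulrC /= mulr_algl; exact: submodZ.
Qed.

(* Colons do not increase lengths; nothing is lost since a multiple of Y / X lies
   between R and dR, and l(R / dR) = l(K / dK). *)
Lemma colon_length X Y n : lattice X -> lattice Y ->
  has_length Y X n -> has_length (colon K X) (colon K Y) n.
Proof.
move=> lX lY hXY; have [_ _ [s rs Ys]] := lY; have us := regular_unit rs.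
pose X' := qscale s%:A X; pose Y' := qscale s%:A Y.
have XY := has_length_sub hXY.
have Y'R : Y' `<=` @base R Q by move=> _ [y Yy <-]; rewrite mulr_algl; exact: Ys.
have lX' : lattice X' by exact: lattice_qscale.
have lY' : lattice Y' by exact: lattice_qscale.
have [sX' [d rd X'd] _] := lX'; have ud := regular_unit rd.
pose D := qscale d%:A (@base R Q).
have lD : lattice D by apply: lattice_qscale => //; exact: lattice_base.
have DX' : D `<=` X' by move=> _ [_ [r _ <-] <-]; rewrite mulrC /= mulr_algl; exact: submodZ.
have hX'Y' : has_length Y' X' n by exact: has_length_qscale.
have [a ha] := lattice_fin_len lY' lattice_base Y'R.
have [b hb] := lattice_fin_len lD lX' DX'.
have [a' a'a ha'] := colon_length_le ha.
have [n' n'n hn'] := colon_length_le hX'Y'.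
have [b' b'b hb'] := colon_length_le hb.
have E : (b' + (n' + a') = a + (n + b))%N.
  have h1 := has_length_trans hb' (has_length_trans hn' ha').
  have h2 := has_length_trans ha (has_length_trans hX'Y' hb).
  have h3 := lattice_index rd lattice_base lK h2.
  have := has_length_qscale (_ : d%:A^-1 \is a GRing.unit) h3.
  rewrite unitrV => /(_ ud); rewrite qscaleM mulVr // qscale1.
  by move: h1; rewrite /D colon_qscale // colon_base; exact: has_length_uniq.
have En : n' = n by lia.
move: hn'; rewrite En /X' /Y' !colon_qscale // => h.
have := has_length_qscale us h; rewrite !qscaleM mulrV // !qscale1.
by [].
Qed.

(** X lies in its bidual with finite colength n. Dualizing the inclusion preserves n, yet the third
    dual equals the first, so n is 0. *)
Lemma colon_bidual X : lattice X -> colon K (colon K X) = X.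
Proof.
move=> lX; have l1 := lattice_colon lK lX; have l2 := lattice_colon lK l1.
have sub : X `<=` colon K (colon K X) by move=> x Xx y hy; rewrite mulrC; exact: hy.
have [n hn] := lattice_fin_len lX l2 sub.
have := colon_length lX l2 hn.
have -> : colon K (colon K (colon K X)) = colon K X.
  rewrite eqEsubset; split; first exact: colon_anti.
  by move=> y hy z hz; rewrite mulrC; exact: hz.
move=> h; have n0 := has_length_uniq h (has_length_refl (lattice_submod l1)).
by move: hn; rewrite n0 => /has_length0[].
Qed.

Lemma colon_inj X Y : lattice X -> lattice Y -> colon K X = colon K Y -> X = Y.
Proof. by move=> lX lY E; rewrite -(colon_bidual lX) -(colon_bidual lY) E. Qed.

Lemma colon_self : colon K K = @base R Q.
Proof. by rewrite -[in X in colon _ X]colon_base colon_bidual //; exact: lattice_base. Qed.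

Lemma colon_add X Y : submod X -> submod Y -> colon K (sadd X Y) = colon K X `&` colon K Y.
Proof.
move=> sX sY; have sK := lattice_submod lK; rewrite eqEsubset; split=> q.
  by move=> hq; split=> y h; apply: hq; [exact: saddl|exact: saddr].
by move=> [h1 h2] _ [x Xx [y Yy <-]]; rewrite mulrDr; exact (submodD sK (h1 _ Xx) (h2 _ Yy)).
Qed.

End Duality.
End Lattices.

Section LinearMaps.
Variables (R : comNzRingType) (V W : lmodType R) (f : V -> W).
Hypothesis lin : forall r x y, f (r *: x + y) = r *: f x + f y.

(** The alias carries the linearity proof as an argument, so that a structure instance can be
    attached to it for an arbitrary function. *)
Definition linear_alias (_ : forall r x y, f (r *: x + y) = r *: f x + f y) := f.
HB.instance Definition _ := GRing.isLinear.Build R V W *:%R (linear_alias lin) lin.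

Lemma linear_exists : exists g : {linear V -> W}, forall x, g x = f x.
Proof. by exists (linear_alias lin). Qed.
End LinearMaps.

Definition mults (R : comNzRingType) (M : lmodType R) (x : R) : set M := [set x *: w | w in setT].

Arguments mults {R} M x.

Lemma mults_submod (R : comNzRingType) (M : lmodType R) (x : R) : submod (mults M x).
Proof.
split; first by exists 0; rewrite ?scaler0.
move=> r _ _ [a _ <-] [b _ <-]; exists (r *: a + b) => //.
by rewrite scalerDr !scalerA mulrC.
Qed.

(** * Ext^1(R/m, M) as the socle of M/xM *)

Section ExtOne.
Variables (R : comNzRingType) (m : set R).
Hypotheses (noeth : noetherian R) (loc : local_with m).
Variables (N : lmodType R) (F : nat -> lmodType R) (eps : {linear F 0%N -> N}).
Variable d : forall i, {linear F i.+1 -> F i}.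
Hypotheses (qN : is_quotient m N) (prF : forall i, projective_mod (F i)).
Hypotheses (ceps : range eps = setT) (d0 : range (d 0%N) = kernel eps).
Hypothesis d1 : forall i, range (d i.+1) = kernel (d i).

(** A substitute for uniqueness of resolutions up to homotopy: [alpha] lifts [eps] to R, and [u]
    lifts the class of 1. The composite z |-> alpha(z) u is the identity up to the kernel of [eps],
    and alpha(u) is 1 modulo m. *)
Lemma projective_cover_compare : exists (alpha : {linear F 0%N -> R^o}) (u : F 0%N),
  [/\ forall z, eps z = 0 -> m (alpha z),
      forall r, m r -> eps (r *: u) = 0,
      forall z, eps (z - alpha z *: u) = 0 & m (alpha u - 1)].
Proof.
have [p [pT kp]] := qN.
have kerp r : p r = 0 <-> m r by rewrite -kp.
have [alpha ha] := (prF eps pT).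
have [u _ eu] : range eps (p 1) by rewrite ceps.
have pE (r : R) : p r = r *: p 1 by rewrite -linearZ /= -[r *: (1 : R^o)]/(r * 1) mulr1.
exists alpha, u; split.
- by move=> z ez; apply/kerp; rewrite ha.
- by move=> r /kerp pr; rewrite linearZ /= eu -pE.
- by move=> z; rewrite linearB linearZ /= eu -pE ha subrr.
- by apply/kerp; rewrite linearB /= ha eu subrr.
Qed.

Variables (M : lmodType R) (x : R).
Hypotheses (mx : m x) (regx : forall y : M, x *: y = 0 -> y = 0).

Definition cocycles1 : set (F 1%N -> M) :=
  [set f | exists g : {linear F 1%N -> M}, f = (g : F 1%N -> M) /\ forall z, g (d 1%N z) = 0].
Definition coboundaries1 : set (F 1%N -> M) :=
  [set f | exists g : {linear F 0%N -> M}, f = (fun z => g (d 0%N z))].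

Lemma cocycles1_submod : submod cocycles1.
Proof.
split; first by exists (\0%R : {linear F 1%N -> M}).
move=> r _ _ [f [-> hf]] [g [-> hg]].
have lin s a b : r *: f (s *: a + b) + g (s *: a + b) = s *: (r *: f a + g a) + (r *: f b + g b).
  by rewrite !linearP /= !scalerA [r * s]mulrC addrACA.
have [h eh] := linear_exists lin.
exists h; split; first by apply: funext => z; rewrite eh.
by move=> z; rewrite eh hf hg scaler0 addr0.
Qed.

Lemma coboundaries1_sub : coboundaries1 `<=` cocycles1.
Proof.
move=> _ [g ->].
have lin s a b : g (d 0%N (s *: a + b)) = s *: g (d 0%N a) + g (d 0%N b) by rewrite !linearP.
have [h eh] := linear_exists lin.
exists h; split; first by apply: funext => z; rewrite eh.
move=> z; rewrite eh; suff -> : d 0%N (d 1%N z) = 0 by rewrite linear0.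
have : range (d 1%N) (d 1%N z) by exists z.
by rewrite d1.
Qed.

Let injx (y y' : M) : x *: y = x *: y' -> y = y'.
Proof. by move=> e; apply/eqP; rewrite -subr_eq0; apply/eqP/regx; rewrite scalerBr e subrr. Qed.

Let dd z : d 0%N (d 1%N z) = 0.
Proof. by have : range (d 1%N) (d 1%N z); [exists z|rewrite d1]. Qed.

Let epsd z : eps (d 0%N z) = 0.
Proof. by have : range (d 0%N) (d 0%N z); [exists z|rewrite d0]. Qed.

(* Multiplication by the [M]-regular element [x] identifies Hom(m, M) / M with
   (x M : m) / x M; the correspondence with cocycles is up to a coboundary
   because [alpha] and [r |-> r u] are only inverse up to homotopy. *)
Lemma ext1_socle n : has_length cocycles1 coboundaries1 n <->
  has_length (socle_over m (mults M x)) (mults M x) n.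
Proof.
have [alpha [u [al mu tau alu]]] := projective_cover_compare.
have im := max_ideal loc.
(* A socle element w defines m -> M by r |-> x^-1 (r w). The cocycle g corresponds to w when it is
   this map composed with alpha and d, up to the coboundary of h. *)
pose rho (w : M) (g : F 1%N -> M) :=
  exists h : {linear F 0%N -> M}, forall y, x *: (g y - h (d 0%N y)) = alpha (d 0%N y) *: w.
have linrho r w w' g g' : rho w g -> rho w' g' -> rho (r *: w + w') (r *: g + g').
  move=> [h eh] [h' eh'].
  have lin s a b : r *: h (s *: a + b) + h' (s *: a + b) = s *: (r *: h a + h' a) + (r *: h b + h' b).
    by rewrite !linearP /= !scalerA [r * s]mulrC addrACA.
  have [k ek] := linear_exists lin.
  exists k => y; rewrite ek -[(r *: g + g') y]/(r *: g y + g' y).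
  rewrite opprD addrACA -scalerBr scalerDr scalerA [x * r]mulrC -scalerA eh eh'.
  by rewrite scalerDr !scalerA [_ * r]mulrC.
have AA' w : socle_over m (mults M x) w -> exists2 g, cocycles1 g & rho w g.
  move=> hw.
  have ex y : exists v, x *: v = alpha (d 0%N y) *: w.
    by have [v _ e] := hw _ (al _ (epsd y)); exists v.
  have [g eg] := choice ex.
  have lg r a b : g (r *: a + b) = r *: g a + g b.
    by apply: injx; rewrite eg !linearP /= !eg scalerDl scalerA.
  have [g' eg'] := linear_exists lg.
  exists (g' : F 1%N -> M).
    exists g'; split=> // z; apply: injx; rewrite eg' eg dd linear0 scale0r scaler0.
    by [].
  exists \0%R => y; rewrite subr0 eg' eg.
  by [].
have A'A g : cocycles1 g -> exists2 w, socle_over m (mults M x) w & rho w g.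
  move=> [g' [-> hg']].
  have lift z : eps z = 0 -> exists y, d 0%N y = z.
    by move=> ez; have : kernel eps z by []; rewrite -d0 => -[y _ <-]; exists y.
  have wd y y' : d 0%N y = d 0%N y' -> g' y = g' y'.
    move=> e; apply/eqP; rewrite -subr_eq0 -linearB /=; apply/eqP.
    have : kernel (d 0%N) (y - y') by rewrite /kernel /= linearB e subrr.
    by rewrite -d1 => -[z _ <-].
  (* As x is in m, the element x u is a boundary; the value of g' at a preimage y0 of it is the
     required w. The correction h is g' evaluated on preimages of z - alpha(z) u. *)
  have [y0 ey0] := lift _ (mu _ mx).
  have ext z : exists y, d 0%N y = z - alpha z *: u by apply: lift; exact: tau.
  have [t et] := choice ext.
  have lt r a b : g' (t (r *: a + b)) = r *: g' (t a) + g' (t b).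
    rewrite -linearP /=; apply: wd; rewrite linearP !et linearP /=.
    by rewrite scalerBr scalerDl opprD addrACA -scalerA.
  have [h eh] := @linear_exists _ _ _ (fun z => g' (t z)) lt.
  exists (g' y0).
    move=> r mr; have [y1 ey1] := lift _ (mu _ mr).
    exists (g' y1) => //; rewrite -!linearZ /=; apply: wd.
    by rewrite !linearZ /= ey0 ey1 !scalerA mulrC.
  exists h => y; rewrite eh -linearB /= -!linearZ /=; apply: wd.
  by rewrite !linearZ linearB /= et ey0 opprB addrC subrK !scalerA mulrC.
have BB' w g : socle_over m (mults M x) w -> cocycles1 g -> rho w g ->
    mults M x w <-> coboundaries1 g.
  move=> hw [g' [eg _]] [h eh]; split=> [[w' _ ew]|[k ek]].
    have lin s a b : h (s *: a + b) + alpha (s *: a + b) *: w' = s *: (h a + alpha a *: w') + (h b + alpha b *: w').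
      by rewrite !linearP /= scalerDl scalerDr -scalerA addrACA.
    have [k ek] := linear_exists lin.
    exists k; apply: funext => y; rewrite ek; apply/eqP; rewrite addrC -subr_eq; apply/eqP.
    by apply: injx; rewrite eh -ew !scalerA mulrC.
  have key z : eps z = 0 -> x *: (k z - h z) = alpha z *: w.
    move=> ez; have : kernel eps z by []; rewrite -d0 => -[y _ <-].
    by rewrite -eh ek.
  have := key _ (mu _ mx); rewrite !linearZ /= -scalerDr -[x *: alpha u]/(x * alpha u) -scalerA.
  move=> /injx e2.
  have [s es] := local_unit1B noeth loc (idealN im alu).
  exists (s *: (k u - h u)) => //; rewrite scalerA mulrC -scalerA e2 scalerA.
  by move: es; rewrite opprK addrC subrK => ->; rewrite scale1r.
split.
  apply: (@has_length_rel _ _ _ (fun g w => rho w g)).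
  - by move=> r g g' w w'; exact: linrho.
  - exact: socle_over_submod (mults_submod M x).
  - exact: sub_socle (mults_submod M x).
  - exact: A'A.
  - exact: AA'.
  - by move=> g w cg sw r; exact: iff_sym (BB' _ _ sw cg r).
apply: (@has_length_rel _ _ _ rho) => //.
- exact: cocycles1_submod.
- exact: coboundaries1_sub.
Qed.

End ExtOne.

(** * Type, socles and embedding the canonical module into Q *)

Section CanonicalModule.
Variables (R : comNzRingType) (m : set R) (Q : comUnitAlgType R).
Hypotheses (noeth : noetherian R) (loc : local_with m) (dim1 : has_dim (R^o : lmodType R) 1).
Hypothesis hQ : total_fractions Q.

Lemma fin_gen_bounded (X : set Q) : fin_gen X ->
  exists2 s, regular_elt s & forall x, X x -> base (s *: x).
Proof.
move=> [n gX]; elim: n X gX => [|n IH] X gX.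
  exists 1; first exact: regular1.
  by rewrite (gen_by0 gX) => _ ->; rewrite scaler0; exact: submod0 (base_submod Q).
have [X' gX' [q ->]] := gen_byS gX; have [s rs Xs] := IH _ gX'.
have [_ [ru fr]] := hQ; have [a [t [rt eq]]] := fr q.
exists (s * t); first exact: regularM.
have sb := base_submod Q.
move=> _ [x Xx [_ /span1P[r ->] <-]]; rewrite scalerDr.
apply: (submodD sb); first by rewrite mulrC -scalerA; apply: (submodZ _ sb); exact: Xs.
rewrite -scalerA; apply: (submodZ _ sb); rewrite scalerA mulrC -scalerA; apply: (submodZ _ sb).
rewrite eq -[t *: _]mulr_algl mulrC divrK; first exact: base_alg.
exact: ru.
Qed.

(** Division by x identifies (xM : m)/xM with (X : m)/X. It reaches every q in X : m, because x is
    in m and so xq already lies in X. *)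
Lemma socle_transport (M : lmodType R) (f : {linear M -> Q}) (X : set Q) x n :
  submod X -> injective f -> range f = X -> m x -> regular_elt x ->
  has_length (socle_over m (mults M x)) (mults M x) n <-> has_length (socle_over m X) X n.
Proof.
move=> sX injf rf mx rx; have ux := regular_unit hQ rx.
have fX w : X (f w) by rewrite -rf; exists w.
have injx (q q' : Q) : x *: q = x *: q' -> q = q'.
  by rewrite -[x *: q]mulr_algl -[x *: q']mulr_algl; exact: mulrI.
have divx w : exists q : Q, x *: q = f w.
  by exists (x%:A^-1 * f w); rewrite -[x *: _]mulr_algl mulVKr.
pose rho (w : M) (q : Q) := x *: q = f w.
have lin r w w' q q' : rho w q -> rho w' q' -> rho (r *: w + w') (r *: q + q').
  by rewrite /rho linearP /= => <- <-; rewrite scalerDr !scalerA mulrC.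
have AA' w : socle_over m (mults M x) w -> exists2 q, socle_over m X q & rho w q.
  move=> hw; have [q eq] := divx w; exists q => // r mr; have [v _ ev] := hw _ mr.
  suff -> : r *: q = f v by [].
  by apply: injx; rewrite scalerA mulrC -scalerA eq -!linearZ /= ev.
have A'A q : socle_over m X q -> exists2 w, socle_over m (mults M x) w & rho w q.
  move=> hq; have := hq _ mx; rewrite -rf => -[w _ ew]; exists w => // r mr.
  have := hq _ mr; rewrite -rf => -[v _ ev]; exists v => //.
  by apply: injf; rewrite !linearZ /= ew ev !scalerA mulrC.
have BB' w q : rho w q -> mults M x w <-> X q.
  move=> e; split=> [[v _ ev]|]; last first.
    by rewrite -rf => -[v _ ev]; exists v => //; apply: injf; rewrite linearZ /= ev.
  suff -> : q = f v by [].
  by apply: injx; rewrite e -linearZ /= ev.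
split.
  apply: (@has_length_rel _ _ _ rho) => //.
  - exact: socle_over_submod.
  - exact: sub_socle.
  - by move=> w q _ _; exact: BB'.
apply: (@has_length_rel _ _ _ (fun q w => rho w q)) => //.
- by move=> r w w' q q'; exact: lin.
- exact: socle_over_submod (mults_submod M x).
- exact: sub_socle (mults_submod M x).
- by move=> q w _ _ h; exact: iff_sym (BB' _ _ h).
Qed.

Lemma canonical_depth (W : lmodType R) : canonical_module m W -> has_depth m W 1.
Proof.
move=> [_ [[d [h1 [h2 h3]]] _]].
by rewrite (has_dim_uniq dim1 h3).
Qed.

Lemma canonical_regular (W : lmodType R) : canonical_module m W ->
  exists2 x, m x & forall y : W, x *: y = 0 -> y = 0.
Proof. by move=> /canonical_depth[h _]; exact: regular_seq1 h. Qed.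

Lemma canonical_socle (W : lmodType R) x : canonical_module m W -> m x ->
  (forall y : W, x *: y = 0 -> y = 0) ->
  has_length (socle_over m (mults W x)) (mults W x) 1.
Proof.
move=> cW mx rx; have [_ [_ [[t [ht [N [qN hE]]]] _]]] := cW.
move: hE; rewrite (has_depth_uniq ht (canonical_depth cW)) => -[F [eps [d [prF [ceps [d0 [d1 h]]]]]]].
exact/(ext1_socle noeth loc qN prF ceps d0 d1 mx rx).
Qed.

(** [cm_type] is chosen by [xget], so a value must be exhibited and then identified. The resolution
    that exhibits one is borrowed from the type-one clause of W; the chosen value may come from
    another resolution, and the two are compared through the socle of R/xR. *)
Lemma cm_type_eq (W : lmodType R) x r : canonical_module m W -> has_depth m (R^o : lmodType R) 1 ->
  m x -> regular_elt x ->
  has_length (socle_over m (mults (R^o : lmodType R) x)) (mults R^o x) r ->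
  cm_type m R^o = r.
Proof.
move=> cW dR mx rx hr.
have rx' : forall y : (R^o : lmodType R), x *: y = 0 -> y = 0 by exact: rx.
have [_ [_ [[t [ht [N [qN hE]]]] _]]] := cW.
move: hE; rewrite (has_depth_uniq ht (canonical_depth cW)) => -[F [eps [d [prF [ceps [d0 [d1 _]]]]]]].
have hS : has_cm_type m (R^o : lmodType R) r.
  exists 1%N; split=> //; exists N; split=> //; exists F, eps, d; do 4!split=> //.
  exact (proj2 (ext1_socle noeth loc qN prF ceps d0 d1 mx rx' r) hr).
have [t' [ht' [N' [qN']]]] : has_cm_type m (R^o : lmodType R) (cm_type m R^o).
  exact (xgetPex 0%N (ex_intro (fun r => has_cm_type m (R^o : lmodType R) r) r hS)).
rewrite (has_depth_uniq ht' dR) => -[F' [eps' [d' [prF' [ceps' [d0' [d1' h]]]]]]].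
have := (ext1_socle noeth loc qN' prF' ceps' d0' d1' mx rx' (cm_type m R^o)).1 h.
by move=> h'; exact: has_length_uniq h' hr.
Qed.

Section Embedding.
Variables (M : lmodType R) (phi : {linear R^o -> M}) (x : R).
Hypotheses (fM : fin_gen (setT : set M)) (injphi : injective phi) (mx : m x).
Hypothesis rxM : forall y : M, x *: y = 0 -> y = 0.
Hypothesis socM : has_length (socle_over m (mults M x)) (mults M x) 1.

Let rX n : forall y : M, x ^+ n *: y = 0 -> y = 0.
Proof.
elim: n => [|n IH] y; first by rewrite scale1r.
by rewrite exprS -scalerA => /rxM/IH.
Qed.

Let phiE (r : R) : phi r = r *: phi 1.
Proof. by rewrite -linearZ /= -[r *: (1 : R^o)]/(r * 1) mulr1. Qed.

Let regXR n : regular_elt (x ^+ n).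
Proof.
move=> r e; apply: injphi; rewrite linear0; apply: (rX (n := n)).
by rewrite phiE scalerA e scale0r.
Qed.

Let rx : regular_elt x. Proof. by have := @regXR 1%N; rewrite expr1. Qed.

Let phi_submod : submod (range phi).
Proof.
split; first by exists 0; rewrite ?linear0.
by move=> r _ _ [a _ <-] [b _ <-]; exists (r *: a + b); rewrite ?linearP.
Qed.

(** For the scalar action R x M -> M read modulo xM, the orthogonal of xR is M and that of R is
    xM. *)
Lemma mults_length_le n : has_length (setT : set R^o) (pideal x) n ->
  exists2 j, (j <= n)%N & has_length (setT : set M) (mults M x) j.
Proof.
have b1 (r : R) (s s' : R^o) (y : M) : (r *: s + s') *: y = r *: (s *: y) + s' *: y.
  by rewrite scalerDl -scalerA.
have b2 (r : R) (s : R^o) (y y' : M) : (s : R) *: (r *: y + y') = r *: (s *: y) + s *: y'.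
  by rewrite scalerDr !scalerA mulrC.
move=> h; have [j jn] := @perp_length R m noeth loc R^o M M (fun s y => (s : R) *: y) b1 b2 _ socM _ _ n h.
set A := perp _ _ _; set B := perp _ _ _ => hj; exists j => //.
have -> : (setT : set M) = A.
  rewrite eqEsubset; split=> // y _ s /pidealP[r ->].
  by rewrite mulrC -scalerA; exists (r *: y).
suff -> : mults M x = B by [].
rewrite eqEsubset; split=> [y hy s _|y]; last by move=> /(_ 1 I); rewrite scale1r.
exact: submodZ (mults_submod M x) hy.
Qed.

(** The preimage of the x-power torsion of M/phi(R). Once it is all of M, each element of M is a
    fraction r/x^n. *)
Definition torsion_hull : set M := [set w | exists n r, x ^+ n *: w = phi r].

Lemma torsion_hull_submod : submod torsion_hull.
Proof.
split; first by exists 0%N, 0; rewrite scaler0 linear0.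
move=> r w w' [n [a ea]] [n' [a' ea']]; exists (n + n')%N, (r * (x ^+ n' * a) + x ^+ n * a').
have e1 : x ^+ (n + n') *: (r *: w) = (r * x ^+ n') *: (x ^+ n *: w).
  by rewrite !scalerA exprD; congr (_ *: _); move: (x ^+ n) (x ^+ n') => a0 b0; ring.
have e2 : x ^+ (n + n') *: w' = x ^+ n *: (x ^+ n' *: w') by rewrite !scalerA -exprD.
by rewrite scalerDr e1 e2 ea ea' phiE [phi a']phiE [RHS]phiE !scalerA scalerDl mulrA.
Qed.

Lemma torsion_hull_bounded : exists n, forall w, torsion_hull w -> exists r, x ^+ n *: w = phi r.
Proof.
have [k [e eD]] := noetherian_submod noeth fM torsion_hull_submod (@subsetT _ _).
have De i : torsion_hull (e i) by rewrite eD; exact: span_in.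
have [g hg] := choice De; exists (\max_i g i)%N => w.
have s1 : submod [set w | exists r, x ^+ (\max_i g i)%N *: w = phi r].
  split; first by exists 0; rewrite scaler0 linear0.
  move=> r a a' [b eb] [b' eb']; exists (r * b + b').
  by rewrite linearP /= eb eb' -linearP.
rewrite eD; apply: (span_range_sub s1) => i /=; have [r er] := hg i.
exists (x ^+ (\max_i g i - g i) * r); rewrite phiE -scalerA -phiE -er scalerA -exprD subnK //.
exact: (leq_bigmax i).
Qed.

(** Let D be the hull. It contains phi(R) with finite colength, so l(D/xD) = l(R/xR), which is at
    least l(M/xM). As D ∩ xM = xD, the module D/xD embeds into M/xM, so D + xM = M, and Nakayama
    concludes. *)
Lemma torsion_hull_full w : torsion_hull w.
Proof.
have [n hn] := fin_len_regular noeth loc dim1 rx.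
have [j jn hj] := mults_length_le hn.
have sD := torsion_hull_submod; have sxM := mults_submod M x.
have [n0 hn0] := torsion_hull_bounded.
have phiD : range phi `<=` torsion_hull by move=> _ [r _ <-]; exists 0%N, r; rewrite scale1r.
have [k gD] := noetherian_submod noeth fM sD (@subsetT _ _).
have [a ha] : fin_len torsion_hull (range phi).
  have <- : sadd (range phi) torsion_hull = torsion_hull.
    by rewrite eqEsubset; split; [exact: sadd_min|exact: saddr].
  apply: (fin_len_gen (J := pideal (x ^+ n0)) (n := k)) => //.
  - exact: pideal_ideal.
  - exact: (fin_len_regular noeth loc dim1 (@regXR n0)).
  - apply: idprod_min => // r y /pidealP[s ->] /hn0[b eb].
    by rewrite -scalerA eb; apply: (submodZ _ phi_submod); exists b.
pose tm (A : set M) : set M := [set x *: y | y in A].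
have stm A : submod A -> submod (tm A).
  move=> sA; split; first by exists 0; [exact: submod0|rewrite scaler0].
  move=> r _ _ [y Ay <-] [z Az <-]; exists (r *: y + z); first exact (submodD sA (submodZ r sA Ay) Az).
  by rewrite scalerDr !scalerA mulrC.
have injx (y y' : M) : x *: y = x *: y' -> y = y'.
  by move=> e; apply/eqP; rewrite -subr_eq0; apply/eqP/rxM; rewrite scalerBr e subrr.
have htm : has_length (tm torsion_hull) (tm (range phi)) a.
  apply: (@has_length_rel _ _ _ (fun y z => z = x *: y)) ha.
  - by move=> r y y' _ _ -> ->; rewrite scalerDr !scalerA mulrC.
  - exact: stm.
  - by move=> _ [y py <-]; exists y => //; exact: phiD.
  - by move=> y Dy; exists (x *: y) => //; exists y.
  - by move=> _ [y Dy <-]; exists y.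
  - by move=> y _ Dy _ ->; split=> [py|[y' py' /injx <-//]]; exists y.
have hphi : has_length (range phi) (tm (range phi)) n.
  apply: (@has_length_rel _ R^o _ (fun r z => z = phi r)) hn.
  - by move=> r s s' _ _ -> ->; rewrite linearP.
  - exact: phi_submod.
  - by move=> _ [y py <-]; exact: submodZ.
  - by move=> r _; exists (phi r) => //; exists r.
  - by move=> _ [r _ <-]; exists r.
  - move=> r _ _ _ ->; split=> [/pidealP[s ->]|[_ [s _ <-] e]].
      by exists (phi s); [exists s|rewrite [RHS]phiE mulrC -scalerA -phiE].
    by apply/pidealP; exists s; apply: injphi; rewrite -e [RHS]phiE mulrC -scalerA -phiE.
have h1 := has_length_trans ha hphi.
have tDD : tm torsion_hull `<=` torsion_hull by move=> _ [y Dy <-]; exact: submodZ.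
have tphi : tm (range phi) `<=` tm torsion_hull by move=> _ [y py <-]; exists y => //; exact: phiD.
have [i [b [hi hb e]]] := has_length_split (stm _ sD) tphi tDD h1.
have ein : i = n by have := has_length_uniq hb htm; lia.
have eI : tm torsion_hull = torsion_hull `&` mults M x.
  rewrite eqEsubset; split=> y; first by move=> [z Dz <-]; split; [exact: submodZ|exists z].
  move=> [[c [r er]] [z _ ez]]; exists z => //; exists c.+1, r.
  by rewrite exprSr -scalerA ez.
have := has_length_modular sD sxM; rewrite -eI => /(_ _ hi) hs.
have [le eqs] := has_length_le (sadd_submod sD sxM) (saddr sD) (@subsetT _ _) hj hs.
have full : sadd torsion_hull (mults M x) = setT by apply: eqs; lia.
apply: (nakayama noeth loc fM sD) (I : setT w) => y _.
have : sadd torsion_hull (mults M x) y by rewrite full.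
move=> [z Dz [_ [v _ <-] <-]]; exists z => //; exists (x *: v) => //.
exact: idprod_in.
Qed.

Lemma embed_in_fractions : exists theta : {linear M -> Q},
  injective theta /\ forall r : R, theta (phi r) = r%:A.
Proof.
have [n hn] := torsion_hull_bounded.
have [g eg] := choice (fun w => hn w (torsion_hull_full w)).
have gP w r : x ^+ n *: w = phi r -> g w = r by move=> e; apply: injphi; rewrite -eg.
have ux := regular_unit hQ (@regXR n).
pose f w : Q := (g w)%:A / (x ^+ n)%:A.
have lin r w w' : f (r *: w + w') = r *: f w + f w'.
  rewrite /f (@gP _ (r * g w + g w')); last first.
    by rewrite [LHS]linearP /= !eg -linearP.
  by rewrite scalerDl mulrDl -[(r * g w)%:A]scalerA scalerAl.
have [theta et] := linear_exists lin; exists theta; split=> [w w'|r].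
  rewrite !et /f => /(mulIr (_ : (x ^+ n)%:A^-1 \is a GRing.unit)); rewrite unitrV => /(_ ux).
  move=> /(alg_inj hQ) e; apply/eqP; rewrite -subr_eq0; apply/eqP/(rX (n := n)).
  by rewrite scalerBr !eg e subrr.
rewrite et /f (@gP _ (x ^+ n * r)); last by rewrite [RHS]phiE -scalerA -phiE.
by rewrite algM mulrC mulKr.
Qed.

End Embedding.
End CanonicalModule.

(** * Uniqueness of canonical ideals and the algebra they generate *)

Section CanonicalIdeals.
Variables (R : comNzRingType) (m : set R) (Q : comUnitAlgType R).
Hypotheses (noeth : noetherian R) (loc : local_with m) (dim1 : has_dim (R^o : lmodType R) 1).
Hypothesis hQ : total_fractions Q.
Hypothesis hreg : exists2 x, m x & regular_elt x.

Lemma lattice_idprod (Y : set Q) : lattice Y -> lattice (idprod m Y).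
Proof.
move=> [sY [t rt Yt] [s rs Ys]]; have [x mx rx] := hreg; split; first exact: idprod_submod.
  exists (x * t); first exact: regularM.
  by rewrite -scalerA; exact: idprod_in.
by exists s => // y /(idprod_sub sY); exact: Ys.
Qed.

Lemma simple_cyclic (V : lmodType R) (Y : set V) : fin_gen Y -> has_length Y (idprod m Y) 1 ->
  exists2 y, Y y & Y = submod_span [set y].
Proof.
move=> fY /has_length1[sY sm [mY nYm] mx].
have /existsNP[y /not_implyP[Yy nmy]] := nYm; exists y => //.
have s1 := span_submod [set y].
have yY : submod_span [set y] `<=` Y by exact: span1_sub.
rewrite eqEsubset; split=> //; apply: (nakayama noeth loc fY s1) => z Yz.
rewrite saddC; have sub : sadd (idprod m Y) (submod_span [set y]) `<=` Y by exact: sadd_min.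
have [E|->//] := mx _ (sadd_submod sm s1) (saddl s1) sub.
by case: nmy; rewrite -E; apply: (saddr sm); exact: sub_span.
Qed.

(** For Y = L : K one has L : Y = K and L : mY = K : m, so l(Y/mY) = 1. Hence Y = yR is cyclic, and
    K = L : Y = y^-1 L. *)
Lemma canonical_unique (K L : set Q) : lattice K -> lattice L ->
  has_length (socle_over m K) K 1 -> has_length (socle_over m L) L 1 ->
  exists2 u, u \is a GRing.unit & K = qscale u L.
Proof.
move=> lK lL socK socL; pose Y := colon L K.
have lY : lattice Y by exact: lattice_colon.
have lmY := lattice_idprod lY; have sL := lattice_submod lL.
have EK : colon L Y = K by exact: (colon_bidual noeth loc dim1 hQ lL socL).
have Esoc : colon L (idprod m Y) = socle_over m K.
  rewrite -EK eqEsubset; split=> q hq.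
    by move=> r mr y Yy; rewrite -scalerAl scalerAr; apply: hq; exact: idprod_in.
  suff : idprod m Y `<=` [set z | L (q * z)] by [].
  apply: (idprod_min (submod_mull q sL)) => r y mr Yy /=.
  by rewrite -scalerAr scalerAl; exact: hq.
have [n hn] := lattice_fin_len noeth loc dim1 hQ lmY lY (idprod_sub (lattice_submod lY)).
have := colon_length noeth loc dim1 hQ lL socL lmY lY hn; rewrite EK Esoc => h.
rewrite (has_length_uniq h socK) in hn.
have [y Yy EY] := simple_cyclic (lattice_fin_gen noeth hQ lY) hn.
have uy : y \is a GRing.unit.
  have [_ [t rt]] := lY; rewrite EY => /span1P[r e] _.
  by have := regular_unit hQ rt; rewrite e -mulr_algl unitrM => /andP[].
have EYu : Y = qscale y (@base R Q).
  rewrite EY eqEsubset; split=> [_ /span1P[r ->]|_ [_ [r _ <-] <-]].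
    by exists (r%:A); [exact: base_alg|rewrite mulrC mulr_algl].
  by apply/span1P; exists r; rewrite mulrC /= mulr_algl.
exists y^-1; first by rewrite unitrV.
by rewrite -EK EYu colon_qscale // (colon_base lL).
Qed.

(** * A canonical ideal L with L/R free over R/c and cL inside c *)

Section NormalForm.
Variables (L : set Q) (k : nat) (e : 'I_k.+1 -> Q) (c : set R).
Hypotheses (lL : lattice L) (RL : @base R Q `<=` L) (socL : has_length (socle_over m L) L 1).
Hypotheses (ic : ideal c) (Le : forall i, L (e i)).
Hypothesis genL : forall x, L x -> exists r : 'I_k.+1 -> R, base (x - \sum_i r i *: e i).
Hypothesis indL : forall r : 'I_k.+1 -> R, base (\sum_i r i *: e i) -> forall i, c (r i).
Hypothesis cL : forall r x, c r -> L x -> exists2 s, c s & r *: x = s%:A.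

Let S := adjoin L.
Let C : set Q := [set r%:A | r in c].
Let sL : submod L := lattice_submod lL.

Lemma adjoin_subalg (K : set Q) : subalg (adjoin K).
Proof.
split; last split.
- split=> [A [sA _] _|r x y hx hy A hA KA]; first exact: submod0.
  by case: (hA) => sA _; exact (submodD sA (submodZ r sA (hx _ hA KA)) (hy _ hA KA)).
- by move=> A [_ []].
- by move=> x y hx hy A hA KA; case: (hA) => _ [_]; apply; [exact: hx|exact: hy].
Qed.

Lemma sub_adjoin (K : set Q) : K `<=` adjoin K.
Proof. by move=> x Kx A _; apply. Qed.

Lemma adjoin_submod : submod S. Proof. by case: (adjoin_subalg L). Qed.
Lemma adjoin1 : S 1. Proof. by case: (adjoin_subalg L) => _ []. Qed.
Lemma adjoinM x y : S x -> S y -> S (x * y).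
Proof. by case: (adjoin_subalg L) => _ [_]; apply. Qed.

(** The elements of Q that multiply c into itself form a subalgebra; it contains L, hence R[L]. *)
Lemma conductor_absorb r q : c r -> S q -> exists2 s, c s & r *: q = s%:A.
Proof.
move=> cr Sq; pose T := [set q : Q | forall r, c r -> exists2 s, c s & r *: q = s%:A].
have hT : subalg T.
  split; last split.
  - split=> [s cs|s x y hx hy t ct]; first by exists 0; [exact: ideal0|rewrite scaler0 scale0r].
    have [a ca ea] := hx _ ct; have [b cb eb] := hy _ ct; exists (s * a + b).
      exact (idealD ic (idealM s ic ca) cb).
    by rewrite scalerDr scalerA mulrC -scalerA ea eb scalerDl scalerA.
  - by move=> s cs; exists s.
  - move=> x y hx hy s cs; have [a ca ea] := hx _ cs; have [b cb eb] := hy _ ca; exists b => //.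
    by rewrite scalerAl ea mulr_algl.
by apply: Sq hT _ _ cr => x Lx s cs; exact: cL.
Qed.

Lemma conductor_regular : exists2 t, c t & regular_elt t.
Proof.
have [_ _ [s rs Ls]] := lL; exists s => //.
have := @indL (fun i => if i == ord0 then s else 0); rewrite (bigD1 ord0) //= big1 ?addr0.
  by move=> /(_ (Ls _ (Le _)) ord0); rewrite eqxx.
by move=> i /negbTE ->; rewrite scale0r.
Qed.

Lemma lattice_adjoin : lattice S.
Proof.
split; first exact: adjoin_submod.
  by exists 1; [exact: regular1|rewrite scale1r; exact: adjoin1].
have [t ct rt] := conductor_regular; exists t => // x Sx.
by have [s _ ->] := conductor_absorb ct Sx; exact: base_alg.
Qed.

Lemma conductorP r : c r <-> forall i, base (r *: e i).
Proof.
split=> [cr i|h]; first by have [s _ ->] := cL cr (Le i); exact: base_alg.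
have := @indL (fun i => if i == ord0 then r else 0); rewrite (bigD1 ord0) //= big1 ?addr0.
  by move=> /(_ (h _) ord0); rewrite eqxx.
by move=> i /negbTE ->; rewrite scale0r.
Qed.

Lemma alg_memP r : C r%:A <-> c r.
Proof. by split=> [[s cs /(alg_inj hQ) <-]|cr]; [|exists r]. Qed.

Lemma lattice_conductor : lattice C.
Proof.
split.
- split; first by exists 0; [exact: ideal0|rewrite scale0r].
  move=> r _ _ [a ca <-] [b cb <-]; exists (r * a + b).
    exact (idealD ic (idealM r ic ca) cb).
  by rewrite scalerDl scalerA.
- by have [t ct rt] := conductor_regular; exists t => //; exists t.
- by exists 1; [exact: regular1|move=> _ [r _ <-]; rewrite scale1r; exact: base_alg].
Qed.

Lemma conductorQ_eq : conductorQ L = C.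
Proof.
rewrite eqEsubset; split=> q; last first.
  move=> [r cr <-] y Sy; rewrite mulr_algl.
  by have [s _ ->] := conductor_absorb cr Sy; exact: base_alg.
move=> hq; have /baseP[r er] : base q by rewrite -(mulr1 q); apply: hq; exact: adjoin1.
exists r => //; apply/conductorP => i; rewrite -mulr_algl -er; apply: hq; exact: sub_adjoin.
Qed.

(** Since R = L : L and LS = S, the conductor R : S equals L : LS = L : S. *)
Lemma canonical_colon_adjoin : colon L S = C.
Proof.
rewrite -conductorQ_eq /conductorQ -(colon_self noeth loc dim1 hQ lL socL) (colon_qmul _ _ sL).
congr colon; rewrite eqEsubset; split.
  by move=> x Sx; rewrite -(mul1r x); apply: qmul_in => //; apply: RL; exact: base1.
by apply: (qmul_min adjoin_submod) => x y /sub_adjoin; exact: adjoinM.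
Qed.

Lemma canonical_colon_conductor : colon L C = S.
Proof. by rewrite -canonical_colon_adjoin; exact: (colon_bidual noeth loc dim1 hQ lL socL lattice_adjoin). Qed.

(** R : c = (L : L) : c = L : Lc with Lc = c, and L : c is the bidual of S. *)
Lemma base_colon_conductor : colon (@base R Q) C = S.
Proof.
rewrite -(colon_self noeth loc dim1 hQ lL socL) (colon_qmul _ _ sL) -canonical_colon_conductor.
congr colon; rewrite eqEsubset; split.
  apply: (qmul_min (lattice_submod lattice_conductor)) => x _ Lx [r cr <-].
  by rewrite mulrC mulr_algl; have [s cs ->] := cL cr Lx; exists s.
by move=> x Cx; rewrite -(mul1r x); apply: qmul_in => //; apply: RL; exact: base1.
Qed.

(** L^2 and S have the same dual: L : L^2 = R : L, which by freeness of L/R is c = L : S. *)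
Lemma canonical_square : qmul L L = S.
Proof.
apply: (colon_inj noeth loc dim1 hQ lL socL) lattice_adjoin _; first exact: lattice_qmul.
rewrite canonical_colon_adjoin -(colon_qmul _ _ sL) (colon_self noeth loc dim1 hQ lL socL).
rewrite eqEsubset; split=> q; last first.
  move=> [r cr <-] y Ly; rewrite mulr_algl.
  by have [s _ ->] := cL cr Ly; exact: base_alg.
move=> hq; have /baseP[r er] : base q by rewrite -(mulr1 q); apply: hq; apply: RL; exact: base1.
by exists r => //; apply/conductorP => i; rewrite -mulr_algl -er; exact: hq.
Qed.

(** As 1 is in K = uL, u^-1 lies in L. The element u is in K, hence integral, and its integral
    equation divided by a power of u expresses u as a polynomial in u^-1. So u is a unit of S and K
    lies in S. Conversely S = u^2 S = u^2 L^2 = K^2 lies in R[K]. *)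
Lemma adjoin_eq (K : set Q) u : u \is a GRing.unit -> K = qscale u L ->
  K 1 -> K `<=` @int_closure R Q -> adjoin K = S.
Proof.
move=> uu EK K1 Kint.
have Sv : S u^-1 by apply: sub_adjoin; move: K1; rewrite EK => /(qscale_inv _ _ uu); rewrite mulr1.
have Ku : K u by rewrite EK; exists 1; [apply: RL; exact: base1|rewrite mulr1].
have SX n x : S x -> S (x ^+ n).
  by move=> Sx; elim: n => [|n IH]; [exact: adjoin1|rewrite exprS; exact: adjoinM].
have sS := adjoin_submod.
have Su : S u.
  have [p mp /rootP] := Kint _ Ku.
  have : size (map_poly (in_alg Q) p) = size p.
    by apply: size_map_poly_id0; rewrite (monicP mp) /= scale1r oner_eq0.
  rewrite horner_coef => ->.
  have : p`_(size p).-1 = 1 by have /monicP := mp.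
  case E: (size p) => [|n]; last rewrite /= big_ord_recr /= coef_map => pn.
    by have := monic_neq0 mp; rewrite -size_poly_gt0 E.
  rewrite /= pn /= scale1r mul1r addrC => /eqP; rewrite addr_eq0 => /eqP eu.
  case: n eu {pn E} => [|n eu].
    by rewrite big_ord0 oppr0 expr0 => /eqP; rewrite oner_eq0.
  have -> : u = u ^+ n.+1 * u^-1 ^+ n by rewrite exprS -mulrA -exprMn divrr // expr1n mulr1.
  rewrite eu mulNr mulr_suml; apply: (submodN sS); apply: (submod_sum sS) => i _.
  rewrite coef_map /= -mulrA mulr_algl; apply: (submodZ _ sS).
  have -> : u^-1 ^+ n = u^-1 ^+ i * u^-1 ^+ (n - i) by rewrite -exprD subnKC // -ltnS.
  by rewrite mulrA -exprMn divrr // expr1n mul1r; exact: SX.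
rewrite eqEsubset; split.
  move=> x; apply; first exact: adjoin_subalg.
  by rewrite EK => _ [y Ly <-]; apply: adjoinM => //; exact: sub_adjoin.
have [sK [_ KM]] := adjoin_subalg K.
move=> s Ss; have : S (u^-1 ^+ 2 * s) by apply: adjoinM => //; exact: SX.
rewrite -canonical_square => h.
have -> : s = u ^+ 2 * (u^-1 ^+ 2 * s) by rewrite mulrA -exprMn divrr // expr1n mul1r.
suff : qmul L L `<=` [set z | adjoin K (u ^+ 2 * z)] by exact.
apply: (qmul_min (submod_mull _ sK)) => x y Lx Ly /=.
rewrite expr2 mulrACA; apply: KM; apply: sub_adjoin; rewrite EK; exact: qscale_in.
Qed.

End NormalForm.
End CanonicalIdeals.

(** * From the generalized Gorenstein condition to the normal form *)

Section GeneralizedGorenstein.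
Variables (R : comNzRingType) (m : set R) (Q : comUnitAlgType R).
Hypotheses (noeth : noetherian R) (loc : local_with m) (dim1 : has_dim (R^o : lmodType R) 1).
Hypothesis hQ : total_fractions Q.

Lemma rat_lim_eventually_const (u : nat -> nat) (a b n0 : nat) :
  (forall n, (n0 <= n)%N -> u n = a) -> rat_lim (fun n => (u n)%:R) b%:R -> a = b.
Proof.
move=> ua /(_ 1 ltr01)[n1 h].
have := h _ (leq_maxr n0 n1); rewrite ua ?leq_maxl // => lt.
apply/eqP; rewrite eqn_leq; apply/andP; split; rewrite leqNgt; apply/negP => ab.
  by move: lt; rewrite -natrB ?(ltnW ab) // normr_nat ltrn1; lia.
by move: lt; rewrite distrC -natrB ?(ltnW ab) // normr_nat ltrn1; lia.
Qed.

Lemma radical_pow (a : set R) : primary_to m a -> a `<=` m.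
Proof. by move=> [_ <-] r ar; exists 1%N; rewrite expr1. Qed.

Lemma ideal_pow_mono (I J : set R) n : I `<=` J -> ideal_pow I n `<=` ideal_pow J n.
Proof.
move=> IJ; elim: n => [//|n IH]; exact: (@idprod_mono _ R^o _ _ _ _ IJ IH).
Qed.

Lemma ideal_pow_dec (I : set R) n k : (n <= k)%N -> ideal_pow I k `<=` ideal_pow I n.
Proof.
move=> /subnK <-; rewrite ideal_powD; exact: (@idprod_sub _ R^o _ _ (ideal_pow_ideal I n)).
Qed.

(* As [C] has finite length, its multiplicity is its length. *)
Lemma ulrich_annihilated (a : set R) (C : lmodType R) s : primary_to m a ->
  fin_gen (setT : set C) -> regular_elt s -> (forall y : C, s *: y = 0) ->
  has_mult a C (len (setT : set C) (idprod a setT))%:R ->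
  idprod a (setT : set C) = [set 0].
Proof.
move=> pa fC rs sC [d [[dC _] lim]]; have s0 := @submod_zero R C.
have d0 : d = 0%N.
  case: d dC {lim} => [//|d [P [hP sP]]].
  have sann : annihilator C s by exact: sC.
  have Pm i : (i <= d.+1)%N -> P i = m.
    move=> /hP[prP annP]; apply: (prime_regular noeth loc dim1 prP _ rs); exact: annP.
  by have := sP 0%N (ltn0Sn _); rewrite !Pm // => -[_]; case.
rewrite d0 in lim.
have [k gC] := fC.
have [n hn] : fin_len (setT : set C) [set 0].
  have <- : sadd [set 0] (setT : set C) = setT.
    by rewrite eqEsubset; split=> //; exact: saddr.
  apply: (fin_len_gen (J := pideal s) (n := k)) => //.
  - exact: pideal_ideal.
  - exact: (fin_len_regular noeth loc dim1).
  - by apply: idprod_min => // r y /pidealP[t ->] _; rewrite -scalerA sC scaler0.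
have powC j : (n <= j)%N -> idprod (ideal_pow a j) (setT : set C) = [set 0].
  move=> nj; rewrite eqEsubset; split; last by move=> _ ->; exact: (submod0 (idprod_submod _ _)).
  apply: subset_trans (has_length_pow noeth loc hn); apply: idprod_mono => //.
  by apply: subset_trans (ideal_pow_dec nj); apply: ideal_pow_mono; exact: radical_pow.
have h0 : [set 0] `<=` idprod a (setT : set C) by move=> _ ->; exact: (submod0 (idprod_submod _ _)).
have [i [j [hi hj e]]] := has_length_split (idprod_submod a (setT : set C)) h0 (@subsetT _ _) hn.
have := @rat_lim_eventually_const (fun j => len (setT : set C) (idprod (ideal_pow a j) setT)) n
  (len (setT : set C) (idprod a setT)) n.
rewrite (len_eq hi) => ni.
have : n = i.
  apply: ni => [t nt|]; first by rewrite powC // (len_eq hn).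
  move: lim; rewrite (len_eq hi); congr rat_lim; apply: funext => t.
  by rewrite fact0 expr0 mul1r divr1.
move=> en; have j0 : j = 0%N by lia.
by move: hj; rewrite j0 => /has_length0[].
Qed.

(** The sequence R -> W -> C is embedded in Q with phi(1) = 1, and L is the image of W. Then L/R is
    C, killed by c and free over R/c; the rank is written k + 1 because C is nonzero. That cL lies
    in c, and not merely in R, is the injectivity of R/c -> W/cW. *)
Lemma ggl_normal_form : ggl_ring m -> ~ gorenstein R ->
  exists (L : set Q) (k : nat) (e : 'I_k.+1 -> Q) (c : set R),
  [/\ [/\ lattice L, @base R Q `<=` L & has_length (socle_over m L) L 1],
      [/\ ideal c, c `<=` m & forall i, L (e i)],
      forall x, L x -> exists r : 'I_k.+1 -> R, base (x - \sum_i r i *: e i),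
      forall r : 'I_k.+1 -> R, base (\sum_i r i *: e i) -> forall i, c (r i) &
      forall r x, c r -> L x -> exists2 s, c s & r *: x = s%:A].
Proof.
move=> [_ [W [cW [//|[_ [C [phi [psi [c [injphi [kpsi [rpsi [pc [uC injc]]]]]]]]]]]]]] nG.
have [x mx rxW] := canonical_regular dim1 cW.
have sW := canonical_socle noeth loc dim1 cW mx rxW.
have fW : fin_gen (setT : set W) by case: cW.
have [theta [injt thphi]] := embed_in_fractions noeth loc dim1 hQ fW injphi mx rxW sW.
have phiE (r : R) : phi r = r *: phi 1.
  by rewrite -linearZ /= -[r *: (1 : R^o)]/(r * 1) mulr1.
have rx : regular_elt x.
  move=> r e; apply: injphi; rewrite linear0; apply: rxW.
  by rewrite phiE scalerA e scale0r.
pose L := range theta.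
have sL : submod L.
  split; first by exists 0; rewrite ?linear0.
  by move=> r _ _ [a _ <-] [b _ <-]; exists (r *: a + b); rewrite ?linearP.
have RL : @base R Q `<=` L by move=> _ [r _ <-]; exists (phi r) => //; rewrite thphi.
have [n0 [g eg]] := fW.
have EL : L = submod_span (range (theta \o g)).
  rewrite eqEsubset; split; last by apply: span_range_sub => // i; exists (g i).
  move=> _ [w _ <-]; have : setT w by []; rewrite eg => /span_rangeP[r ->].
  by apply/span_rangeP; exists r; rewrite linear_sum; apply: eq_bigr => i _; rewrite linearZ.
have [s rs Ls] : exists2 s, regular_elt s & forall x, L x -> base (s *: x).
  by apply: (fin_gen_bounded hQ); exists n0, (theta \o g).
have lL : lattice L.
  split=> //; last by exists s.
  by exists 1; [exact: regular1|apply: RL; exact: base_alg].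
have psi0 w : psi w = 0 <-> exists r, w = phi r.
  split=> [pw|[r ->]].
    by have : kernel psi w by []; rewrite -kpsi => -[r _ <-]; exists r.
  by have : range phi (phi r); [exists r|rewrite kpsi].
have baseth w : base (theta w) <-> psi w = 0.
  rewrite psi0; split=> [[r _ er]|[r ->]]; last by rewrite thphi; exact: base_alg.
  by exists r; apply: injt; rewrite thphi.
have sC (y : C) : s *: y = 0.
  have [w _ <-] : range psi y by rewrite rpsi.
  by rewrite -linearZ /=; apply/baseth; rewrite linearZ /=; apply: Ls; exists w.
have [[y0 ny0] [fC [_ [mC frC]]]] := uC.
have aC := ulrich_annihilated pc fC rs sC mC.
have ic : ideal c by case: pc => -[].
have mults r (y : C) : c r -> r *: y = 0.
  by move=> cr; have : idprod c (setT : set C) (r *: y); [exact: idprod_in|rewrite aC].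
move: frC; rewrite aC => -[n [f [_ [fgen find]]]].
case: n f fgen find => [|k] f fgen find.
  case: ny0; have [r] := fgen y0 I; rewrite big_ord0 subr0; exact.
have lift i : exists v, psi v = f i.
  by have [v _ <-] : range psi (f i); [rewrite rpsi|exists v].
have [w ew] := choice lift.
have psum (r : 'I_k.+1 -> R) : psi (\sum_i r i *: w i) = \sum_i r i *: f i.
  by rewrite linear_sum; apply: eq_bigr => i _; rewrite linearZ /= ew.
have tsum (r : 'I_k.+1 -> R) : theta (\sum_i r i *: w i) = \sum_i r i *: theta (w i).
  by rewrite linear_sum; apply: eq_bigr => i _; rewrite linearZ.
exists L, k, (fun i => theta (w i)), c; split.
- by split=> //; exact (proj1 (socle_transport hQ 1 sL injt (erefl _) mx rx) sW).
- by split=> // [|i]; [exact: radical_pow|exists (w i)].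
- move=> _ [v _ <-]; have [r er] := fgen (psi v) I; exists r.
  by rewrite -tsum -linearB; apply/baseth; rewrite linearB /= psum.
- move=> r; rewrite -tsum => /baseth; rewrite psum => h; exact: find.
- move=> r _ cr [v _ <-].
  have : psi (r *: v) = 0 by rewrite linearZ /=; exact: mults.
  move=> /psi0[t et]; exists t; last by rewrite -thphi -et linearZ.
  by apply: injc; rewrite -et; exact: idprod_in.
Qed.

End GeneralizedGorenstein.

(** Mostly used with first entry 1, to pass from a basis of L/R or A/R to generators of L or A. *)
Definition fcons (T : Type) n (x : T) (e : 'I_n -> T) (i : 'I_n.+1) : T :=
  if unlift ord0 i is Some j then e j else x.

Lemma fcons0 T n (x : T) (e : 'I_n -> T) : fcons x e ord0 = x.
Proof. by rewrite /fcons unlift_none. Qed.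

Lemma fconsS T n (x : T) (e : 'I_n -> T) j : fcons x e (lift ord0 j) = e j.
Proof. by rewrite /fcons liftK. Qed.

Lemma fcons_sum (R : comNzRingType) (V : lmodType R) n (x : V) (e : 'I_n -> V) (r : 'I_n.+1 -> R) :
  \sum_i r i *: fcons x e i = r ord0 *: x + \sum_i r (lift ord0 i) *: e i.
Proof. by rewrite big_ord_recl fcons0; congr (_ + _); apply: eq_bigr => i _; rewrite fconsS. Qed.

Lemma fcons_lincomb (R : comNzRingType) (V : lmodType R) n (x : V) (e : 'I_n -> V) t (r : 'I_n -> R) :
  \sum_i fcons t r i *: fcons x e i = t *: x + \sum_i r i *: e i.
Proof.
by rewrite fcons_sum fcons0; congr (_ + _); apply: eq_bigr => i _; rewrite fconsS.
Qed.

Lemma idprod_span (R : comNzRingType) (V : lmodType R) (I : set R) n (e : 'I_n -> V) x :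
  ideal I -> idprod I (submod_span (range e)) x ->
  exists2 r : 'I_n -> R, (forall i, I (r i)) & x = \sum_i r i *: e i.
Proof.
move=> iI; move: x; apply: (@idprod_min _ _ _ _ [set x | exists2 r : 'I_n -> R, (forall i, I (r i)) & x = \sum_i r i *: e i]).
  split; first by exists (fun=> 0) => [_|]; [exact: ideal0|rewrite big1 // => i _; rewrite scale0r].
  move=> r _ _ [a Ia ->] [b Ib ->]; exists (fun i => r * a i + b i) => [i|].
    exact (idealD iI (idealM r iI (Ia i)) (Ib i)).
  by rewrite scaler_sumr -big_split; apply: eq_bigr => i _; rewrite scalerDl scalerA.
move=> r x Ir /span_rangeP[a ->]; exists (fun i => r * a i) => [i|]; first exact: idealMr.
by rewrite scaler_sumr; apply: eq_bigr => i _; rewrite scalerA.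
Qed.

Lemma ideal_mul_pideal (R : comNzRingType) (a x : R) (I : set R) : ideal I ->
  ideal_mul (pideal a) I x <-> exists2 s, I s & x = a * s.
Proof.
move=> iI; split=> [|[s Is ->]]; last exact (ideal_mul_in (pideal_gen a) Is).
move: x; apply: (@idprod_min _ R^o _ _ [set x | exists2 s, I s & x = a * s]).
  split; first by exists 0; [exact: ideal0|rewrite mulr0].
  move=> r _ _ [s Is ->] [t It ->]; exists (r * s + t).
    exact (idealD iI (idealM r iI Is) It).
  by rewrite mulrDr mulrCA.
move=> r s /pidealP[t ->] Is; exists (t * s); first exact: idealM.
by rewrite -[_ *: s]/(t * a * s); ring.
Qed.

(** * Ulrich ideals and the rings A = a^-1 I *)

Section UlrichIdeals.
Variables (R : comNzRingType) (m : set R) (Q : comUnitAlgType R).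
Hypotheses (noeth : noetherian R) (loc : local_with m) (dim1 : has_dim (R^o : lmodType R) 1).
Hypothesis hQ : total_fractions Q.

Lemma alg_scale (r s : R) : r *: s%:A = (r * s)%:A :> Q.
Proof. by rewrite scalerA. Qed.

Lemma algD (r s : R) : (r + s)%:A = r%:A + s%:A :> Q.
Proof. by rewrite scalerDl. Qed.

Lemma algN (r : R) : (- r)%:A = - r%:A :> Q.
Proof. by rewrite scaleNr. Qed.

Lemma algB (r s : R) : (r - s)%:A = r%:A - s%:A :> Q.
Proof. by rewrite scalerBl. Qed.

Lemma alg_sum n (r : 'I_n -> R) : (\sum_i r i)%:A = \sum_i (r i)%:A :> Q.
Proof. by rewrite scaler_suml. Qed.

Lemma regular_scale_inj a (x y : Q) : regular_elt a -> a *: x = a *: y -> x = y.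
Proof.
move=> /(regular_unit hQ) ua; rewrite -[a *: x]mulr_algl -[a *: y]mulr_algl.
exact: mulrI.
Qed.

Lemma primary_to_max (J : set R) d : ideal J -> J `<=` m -> J d -> regular_elt d -> primary_to m J.
Proof.
move=> iJ Jm Jd rd; have [n hn] := max_pow_regular noeth loc dim1 rd.
have powm x k : m x -> ideal_pow m k (x ^+ k).
  move=> mx; elim: k => [//|k IH]; rewrite exprS.
  exact (ideal_mul_in mx IH).
have eJ : radical J = m.
  rewrite eqEsubset; split=> x.
    move=> [k /Jm]; elim: k => [|k IH].
      by rewrite expr0 => /(max_proper loc).
    by rewrite exprS => /(max_prime noeth loc)[|/IH].
  move=> mx; exists n; have /hn/pidealP[r ->] := powm x n mx.
  exact: idealM.
split=> //; split=> //; split=> [E|x y Jxy].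
  by apply: (max_proper loc); apply: Jm; rewrite E.
rewrite eJ; have [|/(local_unit noeth loc)[s es]] := pselect (m y); [by right|left].
by rewrite -(mulr1 x) -es [s * y]mulrC mulrA; exact: idealMr.
Qed.

(* [A] is the ring [I : I = a^-1 I]; the [f i] form a basis of the free
   R/I-module A / R. *)
Definition ulrich_data (I : set R) (a : R) (A : set Q) n (f : 'I_n -> Q) : Prop :=
  [/\ [/\ m a, regular_elt a, ideal I & I `<=` m],
      subalg A /\ (0 < n)%N,
      forall x, A x <-> exists2 r, I r & a *: x = r%:A,
      (forall i, A (f i)) /\ forall x, A x -> exists r : 'I_n -> R, base (x - \sum_i r i *: f i) &
      forall r : 'I_n -> R, base (\sum_i r i *: f i) -> forall i, I (r i)].

Section Data.
Variables (I : set R) (a : R) (A : set Q) (n : nat) (f : 'I_n -> Q).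
Hypothesis hU : ulrich_data I a A f.

Let ma : m a. Proof. by case: hU => -[]. Qed.
Let ra : regular_elt a. Proof. by case: hU => -[]. Qed.
Let iI : ideal I. Proof. by case: hU => -[]. Qed.
Let Im : I `<=` m. Proof. by case: hU => -[]. Qed.
Let AP x : A x <-> exists2 r, I r & a *: x = r%:A. Proof. by case: hU. Qed.
Let sA : submod A. Proof. by case: hU => _ [[]]. Qed.
Let A1 : A 1. Proof. by case: hU => _ [[_ []]]. Qed.
Let AM x y : A x -> A y -> A (x * y). Proof. by case: hU => _ [[_ [_ h]] _] _ _ _; exact: h. Qed.
Let n0 : (0 < n)%N. Proof. by case: hU => _ []. Qed.
Let Af i : A (f i). Proof. by case: hU => _ _ _ []. Qed.
Let genA x : A x -> exists r : 'I_n -> R, base (x - \sum_i r i *: f i).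
Proof. by case: hU => _ _ _ [_ h] _; exact: h. Qed.
Let indA (r : 'I_n -> R) : base (\sum_i r i *: f i) -> forall i, I (r i).
Proof. by case: hU => _ _ _ _; apply. Qed.

Lemma ulrich_base r : A r%:A.
Proof. by rewrite -[r%:A]/(r *: 1); exact: submodZ. Qed.

Lemma ulrich_gen : I a.
Proof. by have [r Ir /(alg_inj hQ) ->] := (AP 1).1 A1. Qed.

Lemma ulrich_absorb r x : I r -> A x -> exists2 s, I s & r *: x = s%:A.
Proof.
move=> Ir Ax; have Aq : A (a%:A^-1 * r%:A).
  by apply/AP; exists r => //; rewrite -[LHS]mulr_algl mulVKr // regular_unit.
have [s Is es] := (AP _).1 (AM Aq Ax); exists s => //.
by rewrite -es -[RHS]mulr_algl mulrA mulVKr ?regular_unit // mulr_algl.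
Qed.

(** I = R : A: a multiplier of A into R kills a basis vector of A/R, and one exists because n is
    positive. With [ulrich_colonP], I and A determine each other. *)
Lemma ulrich_idealP r : I r <-> forall x, A x -> base (r *: x).
Proof.
split=> [Ir x Ax|h]; first by have [s _ ->] := ulrich_absorb Ir Ax; exact: base_alg.
have := @indA (fun i => if i == Ordinal n0 then r else 0).
rewrite (bigD1 (Ordinal n0)) //= big1 ?addr0; last by move=> i /negbTE ->; rewrite scale0r.
by move=> /(_ (h _ (Af _)) (Ordinal n0)); rewrite eqxx.
Qed.

Lemma ulrich_colonP x : A x <-> forall r, I r -> base (r *: x).
Proof.
split=> [Ax r Ir|h]; first by exact: (ulrich_idealP r).1.
have [r er] := (baseP _).1 (h _ ulrich_gen); apply/AP; exists r => //.
apply/ulrich_idealP => y /AP[s Is es].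
by rewrite -mulr_algl -er -scalerAl scalerAr es mulrC mulr_algl; exact: h.
Qed.

Lemma ulrich_lattice : lattice A.
Proof.
split=> //; first by exists 1; [exact: regular1|exact: ulrich_base].
by exists a => // x /AP[r _ ->]; exact: base_alg.
Qed.

(** Since IA = I, this is independence in A/IA. Freeness of A/R puts the coefficients of the f_i
    into I; their contribution then lies in I, and so does the coefficient of 1. *)
Lemma ulrich_indep (r : 'I_n.+1 -> R) s : I s -> \sum_i r i *: fcons 1 f i = s%:A -> forall i, I (r i).
Proof.
rewrite fcons_sum => Is e.
have Ir j : I (r (lift ord0 j)).
  move: j; apply: indA; rewrite -(addKr (r ord0)%:A (\sum_i _)) e -algN -algD.
  exact: base_alg.
have [t It et] : exists2 t, I t & \sum_i r (lift ord0 i) *: f i = t%:A.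
  have ex i : exists t, I t /\ r (lift ord0 i) *: f i = t%:A.
    by have [t It et] := ulrich_absorb (Ir i) (Af i); exists t.
  have [t ht] := choice ex; exists (\sum_i t i).
    by apply: (@submod_sum R R^o _ _ _ _ iI) => i _; exact: (ht i).1.
  by rewrite alg_sum; apply: eq_bigr => i _; exact: (ht i).2.
have I0 : I (r ord0).
  move: e; rewrite et -algD => /(alg_inj hQ) e'.
  by rewrite -(addrK t (r ord0)) e'; exact: idealB.
by move=> i; case: (unliftP ord0 i) => [j ->|->].
Qed.

Lemma ulrich_span x : A x -> exists r : 'I_n.+1 -> R, x = \sum_i r i *: fcons 1 f i.
Proof.
move=> /genA[r /baseP[t et]]; exists (fcons t r).
by rewrite fcons_lincomb -et subrK.
Qed.

Lemma fcons_in i : A (fcons 1 f i).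
Proof. by case: (unliftP ord0 i) => [j ->|->]; rewrite ?fconsS ?fcons0. Qed.

(** I = aA is generated by a, a f_1, ..., a f_n, and [ulrich_indep] makes these independent modulo
    mI. *)
Lemma ulrich_mu : mu (I : set R^o) = n.+1.
Proof.
have ex i : exists g, I g /\ a *: fcons 1 f i = g%:A.
  by have [g Ig eg] := (AP _).1 (fcons_in i); exists g.
have [g hg] := choice ex.
have sumg (r : 'I_n.+1 -> R) : (\sum_i r i *: (g i : R^o) : R)%:A = a *: \sum_i r i *: fcons 1 f i.
  rewrite alg_sum scaler_sumr; apply: eq_bigr => i _.
  by rewrite -[r i *: (g i : R^o)]/(r i * g i) -alg_scale -(hg i).2 !scalerA mulrC.
have defI : (I : set R^o) = submod_span (range (g : _ -> R^o)).
  rewrite eqEsubset; split; last first.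
    by apply: span_range_sub => // i; exact: (hg i).1.
  move=> r Ir; have ua := regular_unit hQ ra.
  have Ax : A (a%:A^-1 * r%:A).
    by apply/AP; exists r => //; rewrite -[LHS]mulr_algl mulVKr.
  have [t et] := ulrich_span Ax; apply/(@span_rangeP R R^o); exists t; apply: (alg_inj hQ).
  by rewrite sumg -et -[RHS]mulr_algl mulVKr.
apply: (proj1 (mu_eq noeth loc defI _)) => r; rewrite defI.
move=> /(idprod_span (max_ideal loc))[t mt et] i.
rewrite -(subrK (t i) (r i)); apply: (idealD (max_ideal loc)) => //; apply: Im; move: i.
apply: (@ulrich_indep (fun i => r i - t i) 0); first exact: ideal0.
apply: (regular_scale_inj ra); rewrite -sumg scale0r scaler0.
suff -> : \sum_i (r i - t i) *: (g i : R^o) = 0 by rewrite scale0r.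
by under eq_bigr do rewrite scalerBl; rewrite sumrB et subrr.
Qed.

(** As I = aA with A a ring, I^2 = aI, and a times the basis 1, f_1, ..., f_n of A/I is a basis of
    I/I^2. If I were (a), then f_1 would lie in R and independence would put 1 into I. *)
Lemma ulrich_data_ideal : ulrich_ideal m I.
Proof.
have pI := primary_to_max iI Im ulrich_gen ra.
have Isq : ideal_mul I I = ideal_mul (pideal a) I.
  rewrite eqEsubset; split.
    apply: (@idprod_min _ R^o); first exact: ideal_mul_ideal.
    move=> r s Ir Is; have Ax : A (a%:A^-1 * s%:A).
      by apply/AP; exists s => //; rewrite -[LHS]mulr_algl mulVKr // regular_unit.
    have [t It et] := ulrich_absorb Ir Ax; apply/ideal_mul_pideal => //; exists t => //.
    apply: (alg_inj hQ); rewrite -[RHS]alg_scale -et scalerA [a * r]mulrC -[RHS]scalerA.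
    by rewrite -[a *: (_ * _)]mulr_algl mulVKr ?regular_unit // alg_scale.
  move=> x /(ideal_mul_pideal _ _ iI)[s Is ->].
  exact (ideal_mul_in ulrich_gen Is).
have aI : pideal a `<=` I by move=> x /pidealP[r ->]; exact (idealM r iI ulrich_gen).
split=> //; exists a; split.
  split=> //; apply: (primary_to_max (d := a)) => //; first exact: pideal_ideal.
    exact: subset_trans Im.
  exact: pideal_gen.
split; first by split=> //; exists 1%N; rewrite ideal_pow1 // -Isq -[LHS]/(ideal_mul I (ideal_pow I 1)) ideal_pow1.
split.
  move=> E; have [r Ir er] := (AP _).1 (Af (Ordinal n0)).
  move: Ir; rewrite E => /pidealP[t et].
  have : base (f (Ordinal n0)).
    suff -> : f (Ordinal n0) = t%:A by exact: base_alg.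
    by apply: (regular_scale_inj ra); rewrite er et mulrC alg_scale.
  move=> h; apply: (max_proper loc); apply: Im.
  have := @indA (fun i => if i == Ordinal n0 then 1 else 0).
  rewrite (bigD1 (Ordinal n0)) //= big1 ?addr0 ?scale1r; last by move=> i /negbTE ->; rewrite scale0r.
  by move=> /(_ h (Ordinal n0)); rewrite eqxx.
split=> //.
have ex i : exists g, I g /\ a *: fcons 1 f i = g%:A.
  by have [g Ig eg] := (AP _).1 (fcons_in i); exists g.
have [g hg] := choice ex.
have sumg (r : 'I_n.+1 -> R) : (\sum_i r i *: (g i : R^o) : R)%:A = a *: \sum_i r i *: fcons 1 f i.
  rewrite alg_sum scaler_sumr; apply: eq_bigr => i _.
  by rewrite -[r i *: (g i : R^o)]/(r i * g i) -alg_scale -(hg i).2 !scalerA mulrC.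
exists n.+1, g; split=> [i|]; first exact: (hg i).1.
split=> [r Ir|r].
  have Ax : A (a%:A^-1 * r%:A).
    by apply/AP; exists r => //; rewrite -[LHS]mulr_algl mulVKr // regular_unit.
  have [t et] := ulrich_span Ax; exists t.
  suff -> : \sum_i t i *: (g i : R^o) = r by rewrite subrr; exact (ideal0 (ideal_mul_ideal I I)).
  by apply: (alg_inj hQ); rewrite sumg -et -[LHS]mulr_algl mulVKr // regular_unit.
rewrite Isq => /(ideal_mul_pideal _ _ iI)[s Is es]; apply: (ulrich_indep Is).
by apply: (regular_scale_inj ra); rewrite -sumg es alg_scale.
Qed.

End Data.

Hypothesis hreg : exists2 x, m x & regular_elt x.

(** Dividing a basis of I/I^2 by a gives a basis of A/I over R/I, one vector more than a basis of
    A/R has. Some coordinate of 1 is a unit, as otherwise 1 is in mA and A vanishes by Nakayama; so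
    1 may replace that vector. *)
Lemma ulrich_ideal_data (I : set R) : ulrich_ideal m I ->
  exists a (A : set Q) n (f : 'I_n -> Q), ulrich_data I a A f.
Proof.
move=> [pI [a [[ma pa] [[aI _] [Ia [Isq [n0 [e0 [Ie0 [gen0 ind0]]]]]]]]]].
have im := max_ideal loc.
have iI : ideal I by case: pI => -[].
have Im : I `<=` m by case: pI => _ <- r Ir; exists 1%N; rewrite expr1.
have ra : regular_elt a.
  have [x mx rx] := hreg; move: mx; case: pa => _ <- [k /pidealP[r er]] y ay.
  have rxk : regular_elt (x ^+ k).
    by elim: k {er} => [|k IH] z; rewrite ?mul1r // exprS -mulrA => /rx/IH.
  by apply: rxk; rewrite er -mulrA ay mulr0.
have ua := regular_unit hQ ra.
have Iaa : I a by apply: aI; exact: pideal_gen.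
pose A : set Q := [set q | exists2 r, I r & a *: q = r%:A].
have AI r : I r -> A (a%:A^-1 * r%:A).
  by move=> Ir; exists r => //; rewrite -[LHS]mulr_algl mulVKr.
have sA : submod A.
  split; first by exists 0; [exact: ideal0|rewrite scaler0 scale0r].
  move=> r x y [s Is es] [t It et]; exists (r * s + t).
    exact (idealD iI (idealM r iI Is) It).
  by rewrite scalerDr scalerA mulrC -scalerA es et alg_scale algD.
have A1 : A 1 by exists a.
have AM x y : A x -> A y -> A (x * y).
  move=> [s Is es] [t It et].
  have := ideal_mul_in Is It; rewrite Isq => /(ideal_mul_pideal _ _ iI)[w Iw ew].
  exists w => //; apply: (regular_scale_inj ra); rewrite alg_scale -ew algM -es -et.
  by rewrite -scalerAl -scalerAr.
have IA r x : I r -> A x -> exists2 s, I s & r *: x = s%:A.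
  move=> Ir Ax; have [s Is es] := AM _ _ (AI _ Ir) Ax; exists s => //.
  by rewrite -es -[RHS]mulr_algl mulrA mulVKr // mulr_algl.
pose f0 i : Q := a%:A^-1 * (e0 i)%:A.
have af0 i : a *: f0 i = (e0 i)%:A by rewrite -[LHS]mulr_algl mulVKr.
have Af0 i : A (f0 i) by exact: AI.
have sumf (r : 'I_n0 -> R) : a *: (\sum_i r i *: f0 i) = (\sum_i r i *: (e0 i : R^o) : R)%:A.
  rewrite alg_sum scaler_sumr; apply: eq_bigr => i _.
  by rewrite scalerA mulrC -scalerA af0 alg_scale.
have genf x : A x -> exists r : 'I_n0 -> R, exists2 s, I s & x - \sum_i r i *: f0 i = s%:A.
  move=> [w Iw ew]; have [r] := gen0 _ Iw; rewrite Isq => /(ideal_mul_pideal _ _ iI)[s Is es].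
  exists r, s => //; apply: (regular_scale_inj ra); rewrite scalerBr ew sumf alg_scale -es.
  by rewrite [RHS]scalerBl.
have indf (r : 'I_n0 -> R) s : I s -> \sum_i r i *: f0 i = s%:A -> forall i, I (r i).
  move=> Is es; apply: ind0; rewrite Isq; apply/(ideal_mul_pideal _ _ iI); exists s => //.
  by apply: (alg_inj hQ); rewrite -sumf es alg_scale.
have [r1 [s1 Is1 es1]] := genf _ A1.
have lA : lattice A.
  split=> //; first by exists 1; [exact: regular1|rewrite scale1r].
  by exists a => // x [r _ ->]; exact: base_alg.
have [i0 nmi0] : exists i0, ~ m (r1 i0).
  apply: contrapT => /forallNP allm.
  have m1 : idprod m A 1.
    have -> : (1 : Q) = s1 *: 1 + \sum_i r1 i *: f0 i by rewrite -es1 subrK.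
    have sm := idprod_submod m A; apply: (submodD sm).
      by apply: idprod_in => //; exact: Im.
    apply: (submod_sum sm) => i _; apply: idprod_in => //.
    by have := allm i; move=> /contrapT.
  have A0 : A `<=` [set 0].
    apply: (nakayama noeth loc (lattice_fin_gen noeth hQ lA)); first exact: submod_zero.
    move=> x Ax; apply: (saddr (@submod_zero _ _)).
    suff : idprod m A `<=` [set z | idprod m A (x * z)] by move=> /(_ _ m1); rewrite /= mulr1.
    have sm := idprod_submod m A.
    apply: (idprod_min (submod_mull x sm)) => r y mr Ay /=.
    by rewrite -scalerAr; apply: idprod_in => //; exact: AM.
  by have /eqP := A0 _ A1; rewrite oner_eq0.
case: n0 e0 Ie0 gen0 ind0 f0 af0 Af0 sumf genf indf r1 es1 i0 nmi0 => [|n] e0 Ie0 gen0 ind0 f0 af0 Af0 sumf genf indf r1 es1 i0 nmi0.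
  by case: i0 nmi0.
have [u eu] := local_unit noeth loc nmi0.
pose f j := f0 (lift i0 j).
have sb := base_submod Q.
have split0 (r : 'I_n.+1 -> R) : \sum_i r i *: f0 i = r i0 *: f0 i0 + \sum_j r (lift i0 j) *: f j.
  by rewrite (bigD1_ord i0).
pose G := comb (@base R Q) setT f.
have sG : submod G by exact: comb_submod.
have Gb : @base R Q `<=` G by exact: comb_sub.
have Gf j : G (f j) by rewrite -(scale1r (f j)); exact: comb_in.
have Gi0 : G (f0 i0).
  have -> : f0 i0 = u *: (1 - s1%:A - \sum_j r1 (lift i0 j) *: f j).
    rewrite -es1 subKr split0 addrK scalerA eu scale1r.
    by [].
  apply: (submodZ _ sG); apply: (submodB sG).
    by apply: Gb; apply: (submodB sb); [exact: base1|exact: base_alg].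
  by apply: (submod_sum sG) => j _; exact (submodZ _ sG (Gf j)).
have genA x : A x -> exists r : 'I_n -> R, base (x - \sum_i r i *: f i).
  move=> /genf[r [s Is es]].
  have [t _ ht] : G x.
    rewrite -(subrK (\sum_i r i *: f0 i) x) es; apply: (submodD sG); first by apply: Gb; exact: base_alg.
    rewrite split0; apply: (submodD sG); first exact: submodZ.
    by apply: (submod_sum sG) => j _; exact (submodZ _ sG (Gf j)).
  by exists t.
have indA (t : 'I_n -> R) : base (\sum_i t i *: f i) -> forall i, I (t i).
  move=> /baseP[w ew].
  (* From sum t_j f_j = w in R, subtract w times the expansion of 1. This is a relation among all
     the f0; its coefficient at i0 is -w r1(i0) with r1(i0) a unit, which puts w, and then every
     t_j, into I. *)
  pose r i := (if unlift i0 i is Some j then t j else 0) - w * r1 i.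
  have rj j : r (lift i0 j) = t j - w * r1 (lift i0 j) by rewrite /r liftK.
  have r0 : r i0 = - (w * r1 i0) by rewrite /r unlift_none sub0r.
  have Ir : forall i, I (r i).
    apply: (@indf r (w * s1)); first exact: idealM.
    rewrite -alg_scale -es1 scalerBr split0 r0.
    under eq_bigr do rewrite rj scalerBl -scalerA.
    rewrite sumrB ew -scaler_sumr split0 scalerDr scaleNr -scalerA opprD addrCA.
    by [].
  have Iw : I w.
    have := Ir i0; rewrite r0 => /(idealN iI); rewrite opprK => h.
    by rewrite -(mulr1 w) -eu mulrCA; exact: idealM.
  move=> i; have := Ir (lift i0 i); rewrite rj => h.
  by rewrite -(subrK (w * r1 (lift i0 i)) (t i)); apply: (idealD iI) => //; exact: idealMr.
exists a, A, n, f; split=> //; last by split=> // j; exact: Af0.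
split; first by split=> //; split.
(* With n = 0 one would have A = R, hence I = (a), which the definition of an Ulrich ideal
   excludes. *)
rewrite lt0n; apply/eqP => n0; case: Ia; rewrite eqEsubset; split=> // r Ir.
have [t] := genA _ (AI _ Ir); rewrite big1 ?subr0 => [/baseP[w ew]|i _]; last first.
  by have := ltn_ord i; rewrite {2}n0.
apply/pidealP; exists w; apply: (alg_inj hQ).
by rewrite mulrC algM -ew mulVKr.
Qed.

End UlrichIdeals.

(** * S/R is free over R/c, of rank the type of R *)

Section Structure.
Variables (R : comNzRingType) (m : set R) (Q : comUnitAlgType R).
Hypotheses (noeth : noetherian R) (loc : local_with m) (dim1 : has_dim (R^o : lmodType R) 1).
Hypothesis hQ : total_fractions Q.
Hypothesis hreg : exists2 x, m x & regular_elt x.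
Variables (L : set Q) (k : nat) (e : 'I_k.+1 -> Q) (c : set R).
Hypotheses (lL : lattice L) (RL : @base R Q `<=` L) (socL : has_length (socle_over m L) L 1).
Hypotheses (ic : ideal c) (cm : c `<=` m) (Le : forall i, L (e i)).
Hypothesis genL : forall x, L x -> exists r : 'I_k.+1 -> R, base (x - \sum_i r i *: e i).
Hypothesis indL : forall r : 'I_k.+1 -> R, base (\sum_i r i *: e i) -> forall i, c (r i).
Hypothesis cL : forall r x, c r -> L x -> exists2 s, c s & r *: x = s%:A.

Let S := adjoin L.
Let C : set Q := [set r%:A | r in c].
Let sL : submod L := lattice_submod lL.
Let im := max_ideal loc.
Let lS : lattice S := lattice_adjoin lL ic Le indL cL.
Let sS : submod S := lattice_submod lS.
Let lC : lattice C := lattice_conductor lL ic Le indL.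
Let sC : submod C := lattice_submod lC.
Let LS : L `<=` S := @sub_adjoin R Q L.
Let CR : C `<=` @base R Q. Proof. by move=> _ [r _ <-]; exact: base_alg. Qed.
Let CLS : colon L S = C := canonical_colon_adjoin noeth loc dim1 hQ lL RL socL ic Le indL cL.
Let LL : colon L L = @base R Q := colon_self noeth loc dim1 hQ lL socL.
Let sb := base_submod Q.

Let C_absorb q x : C q -> S x -> C (q * x).
Proof.
move=> [r cr <-] Sx; have [s cs es] := conductor_absorb ic cL cr Sx.
by rewrite mulr_algl es; exists s.
Qed.

Let colon_mX (X Y : set Q) : submod Y -> colon Y (idprod m X) = socle_over m (colon Y X).
Proof.
move=> sY; rewrite eqEsubset; split=> q hq.
  by move=> r mr x Xx; rewrite -scalerAl scalerAr; apply: hq; exact: idprod_in.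
suff : idprod m X `<=` [set z | Y (q * z)] by [].
apply: (idprod_min (submod_mull q sY)) => r x mr Xx /=.
by rewrite -scalerAr scalerAl; exact: hq.
Qed.

Lemma indL1 (r : 'I_k.+2 -> R) : C (\sum_i r i *: fcons 1 e i) -> forall i, c (r i).
Proof.
rewrite fcons_sum => h.
have ce j : c (r (lift ord0 j)).
  move: j; apply: indL; rewrite -(addKr (r ord0)%:A (\sum_i _)).
  by apply: (submodD sb); [rewrite -algN; exact: base_alg|exact: CR].
have c0 : C (r ord0)%:A.
  rewrite -(addrK (\sum_i r (lift ord0 i) *: e i) (r ord0)%:A); apply: (submodB sC) => //.
  apply: (submod_sum sC) => i _; rewrite -mulr_algl; apply: C_absorb; last exact: LS.
  by exists (r (lift ord0 i)).
by move=> i; case: (unliftP ord0 i) => [j ->|->] //; exact/(alg_memP hQ).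
Qed.

Lemma length_L_mL : has_length L (idprod m L) k.+2.
Proof.
have EL : L = submod_span (range (fcons 1 e)).
  rewrite eqEsubset; split; last first.
    apply: span_range_sub => // i; case: (unliftP ord0 i) => [j ->|->]; first by rewrite fconsS.
    by rewrite fcons0; apply: RL; exact: base1.
  move=> x /genL[r /baseP[t et]]; apply/span_rangeP; exists (fcons t r).
  by rewrite fcons_lincomb -et subrK.
apply: (proj2 (mu_eq noeth loc EL _)) => r; rewrite {1}EL.
move=> /(idprod_span im)[t mt et] i.
rewrite -(subrK (t i) (r i)); apply: (idealD im) => //; apply: cm; move: i.
apply: indL1; under eq_bigr do rewrite scalerBl.
by rewrite sumrB et subrr; exact: submod0.
Qed.

(** Dualizing mL inside L gives R = L : L inside L : mL = R : m, so the type of R is the number of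
    generators of L. *)
Lemma length_socle_base : has_length (socle_over m (@base R Q)) (@base R Q) k.+2.
Proof.
have lm := lattice_idprod hreg lL.
have := colon_length noeth loc dim1 hQ lL socL lm lL length_L_mL.
by rewrite colon_mX // LL.
Qed.

(** Chosen for their duals: L : (L + mS) = R ∩ (c : m), and below L : (R + mS) = L ∩ (c : m). *)
Let U := sadd L (idprod m S).
Let U' := sadd (@base R Q) (idprod m S).
Let sm := idprod_submod m S.
Let lU : lattice U.
Proof.
apply: (lattice_sandwich lL lS (sadd_submod sL sm) (saddl sm)).
by apply: sadd_min => //; exact: idprod_sub.
Qed.
Let lU' : lattice U'.
Proof.
apply: (lattice_sandwich (lattice_base Q) lS (sadd_submod sb sm) (saddl sm)).
apply: sadd_min => //; last exact: idprod_sub.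
exact: subset_trans RL LS.
Qed.
Let US : U `<=` S. Proof. by apply: sadd_min => //; exact: idprod_sub. Qed.
Let U'U : U' `<=` U.
Proof. by apply: sadd_min; [exact: lattice_submod|exact: subset_trans (saddl sm)|exact: saddr]. Qed.

Let sc1 : submod (socle_over m (c : set R^o)).
Proof. exact: socle_over_submod. Qed.

Lemma length_socle_c n : has_length S U n -> has_length (socle_over m (c : set R^o)) c n.
Proof.
move=> hn; have := colon_length noeth loc dim1 hQ lL socL lU lS hn.
rewrite CLS /U (colon_add lL sL sm) LL colon_mX // CLS => h.
apply: (@has_length_rel _ _ R^o (fun q r => q = r%:A)) h => //.
- by move=> r q q' s s' -> ->; rewrite scalerDl scalerA.
- exact: (@sub_socle R m R^o).
- move=> q [/baseP[r ->] hq]; exists r => // s ms; apply/(alg_memP hQ).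
  by rewrite -alg_scale; exact: hq.
- move=> r hr; exists r%:A => //; split; first exact: base_alg.
  by move=> s ms; rewrite alg_scale; apply/(alg_memP hQ); exact: hr.
- by move=> q r _ _ ->; exact: alg_memP.
Qed.

(** Let rho = l(S/U), which is also the length of (c :_R m)/c. The quotient U/U' is generated by k +
    1 elements killed by m, so l(S/U') <= rho + k + 1. Its dual, L ∩ (c : m) modulo c, contains the
    multiples of 1, e_1, ..., e_{k+1} by c :_R m, of length (k+2) rho. So rho <= 1; and rho = 0
    would give S = L and 1 in L : S = c. *)
Lemma socle_c_simple : has_length S U 1.
Proof.
have [rho hrho] := lattice_fin_len noeth loc dim1 hQ lU lS US.
have hc := length_socle_c hrho.
have mU' : idprod m (submod_span (range e)) `<=` U'.
  apply: subset_trans (saddr sb); apply: idprod_mono => //.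
  by apply: span_range_sub => // i; exact: LS.
have [j jk hj] := has_length_gens noeth loc (lattice_submod lU') (ex_intro _ e (erefl _)) mU'.
have EU : sadd U' (submod_span (range e)) = U.
  rewrite eqEsubset; split.
    apply: sadd_min => //; first exact: lattice_submod.
    by apply: span_range_sub => [|i]; [exact: lattice_submod|apply: (saddl sm); exact: Le].
  apply: sadd_min; first by apply: sadd_submod; [exact: lattice_submod|exact: span_submod].
    move=> x /genL[r br]; exists (x - \sum_i r i *: e i); first exact: (saddl sm).
    by exists (\sum_i r i *: e i); [apply/span_rangeP; exists r|rewrite subrK].
  by apply: subset_trans (saddl (span_submod _)); exact: saddr.
rewrite EU in hj; have hD := colon_length noeth loc dim1 hQ lL socL lU' lS (has_length_trans hrho hj).
rewrite CLS /U' (colon_add lL sb sm) (colon_base lL) colon_mX // CLS in hD.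
have isc : ideal (socle_over m (c : set R^o)) by [].
have h1 : has_length (comb C (socle_over m (c : set R^o)) (fcons 1 e)) C (k.+2 * rho).
  apply: (comb_length (I := c)) => //; last by move=> r _; exact: indL1.
  move=> i r cr; rewrite -mulr_algl; apply: C_absorb; first by exists r.
  case: (unliftP ord0 i) => [i' ->|->]; first by rewrite fconsS; exact: LS.
  by rewrite fcons0; exact: adjoin1.
have sub : comb C (socle_over m (c : set R^o)) (fcons 1 e) `<=` L `&` socle_over m C.
  have s2 : submod (L `&` socle_over m C) by apply: submodI => //; exact: socle_over_submod.
  apply: (comb_min s2).
    by move=> q Cq; split; [apply: RL; exact: CR|exact: sub_socle].
  have Se i : L (fcons 1 e i).
    case: (unliftP ord0 i) => [i' ->|->]; first by rewrite fconsS.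
    by rewrite fcons0; apply: RL; exact: base1.
  move=> i r hr; split; first exact: submodZ.
  move=> s ms; rewrite scalerA -mulr_algl; apply: C_absorb; last by apply: LS.
  by exists (s * r) => //; exact: hr.
have [le _] := has_length_le (comb_submod _ sC isc) (comb_sub _ isc) sub hD h1.
have : (rho <= 1)%N by nia.
case: rho {hj hD h1 le} hrho hc => [|[|]] // h0 _ _.
have EUS : S = U by case/has_length0: h0.
have SL : S `<=` L.
  by apply: (nakayama noeth loc (lattice_fin_gen noeth hQ lS) sL) => x; rewrite {1}EUS.
have C1 : C 1%:A by rewrite -CLS scale1r => y Sy; rewrite mul1r; exact: SL.
by case: (max_proper loc); apply: cm; exact/(alg_memP hQ).
Qed.

(** Since l(S/U) = 1, Nakayama gives S = L + R sg. If r sg is in L, then rS lies in L, so r is in L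
    : S = c; thus S/L is R/c and sg completes the basis of L/R. *)
Lemma adjoin_basis : exists s : 'I_k.+2 -> Q,
  [/\ forall i, S (s i),
      forall x, S x -> exists r : 'I_k.+2 -> R, base (x - \sum_i r i *: s i) &
      forall r : 'I_k.+2 -> R, base (\sum_i r i *: s i) -> forall i, c (r i)].
Proof.
have [_ _ [_ nSU] mS] : simple_quot S U by apply/has_length1; exact: socle_c_simple.
have /existsNP[sg /not_implyP[Ssg nUsg]] := nSU.
have s1 := span_submod [set sg].
have sgS : submod_span [set sg] `<=` S by exact: span1_sub.
have sLs := sadd_submod sL s1.
have EU : sadd U (submod_span [set sg]) = S.
  have sU := lattice_submod lU.
  have [E|//] := mS _ (sadd_submod sU s1) (saddl s1) (sadd_min sS US sgS).
  by case: nUsg; rewrite -E; apply: (saddr sU); exact: sub_span.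
have SLs : S `<=` sadd L (submod_span [set sg]).
  apply: (nakayama noeth loc (lattice_fin_gen noeth hQ lS) sLs) => x.
  rewrite -{1}EU => -[_ [l Ll [y my <-]] [z sz <-]].
  by exists (l + z); [exists l => //; exists z|exists y => //; rewrite addrAC].
exists (fcons sg e); split.
- by move=> i; case: (unliftP ord0 i) => [j ->|->]; rewrite ?fconsS ?fcons0 //; exact: LS.
- move=> x /SLs[l /genL[r br] [_ /span1P[t ->] <-]]; exists (fcons t r).
  by rewrite fcons_lincomb [t *: sg + _]addrC opprD addrA addrAC addrK.
- move=> r; rewrite fcons_sum => br.
  have Lsum : L (\sum_i r (lift ord0 i) *: e i) by apply: (submod_sum sL) => i _; exact: submodZ.
  have Lr : L (r ord0 *: sg).
    by rewrite -(addrK (\sum_i r (lift ord0 i) *: e i) (r ord0 *: sg)); apply: (submodB sL) => //; exact: RL.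
  have c0 : c (r ord0).
    suff : C (r ord0)%:A by move=> /(alg_memP hQ).
    rewrite -CLS => y /SLs[l Ll [_ /span1P[t ->] <-]].
    rewrite mulr_algl scalerDr; apply: (submodD sL); first exact: submodZ.
    by rewrite scalerA mulrC -scalerA; exact: submodZ.
  have ce j : c (r (lift ord0 j)).
    move: j; apply: indL; rewrite -(addKr (r ord0 *: sg) (\sum_i _)); apply: (submodD sb) => //.
    apply: (submodN sb); have [s _ ->] := conductor_absorb ic cL c0 Ssg; exact: base_alg.
  by move=> i; case: (unliftP ord0 i) => [j ->|->].
Qed.

End Structure.

(** * Ulrich ideals containing the conductor, and factorizations c = abS *)

Section UlrichAboveConductor.
Variables (R : comNzRingType) (m : set R) (Q : comUnitAlgType R).
Hypotheses (noeth : noetherian R) (loc : local_with m) (dim1 : has_dim (R^o : lmodType R) 1).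
Hypothesis hQ : total_fractions Q.
Variables (S : set Q) (N : nat) (s : 'I_N -> Q) (c : set R).
Hypotheses (hS : subalg S) (lS : lattice S) (N0 : (0 < N)%N) (ic : ideal c) (cm : c `<=` m).
Hypothesis creg : exists2 t, c t & regular_elt t.
Hypothesis Ss : forall i, S (s i).
Hypothesis genS : forall x, S x -> exists r : 'I_N -> R, base (x - \sum_i r i *: s i).
Hypothesis indS : forall r : 'I_N -> R, base (\sum_i r i *: s i) -> forall i, c (r i).
Hypothesis cS : forall r x, c r -> S x -> exists2 t, c t & r *: x = t%:A.
Hypothesis colonS : forall x, (forall r, c r -> base (r *: x)) -> S x.
Hypothesis socR : has_length (socle_over m (@base R Q)) (@base R Q) N.

Let im := max_ideal loc.
Let sb := base_submod Q.
Let sS : submod S. Proof. by case: hS. Qed.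
Let S1 : S 1. Proof. by case: hS => _ []. Qed.
Let SM x y : S x -> S y -> S (x * y). Proof. by case: hS => _ [_]; apply. Qed.
Let RS : @base R Q `<=` S. Proof. by move=> _ [r _ <-]; exact: submodZ. Qed.

Section Above.
Variables (I : set R) (a : R) (A : set Q) (n : nat) (f : 'I_n -> Q).
Hypotheses (hU : ulrich_data m I a A f) (cI : c `<=` I).

Let ma : m a. Proof. by case: hU => -[]. Qed.
Let ra : regular_elt a. Proof. by case: hU => -[]. Qed.
Let iI : ideal I. Proof. by case: hU => -[]. Qed.
Let Im : I `<=` m. Proof. by case: hU => -[]. Qed.
Let AP x : A x <-> exists2 r, I r & a *: x = r%:A. Proof. by case: hU. Qed.
Let sA : submod A. Proof. by case: hU => _ [[]]. Qed.
Let n0 : (0 < n)%N. Proof. by case: hU => _ []. Qed.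
Let Af i : A (f i). Proof. by case: hU => _ _ _ []. Qed.
Let genA x : A x -> exists r : 'I_n -> R, base (x - \sum_i r i *: f i).
Proof. by case: hU => _ _ _ [_ h] _; exact: h. Qed.
Let indA (r : 'I_n -> R) : base (\sum_i r i *: f i) -> forall i, I (r i).
Proof. by case: hU => _ _ _ _; apply. Qed.
Let RA : @base R Q `<=` A. Proof. by move=> _ [r _ <-]; exact: (ulrich_base hU). Qed.
Let Aabs r x : I r -> A x -> exists2 t, I t & r *: x = t%:A.
Proof. exact: (ulrich_absorb hQ hU). Qed.

Lemma above_sub_S : A `<=` S.
Proof.
move=> x Ax; apply: colonS => r cr.
by have [t _ ->] := Aabs (cI cr) Ax; exact: base_alg.
Qed.

Definition colon_ideal : set R := [set r | forall i, I i -> c (i * r)].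

Lemma colon_ideal_ideal : ideal colon_ideal.
Proof.
split=> [i _|r x y hx hy i Ii]; first by rewrite mulr0; exact: ideal0.
by rewrite mulrDr -[r *: x]/(r * x) mulrCA; exact (idealD ic (idealM r ic (hx _ Ii)) (hy _ Ii)).
Qed.

Let iJ := colon_ideal_ideal.

(** Writing J for [colon_ideal], this is A = R + JS. For x in A and i in I, the product ix lies in
    R, so i times each coordinate of x in S/R lies in c. Conversely IJS is inside cS, so JS is
    inside R : I = A. *)
Lemma above_comb : A = comb (@base R Q) colon_ideal s.
Proof.
rewrite eqEsubset; split.
  move=> x Ax; have [r br] := genS (above_sub_S Ax); exists r => // j i Ii; move: j.
  apply: (@indS (fun j => i * r j)).
  have -> : \sum_j (i * r j) *: s j = i *: x - i *: (x - \sum_j r j *: s j).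
    by rewrite -scalerBr subKr scaler_sumr; apply: eq_bigr => j _; rewrite scalerA.
  apply: (submodB sb); first by have [t _ ->] := Aabs Ii Ax; exact: base_alg.
  exact: submodZ.
apply: comb_min => // j r hr; apply/(ulrich_colonP hQ hU) => i Ii.
by rewrite scalerA; have [t _ ->] := cS (hr _ Ii) (Ss j); exact: base_alg.
Qed.

(** As I lies in m, R : m is contained in R : I = A. In the basis f of A/R its elements are those
    with coordinates in I : m, so n copies of (I : m)/I appear. *)
Lemma above_socle rho : has_length (socle_over m (I : set R^o)) I rho -> N = (n * rho)%N.
Proof.
move=> h; have sI := @socle_over_submod R m R^o I iI.
have -> : N = (n * rho)%N; last by [].
apply: (has_length_uniq socR).
have -> : socle_over m (@base R Q) = comb (@base R Q) (socle_over m (I : set R^o)) f.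
  rewrite eqEsubset; split.
    move=> x hx; have Ax : A x.
      by apply/(ulrich_colonP hQ hU) => r Ir; apply: hx; exact: Im.
    have [r br] := genA Ax; exists r => // j i mi; move: j.
    apply: (@indA (fun j => i * r j)).
    have -> : \sum_j (i * r j) *: f j = i *: x - i *: (x - \sum_j r j *: f j).
      by rewrite -scalerBr subKr scaler_sumr; apply: eq_bigr => j _; rewrite scalerA.
    by apply: (submodB sb); [exact: hx|exact: submodZ].
  apply: comb_min; first exact: socle_over_submod.
    exact: sub_socle.
  move=> j r hr i mi; rewrite scalerA.
  by have [t _ ->] := Aabs (hr _ mi) (Af j); exact: base_alg.
apply: (comb_length (I := I)) => //; last by move=> r _; exact: indA.
by move=> j r Ir; have [t _ ->] := Aabs Ir (Af j); exact: base_alg.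
Qed.

Let mJ : set R := ideal_mul m colon_ideal.
Let imJ : ideal mJ := ideal_mul_ideal m colon_ideal.
Let J' : set R := sadd (c : set R^o) mJ.
Let iJ' : ideal J' := @sadd_submod R R^o _ _ ic imJ.

(** Both sides compute l(A/(R + mA)): the basis f of A/R gives n, and A = R + JS with S/R free over
    R/c gives N copies of J/(c + mJ). *)
Lemma above_gens lam : has_length (colon_ideal : set R^o) J' lam -> n = (N * lam)%N.
Proof.
move=> h; pose M := sadd (@base R Q) (idprod m A).
have smA := idprod_submod m A; have sM : submod M := sadd_submod sb smA.
have MA : M `<=` A by apply: sadd_min => //; exact: idprod_sub.
have h1 : has_length (comb M setT f) M (n * 1).
  apply: (comb_length (I := m)) => //.
  - exact: (residue_length noeth loc).
  - by move=> i r mr; apply: (saddr sb); exact: idprod_in.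
  - move=> r _ [b bb [y my eb]] i.
    have : idprod m (submod_span (range (fcons 1 f))) y.
      move: my; apply: idprod_mono => // x /(ulrich_span hU)[t ->].
      by apply/span_rangeP; exists t.
    move=> /(idprod_span im)[t mt ey].
    rewrite -(subrK (t (lift ord0 i)) (r i)); apply: (idealD im) => //; apply: Im; move: i.
    apply: (@indA (fun i => r i - t (lift ord0 i))).
    under eq_bigr do rewrite scalerBl.
    rewrite sumrB -eb ey fcons_sum addrA addrK.
    by apply: (submodD sb) => //; exact: base_alg.
have h2 : has_length (comb M colon_ideal s) M (N * lam).
  apply: (comb_length (I := J')) => //.
  - move=> i r [u cu [v mv <-]]; rewrite scalerDl; exists (u *: s i).
      by have [t _ ->] := cS cu (Ss i); exact: base_alg.
    exists (v *: s i) => //; move: v mv.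
    apply: (@idprod_min R R^o _ _ [set v : R | idprod m A (v *: s i)]) => [|x y mx Jy /=].
      split=> /= [|r0 x y hx hy]; first by rewrite scale0r; exact: submod0.
      rewrite scalerDl -[r0 *: x]/(r0 * x) -scalerA.
      exact (submodD smA (submodZ r0 smA hx) hy).
    rewrite -[x *: y]/(x * y) -scalerA; apply: idprod_in => //.
    by rewrite above_comb; exact: comb_in.
  - move=> r Jr [b bb [y my eb]] i.
    have [t mt hy] : comb (@base R Q) mJ s y.
      move: y my {eb}; apply: idprod_min; first exact: comb_submod.
      move=> x y mx; rewrite above_comb => -[t Jt hy].
      exists (fun j => x * t j) => [j|]; first exact: ideal_mul_in.
      have -> : \sum_j (x * t j) *: s j = x *: \sum_j t j *: s j.
        by rewrite scaler_sumr; apply: eq_bigr => j _; rewrite scalerA.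
      by rewrite -scalerBr; exact: submodZ.
    exists (r i - t i); last by exists (t i) => //; rewrite subrK.
    move: i; apply: (@indS (fun i => r i - t i)).
    under eq_bigr do rewrite scalerBl.
    by rewrite sumrB -eb -addrA; exact: submodD.
have e1 : comb M setT f = A.
  rewrite eqEsubset; split; first by apply: comb_min => // i r _; exact: submodZ.
  move=> x /genA[r br]; exists r => //; exact: (saddl smA).
have e2 : comb M colon_ideal s = A.
  rewrite eqEsubset; split.
    by apply: comb_min => // i r Jr; rewrite above_comb; exact: comb_in.
  rewrite {1}above_comb => x [r Jr br]; exists r => //; exact: (saddl smA).
rewrite e1 in h1; rewrite e2 in h2.
by rewrite -(has_length_uniq h1 h2) muln1.
Qed.

(* Socles give N = n rho and generators give n = N lam, so rho = lam = 1. *)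
Lemma above_rank : n = N /\ exists2 b, colon_ideal b &
  forall r, colon_ideal r -> exists u t, c u /\ r = u + t * b.
Proof.
have [t ct rt] := creg.
have fI : fin_len (setT : set R^o) I.
  have [|//] := fin_len_split (C := (I : set R^o)) iI _ (@subsetT _ _) (fin_len_regular noeth loc dim1 rt).
  by move=> x /pidealP[r ->]; apply: (idealM r iI); exact: cI.
have fc : fin_len (setT : set R^o) c.
  have [|//] := fin_len_split (C := (c : set R^o)) ic _ (@subsetT _ _) (fin_len_regular noeth loc dim1 rt).
  by move=> x /pidealP[r ->]; exact: (idealM r ic).
have [_ [rho hrho]] := fin_len_split (@socle_over_submod R m R^o _ iI) (@sub_socle R m R^o _ iI) (@subsetT _ _) fI.
have cJ : c `<=` colon_ideal by move=> x cx i _; exact: idealM.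
have [_ fJc] := fin_len_split (C := (colon_ideal : set R^o)) iJ cJ (@subsetT _ _) fc.
have mJJ : mJ `<=` colon_ideal by exact: (@idprod_sub R R^o).
have J'J : J' `<=` colon_ideal by apply: (@sadd_min R R^o).
have cJ' : c `<=` J' by exact: (@saddl R R^o).
have [[lam hlam] _] := fin_len_split (C := (J' : set R^o)) iJ' cJ' J'J fJc.
have eN := above_socle hrho; have en := above_gens hlam.
have lam1 : lam = 1%N.
  case: lam en {hlam} => [|[|lam]] en //; first by move: n0; rewrite en muln0.
  by move: n0 N0 eN en; case: rho {hrho} => [|rho] ? ? ? ?; nia.
split; first by rewrite en lam1 muln1.
rewrite lam1 in hlam.
have /has_length1[_ _ [_ nJJ'] mx] := hlam.
have /existsNP[b /not_implyP[Jb nJ'b]] := nJJ'; exists b => // r Jr.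
have s1 := @span_submod R R^o [set b].
have bJ : submod_span ([set b] : set R^o) `<=` colon_ideal by exact: (@span1_sub R R^o).
have scb := @sadd_submod R R^o _ _ ic s1.
have EJ : sadd (J' : set R^o) (submod_span ([set b] : set R^o)) = colon_ideal.
  have [E|//] := mx _ (sadd_submod iJ' s1) (saddl s1) (sadd_min iJ J'J bJ).
  by case: nJ'b; rewrite -E; apply: (saddr iJ'); exact: sub_span.
have : sadd (c : set R^o) (submod_span ([set b] : set R^o)) r.
  move: r Jr; apply: (nakayama noeth loc (noeth iJ) scb) => x.
  rewrite -{1}EJ => -[_ [u cu [v mv <-]] [w bw <-]].
  by exists (u + w); [exists u => //; exists w|exists v; [exact: mv|rewrite addrAC]].
by move=> [u cu [_ /span1P[w ->] <-]]; exists u, w.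
Qed.

Lemma above_mu : mu (I : set R^o) = N.+1.
Proof. by rewrite (ulrich_mu noeth loc hQ hU) above_rank.1. Qed.

(** From J = c + Rb one gets A = R + bS, and b is not a unit because c differs from I. Multiplying
    by a gives I = (a) + abS, so what remains is that c lies in abS. *)
Lemma above_factor : c <> I -> exists b, [/\ m b,
  [set r%:A | r in c] = [set (a * b)%:A * x | x in S] & I = ideal_add (pideal a) c].
Proof.
move=> cnI; have [_ [b Jb genJ]] := above_rank.
have Ia := ulrich_gen hQ hU; have ua := regular_unit hQ ra.
have mb : m b.
  apply: contrapT => /(local_unit noeth loc)[u eu]; apply: cnI.
  rewrite eqEsubset; split=> // i Ii; rewrite -(mulr1 i) -eu mulrCA.
  by apply: (idealM _ ic); exact: Jb.
have cab : c (a * b) by exact: Jb.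
have Abs x : S x -> A (b *: x).
  move=> Sx; apply/(ulrich_colonP hQ hU) => i Ii; rewrite scalerA.
  by have [t _ ->] := cS (Jb _ Ii) Sx; exact: base_alg.
have Adec x : A x -> exists t y, S y /\ x = t%:A + b *: y.
  rewrite above_comb => -[r Jr /baseP[w ew]].
  pose P := [set x : Q | exists t y, S y /\ x = t%:A + b *: y].
  have sP : submod P.
    split; first by exists 0, 0; split; [exact: submod0|rewrite scale0r scaler0 addr0].
    move=> q _ _ [t [y [Sy ->]]] [t' [y' [Sy' ->]]]; exists (q * t + t'), (q *: y + y').
    split; first exact (submodD sS (submodZ q sS Sy) Sy').
    by rewrite algD -alg_scale !scalerDr !scalerA [q * b]mulrC addrACA.
  have Pb t : P t%:A by exists t, 0; split; [exact: submod0|rewrite scaler0 addr0].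
  rewrite -(subrK (\sum_i r i *: s i) x) ew; apply: (submodD sP) => //.
  apply: (submod_sum sP) => i _; have [u [t [cu ->]]] := genJ _ (Jr i).
  rewrite scalerDl; apply: (submodD sP); first by have [v _ ->] := cS cu (Ss i); exact: Pb.
  exists 0, (t *: s i); split; first exact: submodZ.
  by rewrite scale0r add0r scalerA mulrC.
pose C : set Q := [set r%:A | r in c].
have lC : lattice C.
  split; last by exists 1; [exact: regular1|move=> _ [r _ <-]; rewrite scale1r; exact: base_alg].
    split; first by exists 0; [exact: ideal0|rewrite scale0r].
    move=> r _ _ [x cx <-] [y cy <-]; exists (r * x + y).
      exact (idealD ic (idealM r ic cx) cy).
    by rewrite algD -alg_scale.
  by have [t ct rt] := creg; exists t => //; exists t.
have CabS x : S x -> C ((a * b)%:A * x).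
  by move=> Sx; rewrite mulr_algl; have [v cv ->] := cS cab Sx; exists v.
pose D := qscale a%:A^-1 C; pose bS := qscale b%:A S.
have lD : lattice D by apply: lattice_qscale => //; rewrite unitrV.
have DP x : D x <-> C (a%:A * x).
  by have := qscale_inv C x (_ : a%:A^-1 \is a GRing.unit); rewrite unitrV invrK => /(_ ua).
(* Nakayama for a^-1 c modulo bS. An element of it is t + by by the form of A, with at in c. Since A
   lies in S, t belongs to J = c + Rb, and its part u in c equals a (a^-1 u), which falls into m
   a^-1 c. *)
have DbS : D `<=` bS.
  apply: (nakayama noeth loc (lattice_fin_gen noeth hQ lD) (qscale_submod _ sS)) => x Dx.
  have Ax : A x.
    by have [r cr er] := (DP _).1 Dx; apply/AP; exists r; [exact: cI|rewrite er mulr_algl].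
  have [t [y [Sy ex]]] := Adec _ Ax.
  have sD := lattice_submod lD.
  have Dby : D (b *: y) by apply/DP; rewrite -[b *: y]mulr_algl mulrA -algM; exact: CabS.
  have Dt : D t%:A by rewrite -(addrK (b *: y) t%:A) -ex; exact: submodB.
  have cat : c (a * t) by have := (DP _).1 Dt; rewrite -algM => -[r cr /(alg_inj hQ) <-].
  have Jt : colon_ideal t.
    move=> i Ii; have [z zA] : exists2 z, A z & a *: z = i%:A.
      by exists (a%:A^-1 * i%:A); [apply/AP; exists i => //|]; rewrite -[LHS]mulr_algl mulVKr.
    move=> ez; have [w cw ew] := cS cat (above_sub_S zA).
    suff -> : i * t = w by [].
    by apply: (alg_inj hQ); rewrite -ew mulrC -alg_scale -ez scalerA mulrC.
  have [u [v [cu et]]] := genJ _ Jt.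
  exists (b%:A * (v%:A + y)); first by exists (v%:A + y) => //; apply: (submodD sS) => //; exact: submodZ.
  exists u%:A; last by rewrite ex et algD algM mulrDr -[b *: y]mulr_algl [b%:A * v%:A]mulrC addrC addrA.
  have -> : u%:A = a *: (a%:A^-1 * u%:A) :> Q by rewrite -[RHS]mulr_algl mulVKr.
  by apply: idprod_in => //; apply: qscale_in; exists u.
have EC : C = [set (a * b)%:A * x | x in S].
  rewrite eqEsubset; split=> [x Cx|_ [x Sx <-]]; last exact: CabS.
  have : D (a%:A^-1 * x) by exact: qscale_in.
  move=> /DbS[y Sy ey]; exists y => //.
  by rewrite algM -mulrA ey mulVKr.
exists b; split=> //.
rewrite eqEsubset; split=> [r Ir|_ [x /pidealP[r ->] [y cy <-]]]; last first.
  by apply: (idealD iI); [exact: idealM|exact: cI].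
have Az : A (a%:A^-1 * r%:A).
  by apply/AP; exists r => //; rewrite -[LHS]mulr_algl mulVKr.
have [t [y [Sy ez]]] := Adec _ Az.
have [w cw ew] := CabS _ Sy.
exists (t * a); first by apply/pidealP; exists t.
exists w => //; apply: (alg_inj hQ).
rewrite algD ew -[RHS](mulVKr ua) ez mulrDr algM mulrC; congr (_ + _).
by rewrite algM -mulrA -[b *: y]mulr_algl.
Qed.

End Above.

Section Converse.
Variables (a b : R).
Hypotheses (ma : m a) (mb : m b) (EC : [set r%:A | r in c] = [set (a * b)%:A * x | x in S]).

Let C : set Q := [set r%:A | r in c].

Let uab : ((a * b)%:A : Q) \is a GRing.unit.
Proof.
have [t ct rt] := creg; have : C t%:A by exists t.
rewrite /C EC => -[x _ e]; have := regular_unit hQ rt.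
by rewrite -e unitrM => /andP[].
Qed.
Let ua : (a%:A : Q) \is a GRing.unit. Proof. by move: uab; rewrite algM unitrM => /andP[]. Qed.
Let ub : (b%:A : Q) \is a GRing.unit. Proof. by move: uab; rewrite algM unitrM => /andP[]. Qed.

Lemma conductor_factor r : c r <-> exists2 x, S x & r%:A = (a * b)%:A * x.
Proof.
split=> [cr|[x Sx er]].
  have : C r%:A by exists r.
  by rewrite /C EC => -[x Sx <-]; exists x.
have : C r%:A by rewrite /C EC; exists x.
by move=> [t ct /(alg_inj hQ) <-].
Qed.

Let cab : c (a * b). Proof. by apply/conductor_factor; exists 1; rewrite ?mulr1. Qed.

Lemma conductor_ulrich_data : ulrich_data m c (a * b) S s.
Proof.
split=> //.
- split=> //; first exact: (idealM _ im).
  exact: (unit_regular hQ).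
- move=> x; split=> [Sx|[r /conductor_factor[y Sy ->]]].
    by have [t ct et] := cS cab Sx; exists t.
  by rewrite -[_ *: x]mulr_algl => e; rewrite (mulrI uab e).
Qed.

(** For independence: if the b s_i combine to an element of R, each r_i b lies in c = abS, so r_i =
    ay with y in S. Expanding y as w plus a combination of the s_j, the element ay of R forces a t_j
    into c, and r_i lies in (a) + c. *)
Lemma factor_ulrich_data :
  ulrich_data m (ideal_add (pideal a) c) a (sadd (@base R Q) (qscale b%:A S)) (fun i => b *: s i).
Proof.
have sbS := qscale_submod b%:A sS; have sA := sadd_submod sb sbS.
have iI : ideal (ideal_add (pideal a) c) by exact (@sadd_submod R R^o _ _ (pideal_ideal a) ic).
have Ic : c `<=` ideal_add (pideal a) c by exact (@saddr R R^o _ _ (pideal_ideal a)).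
have Ia : ideal_add (pideal a) c a by apply: (@saddl R R^o _ _ ic); exact: pideal_gen.
have CabS x : S x -> exists2 t, c t & a *: (b%:A * x) = t%:A.
  by move=> Sx; have [t ct et] := cS cab Sx; exists t => //; rewrite mulr_algl scalerA.
split.
- split=> //; first exact: (unit_regular hQ).
  by apply: (@sadd_min R R^o) => // x /pidealP[r ->]; exact: (idealM _ im).
- split=> //; split=> //; split; first by apply: (saddl sbS); exact: base1.
  move=> _ _ [x bx [_ [y Sy <-] <-]] [x' bx' [_ [y' Sy' <-] <-]].
  exists (x * x'); first exact: baseM.
  exists (b%:A * (x * y' + x' * y + b%:A * (y * y'))); last by ring.
  apply: qscale_in; apply: (submodD sS); last by rewrite mulr_algl; apply: submodZ => //; exact: SM.
  by apply: (submodD sS); apply: SM => //; exact: RS.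
- move=> x; split=> [[_ /baseP[t ->] [_ [y Sy <-] <-]]|[r [_ /pidealP[t ->] [u cu <-]]]].
    have [v cv ev] := CabS _ Sy; exists (t * a + v).
      by exists (t * a); [apply/pidealP; exists t|exists v].
    by rewrite scalerDr ev algD alg_scale mulrC.
  have [y Sy ey] := (conductor_factor u).1 cu.
  rewrite algD ey => e; exists t%:A; first exact: base_alg.
  exists (b%:A * y); first exact: qscale_in.
  by apply: (mulrI ua); rewrite [a%:A * x]mulr_algl e !algM; ring.
- split=> [i|x [_ /baseP[t ->] [_ [y Sy <-] <-]]].
    by apply: (saddr sb); exists (s i) => //; rewrite mulr_algl.
  have [r br] := genS Sy; exists r.
  have -> : \sum_i r i *: (b *: s i) = b *: \sum_i r i *: s i.
    by rewrite scaler_sumr; apply: eq_bigr => i _; rewrite !scalerA mulrC.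
  rewrite mulr_algl -addrA -scalerBr; apply: (submodD sb); [exact: base_alg|exact: submodZ].
- move=> r br i.
  have crb : c (r i * b).
    by move: i; apply: (@indS (fun i => r i * b)); under eq_bigr do rewrite -scalerA.
  have [y Sy ey] := (conductor_factor _).1 crb.
  have er : (r i)%:A = a *: y.
    by apply: (mulrI ub); rewrite -algM mulrC ey algM -[a *: y]mulr_algl; ring.
  have [t /baseP[w ew]] := genS Sy.
  have cat : forall j, c (a * t j).
    apply: (@indS (fun j => a * t j)).
    have -> : \sum_j (a * t j) *: s j = a *: y - a *: (y - \sum_j t j *: s j).
      by rewrite -scalerBr subKr scaler_sumr; apply: eq_bigr => j _; rewrite scalerA.
    by rewrite -er ew; apply: (submodB sb); [exact: base_alg|rewrite alg_scale; exact: base_alg].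
  have ex j : exists v, c v /\ (a * t j) *: s j = v%:A.
    by have [v cv ev] := cS (cat j) (Ss j); exists v.
  have [v hv] := choice ex.
  suff -> : r i = w * a + \sum_j v j.
    exists (w * a); first by apply/pidealP; exists w.
    exists (\sum_j v j) => //; apply: (@submod_sum R R^o _ _ _ _ ic) => j _; exact: (hv j).1.
  apply: (alg_inj hQ); rewrite er -(subrK (\sum_j t j *: s j) y) ew scalerDr alg_scale mulrC.
  rewrite [RHS]algD; congr (_ + _); rewrite alg_sum scaler_sumr; apply: eq_bigr => j _.
  by rewrite scalerA (hv j).2.
Qed.

(** If a were in c = abS, then 1 would lie in bS, hence in mS, and Nakayama would kill S. *)
Lemma conductor_proper : c `<` ideal_add (pideal a) c.
Proof.
split; first exact (@saddr R R^o _ _ (pideal_ideal a)).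
move=> h; have /conductor_factor[x Sx] : c a.
  by apply: h; apply: (@saddl R R^o _ _ ic); exact: pideal_gen.
rewrite algM -mulrA -[LHS]mulr1 => /(mulrI ua) e1.
have SmS : S `<=` [set 0].
  apply: (nakayama noeth loc (lattice_fin_gen noeth hQ lS)); first exact: submod_zero.
  move=> y Sy; apply: (saddr (@submod_zero _ _)).
  by rewrite -(mul1r y) e1 -mulrA mulr_algl; apply: idprod_in => //; exact: SM.
by have /eqP := SmS _ S1; rewrite oner_eq0.
Qed.

End Converse.
End UlrichAboveConductor.

(** * Ulrich ideals with A/R of rank at least two contain the conductor *)

Section NonTwoGenerated.
Variables (R : comNzRingType) (m : set R) (Q : comUnitAlgType R).
Hypotheses (noeth : noetherian R) (loc : local_with m) (dim1 : has_dim (R^o : lmodType R) 1).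
Hypothesis hQ : total_fractions Q.
Variables (L : set Q) (c : set R).
Hypotheses (lL : lattice L) (RL : @base R Q `<=` L) (socL : has_length (socle_over m L) L 1).
Hypothesis cL : forall r x, c r -> L x -> exists2 s, c s & r *: x = s%:A.

(** By biduality the sum is the dual of its own dual, which is X ∩ Y. *)
Lemma colon_socle_sum (X Y : set Q) : lattice X -> lattice Y ->
  sadd (colon L X) (colon L Y) = colon L (X `&` Y).
Proof.
move=> lX lY; have lZ := lattice_add (lattice_colon lL lX) (lattice_colon lL lY).
rewrite -[LHS](colon_bidual noeth loc dim1 hQ lL socL lZ); congr colon.
rewrite (colon_add lL) ?(colon_bidual noeth loc dim1 hQ lL socL) //.
  exact: colon_submod (lattice_submod lL).
exact: colon_submod (lattice_submod lL).
Qed.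

(* Two independent elements f, g of A / R satisfy (R + R f) /\ (R + R g) = R,
   so by duality 1 is a sum of elements of K : (R + R f) and K : (R + R g). *)
Lemma ulrich_above_conductor (I : set R) (a : R) (A : set Q) n (f : 'I_n -> Q) :
  ulrich_data m I a A f -> (1 < n)%N -> c `<=` I.
Proof.
move=> hU n1 g cg.
have iI : ideal I by case: hU => -[].
have Af i : A (f i) by case: hU => _ _ _ [].
have Aabs r x : I r -> A x -> exists2 t, I t & r *: x = t%:A by exact: (ulrich_absorb hQ hU).
have indA (r : 'I_n -> R) : base (\sum_i r i *: f i) -> forall i, I (r i).
  by case: hU => _ _ _ _; apply.
pose i0 := Ordinal (ltnW n1); pose i1 := Ordinal n1.
have sb := base_submod Q.
have ind1 i r : base (r *: f i) -> I r.
  move=> br; have := indA (fun j => if j == i then r else 0).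
  rewrite (bigD1 i) //= eqxx big1 ?addr0; last by move=> j /negbTE ->; rewrite scale0r.
  by move=> /(_ br i); rewrite eqxx.
have ind2 r t : base (r *: f i0 - t *: f i1) -> I r.
  move=> br; have := indA (fun j => if j == i0 then r else if j == i1 then - t else 0).
  rewrite (bigD1 i0) //= (bigD1 i1) //= big1 ?addr0; last first.
    by move=> j /andP[/negbTE -> /negbTE ->]; rewrite scale0r.
  by rewrite scaleNr => /(_ br i0); rewrite eqxx.
pose X i := sadd (@base R Q) (submod_span [set f i]).
have sX i : submod (X i) by apply: sadd_submod => //; exact: span_submod.
have XA i : X i `<=` A.
  have sA : submod A by case: hU => _ [[]].
  by apply: sadd_min => //; [move=> _ [r _ <-]; exact: (ulrich_base hU)|exact: span1_sub].
have lX i : lattice (X i).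
  by apply: (lattice_sandwich (lattice_base Q) (ulrich_lattice hU) (sX i)) => //; apply: saddl; exact: span_submod.
have EX : X i0 `&` X i1 = @base R Q.
  rewrite eqEsubset; split; last by move=> x bx; split; apply: saddl => //; exact: span_submod.
  move=> x [[b0 bb0 [_ /span1P[r ->] <-]] [b1 bb1 [_ /span1P[t ->] e]]].
  have Ir : I r.
    apply: (ind2 r t); have -> : r *: f i0 - t *: f i1 = b1 - b0.
      by apply/eqP; rewrite subr_eq addrAC e addrAC subrr add0r.
    exact: submodB.
  by apply: (submodD sb) => //; have [w _ ->] := Aabs _ _ Ir (Af i0); exact: base_alg.
have : colon L (X i0 `&` X i1) 1 by rewrite EX (colon_base lL); apply: RL; exact: base1.
rewrite -colon_socle_sum // => -[p hp [q hq epq]].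
have X1 i : X i 1 by apply: saddl; [exact: span_submod|exact: base1].
have Xf i : X i (f i) by apply: (saddr sb); exact: sub_span.
(* For g in c, gz is an element r of c, and r f_i = g (z f_i) lies in gL, so in R; independence puts
   r into I. Writing 1 as a sum of two such z then gives g in I. *)
have mem i z : colon L (X i) z -> exists2 r, I r & g *: z = r%:A.
  move=> hz; have Lz : L z by rewrite -(mulr1 z); exact: hz.
  have [r _ er] := cL cg Lz; exists r => //; apply: (ind1 i).
  rewrite -mulr_algl -er -scalerAl.
  by have [w _ ->] := cL cg (hz _ (Xf i)); exact: base_alg.
have [r Ir er] := mem _ _ hp; have [t It et] := mem _ _ hq.
suff -> : g = r + t by exact: idealD.
by apply: (alg_inj hQ); rewrite algD -er -et -scalerDr epq.
Qed.

End NonTwoGenerated.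

(** * Hilbert's basis theorem *)

Section HilbertBasis.
Variable A : comNzRingType.
Hypothesis noeth : noetherian A.

(** One ideal of leading coefficients is enough: in degrees at least D the p_i lower the degree, and
    the elements of J of degree below D form a submodule of a finitely generated A-module. *)
Theorem hilbert_basis : noetherian {poly A}.
Proof.
move=> J iJ.
(* The coefficient in a formal degree d bounding that of p, rather than the true leading
   coefficient: zero is then included, and two polynomials can be shifted to the common degree d +
   d'. *)
pose LI := [set a : A | exists p d, [/\ J p, (size p <= d.+1)%N & p`_d = a]].
have shift p k : J p -> J (p * 'X^k) by move=> Jp; rewrite mulrC; exact: (idealM _ iJ).
have iLI : ideal LI.
  split; first by exists 0, 0%N; split; [exact: ideal0|rewrite size_poly0|rewrite coef0].
  move=> r _ _ [p [d [Jp sp <-]]] [q [d' [Jq sq <-]]].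
  exists (r *: (p * 'X^d') + q * 'X^d), (d + d')%N; split.
  - by apply: (idealD iJ); [rewrite -mul_polyC; apply: (idealM _ iJ)|]; exact: shift.
  - apply: leq_trans (size_polyD _ _) _; rewrite geq_max; apply/andP; split.
      apply: leq_trans (size_scale_leq _ _) _; apply: leq_trans (size_polyMleq _ _) _.
      by rewrite size_polyXn addnS /= -addSn leq_add2r.
    apply: leq_trans (size_polyMleq _ _) _.
    by rewrite size_polyXn addnS /= [(d + d')%N]addnC -addSn leq_add2r.
  - by rewrite coefD coefZ !coefMXn !ifN -?leqNgt ?leq_addl ?leq_addr // addnK addKn.
have [k [g eLI]] := noeth iLI.
have LIg i : LI (g i) by rewrite eLI; exact: (@span_in A A^o).
have [p hp] := choice LIg; have [d hd] := choice hp.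
pose D := \max_i d i.
pose V := submod_span (range (fun i : 'I_D => 'X^i : {poly A})).
pose JD := [set q : {poly A} | J q /\ (size q <= D)%N].
have sJD : submod (JD : set {poly A}).
  split; first by split; [exact: ideal0|rewrite size_poly0].
  move=> r q q' [Jq sq] [Jq' sq']; split.
    by apply: (idealD iJ) => //; rewrite -mul_polyC; exact: (idealM _ iJ).
  apply: leq_trans (size_polyD _ _) _; rewrite geq_max sq' andbT.
  exact: leq_trans (size_scale_leq _ _) sq.
have JDV : JD `<=` V.
  move=> q [_ sq]; apply/span_rangeP; exists (fun i => q`_i).
  rewrite -(poly_def D (fun i => q`_i)); apply/polyP => j; rewrite coef_poly.
  by case: ltnP => // Dj; rewrite nth_default //; exact: leq_trans sq Dj.
have [k' [h eJD]] := noetherian_submod noeth (fin_gen_span _ : fin_gen V) sJD JDV.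
have JDh i : JD (h i) by rewrite eJD; exact: span_in.
pose S1 := submod_span (range (p : _ -> {poly A}^o)).
pose S2 := submod_span (range (h : _ -> {poly A}^o)).
have s1 : submod S1 by exact: span_submod.
have s2 : submod S2 by exact: span_submod.
have sS := sadd_submod s1 s2.
have EJ : (J : set {poly A}^o) = sadd S1 S2.
  rewrite eqEsubset; split; last first.
    apply: sadd_min => //; apply: (@span_range_sub _ {poly A}^o) => // i.
      by case: (hd i).
    by case: (JDh i).
  suff H n q : J q -> (size q <= n)%N -> sadd S1 S2 q by move=> q Jq; exact: (H (size q)).
  elim: n q => [|n IH] q Jq.
    by rewrite leqn0 size_poly_eq0 => /eqP ->; exact: (submod0 sS).
  move=> sq; have [nD|Dn] := ltnP n D.
    have : JD q by split=> //; exact: leq_trans nD.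
    rewrite eJD => /span_rangeP[r ->]; apply: (saddr s1).
    apply: (@submod_sum _ {poly A}^o _ _ _ _ s2) => i _.
    rewrite -mul_polyC; apply: (@submodZ _ {poly A}^o _ _ _ s2); exact: (@span_in _ {poly A}^o).
  have : LI q`_n by exists q, n.
  rewrite eLI => /(@span_rangeP A A^o)[r er].
  pose t := \sum_i (r i)%:P * 'X^(n - d i) * p i.
  have dn i : (d i <= n)%N by apply: leq_trans Dn; exact: (leq_bigmax i).
  have St : sadd S1 S2 t.
    apply: (saddl s2); apply: (@submod_sum _ {poly A}^o _ _ _ _ s1) => i _.
    apply: (@submodZ _ {poly A}^o _ _ _ s1); exact: (@span_in _ {poly A}^o).
  rewrite -(subrK t q); apply: (@submodD _ {poly A}^o _ _ _ sS) => //; apply: IH.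
    apply: (idealB iJ) => //; apply: (@submod_sum _ {poly A}^o _ _ _ _ iJ) => i _.
    by apply: (idealM _ iJ); case: (hd i).
  have st : (size t <= n.+1)%N.
    apply: leq_trans (size_sum _ _ _) _; apply/bigmax_leqP => i _.
    rewrite -mulrA mul_polyC; apply: leq_trans (size_scale_leq _ _) _.
    apply: leq_trans (size_polyMleq _ _) _; rewrite size_polyXn addSn /=.
    have [_ sp _] := hd i; apply: leq_trans (leq_add (leqnn _) sp) _.
    by rewrite addnS subnK.
  apply/leq_sizeP => j; rewrite leq_eqVlt => /orP[/eqP <-|nj]; last first.
    by rewrite coefB !nth_default ?subrr //; exact: leq_trans nj.
  rewrite coefB er coef_sum; apply/eqP; rewrite subr_eq0; apply/eqP.
  apply: eq_bigr => i _; rewrite -mulrA mul_polyC coefZ coefXnM ltnNge leq_subr /=.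
  by rewrite subKn //; have [_ _ ->] := hd i.
rewrite EJ; apply: (@fin_gen_add _ {poly A}^o); exact: fin_gen_span.
Qed.

End HilbertBasis.

(** * Stabilization of graded ideals in the Rees algebra *)

Section Rees.
Variables (R : comNzRingType) (m : set R).
Hypotheses (noeth : noetherian R) (im : ideal m).

Definition rees (p : {poly R}) : Prop := forall j, ideal_pow m j p`_j.

Lemma ideal_pow_mul i j r s : ideal_pow m i r -> ideal_pow m j s -> ideal_pow m (i + j) (r * s).
Proof. by rewrite ideal_powD; exact: ideal_mul_in. Qed.

Lemma reesM p q : rees p -> rees q -> rees (p * q).
Proof.
move=> hp hq j; rewrite coefM; apply: (@submod_sum R R^o _ _ _ _ (ideal_pow_ideal m j)) => i _.
have := ideal_pow_mul (hp i) (hq (j - i)%N); rewrite subnKC //.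
by rewrite -ltnS.
Qed.

Lemma reesD p q : rees p -> rees q -> rees (p + q).
Proof. by move=> hp hq j; rewrite coefD; exact: (idealD (ideal_pow_ideal m j)). Qed.

Lemma rees1 : rees 1.
Proof. by case=> [//|j]; rewrite coef1; exact: (ideal0 (ideal_pow_ideal m _)). Qed.

Lemma rees_X x : m x -> rees (x *: 'X).
Proof.
move=> mx [|[|j]]; rewrite coefZ coefX /= ?mulr1 ?mulr0 //.
  by suff : ideal_pow m 1 x by []; rewrite ideal_pow1.
exact: (ideal0 (ideal_mul_ideal _ _)).
Qed.

(** The Rees algebra is reached through a Noetherian ring mapping to it, an iterated polynomial ring
    over R with a variable sent to xX for each x in s; the subring itself is never constructed. *)
Lemma rees_presentation (s : seq R) : (forall x, x \in s -> m x) ->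
  exists (A : comNzRingType) (phi : {rmorphism A -> {poly R}}),
  [/\ noetherian A, forall a, rees (phi a), forall r, exists a, phi a = r%:P &
      forall x, x \in s -> exists a, phi a = x *: 'X].
Proof.
elim: s => [|x s IH] ms.
  exists R, (polyC : {rmorphism R -> {poly R}}); split=> //; last by move=> r; exists r.
  move=> a [|j]; first by [].
  by rewrite coefC; exact: (ideal0 (ideal_pow_ideal m _)).
have [|A [phi [nA rA cA xA]]] := IH; first by move=> y ys; apply: ms; rewrite in_cons ys orbT.
have cfu : commr_rmorph phi (x *: 'X) by move=> a; exact: mulrC.
exists {poly A}, (horner_morph cfu : {rmorphism {poly A} -> {poly R}}); split.
- exact: hilbert_basis.
- move=> p; rewrite /= /horner_morph horner_coef.
  elim/big_ind: _ => [|p1 p2|i _]; first by move=> j; rewrite coef0; exact: (ideal0 (ideal_pow_ideal m _)).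
    exact: reesD.
  apply: reesM; first by rewrite coef_map; exact: rA.
  elim: (i : nat) => [|n IHn]; first by rewrite expr0; exact: rees1.
  by rewrite exprS; apply: reesM => //; apply: rees_X; apply: ms; rewrite mem_head.
- by move=> r; have [a ea] := cA r; exists a%:P; rewrite /= horner_morphC.
- move=> y; rewrite in_cons => /orP[/eqP ->|/xA[a ea]]; first by exists 'X; rewrite /= horner_morphX.
  by exists a%:P; rewrite /= horner_morphC.
Qed.

(** The J_i are the components of a graded ideal of the Rees algebra. Its preimage in a Noetherian
    ring mapping onto that algebra is finitely generated, so past the degrees of the generators each
    component is m times the preceding one. *)
Lemma rees_family (J : nat -> set R) : (forall i, ideal (J i)) ->
  (forall i, J i `<=` ideal_pow m i) ->
  (forall i r x, m r -> J i x -> J i.+1 (r * x)) ->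
  exists D, forall i, (D <= i)%N -> J i.+1 `<=` ideal_mul m (J i).
Proof.
move=> iJ Jm mJ; have [n [g eg]] := noeth im.
have mg i : m (g i) by rewrite eg; exact: (@span_in R R^o).
have [|A [phi [nA rA cA xA]]] := @rees_presentation (codom g).
  by move=> x /codomP[i ->].
have mnJ t i r x : ideal_pow m t r -> J i x -> J (t + i)%N (r * x).
  elim: t i r x => [|t IH] i r x; first by move=> _ Jx; exact: idealM.
  move=> mr Jx; move: r mr; apply: (@idprod_min R R^o _ _ [set r : R | J (t.+1 + i)%N (r * x)]).
    split=> /= [|r a b Ja Jb]; first by rewrite mul0r; exact: ideal0.
    rewrite mulrDl -[r *: a]/(r * a) -mulrA; exact (idealD (iJ _) (idealM r (iJ _) Ja) Jb).
  move=> r s mr ms /=; rewrite -[r *: s]/(r * s) -mulrA addSn; apply: mJ => //; exact: IH.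
pose JJ := [set a : A | forall j, J j (phi a)`_j].
have iJJ : ideal JJ.
  split; first by move=> j; rewrite rmorph0 coef0; exact: ideal0.
  move=> b a a' Ja Ja' j; rewrite rmorphD -[b *: a]/(b * a) rmorphM /= coefD.
  apply: (idealD (iJ j)) => //; rewrite coefM.
  apply: (@submod_sum R R^o _ _ _ _ (iJ j)) => i _.
  by have := mnJ _ _ _ _ (rA b i) (Ja (j - i)%N); rewrite subnKC // -ltnS.
have [k [a ea]] := nA _ iJJ.
have JJa l : JJ (a l) by rewrite ea; exact: (@span_in A A^o).
have surj j w : ideal_pow m j w -> exists b, phi b = w *: 'X^j.
  elim: j w => [|j IH] w; first by move=> _; have [b eb] := cA w; exists b; rewrite eb expr0 alg_polyC.
  pose T := [set w : R | exists b, phi b = w *: 'X^(j.+1)].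
  have sT : ideal T.
    split; first by exists 0; rewrite rmorph0 scale0r.
    move=> r x y [b eb] [b' eb']; have [c ec] := cA r; exists (c * b + b').
    by rewrite rmorphD rmorphM /= eb eb' ec mul_polyC scalerDl scalerA.
  move: w; apply: (@idprod_min R R^o _ _ T) => // r x mr mx.
  have [b eb] := IH _ mx; move: r mr; rewrite eg.
  move=> r /(@span_rangeP R R^o)[c ->]; rewrite scaler_suml.
  apply: (@submod_sum R R^o _ _ _ _ sT) => i _.
  have [c' ec'] := cA (c i); have [q eq] := xA (g i) (codom_f g i).
  exists (c' * q * b); rewrite !rmorphM /= ec' eq eb exprS -[(c i *: g i) *: x]/(c i * g i * x).
  by rewrite -!mul_polyC !polyCM; ring.
(* Every generator has degree below D <= i, so in degree i + 1 its cofactor has degree at least 1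
   and supplies a factor from m. *)
exists (\max_l size (phi (a l)))%N => i Di w Jw.
have [b eb] := surj _ _ (Jm _ _ Jw).
have : JJ b.
  move=> j; rewrite eb coefZ coefXn; case: eqP => [->|_]; rewrite ?mulr1 // mulr0; exact: ideal0.
rewrite ea => /(@span_rangeP A A^o)[c ec].
have iM := ideal_mul_ideal m (J i).
have -> : w = (phi b)`_i.+1 by rewrite eb coefZ coefXn eqxx mulr1.
rewrite ec rmorph_sum coef_sum; apply: (@submod_sum R R^o _ _ _ _ iM) => l _.
rewrite -[c l *: a l]/(c l * a l) rmorphM coefMr.
apply: (@submod_sum R R^o _ _ _ _ iM) => -[t /= ti] _.
have [sz|sz] := leqP (size (phi (a l))) t.
  by rewrite (nth_default 0 sz) mulr0; exact: (ideal0 iM).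
have tD : (t < i.+1)%N by apply: leq_trans sz _; apply: leqW; apply: leq_trans Di; exact: (leq_bigmax l).
have E : (i.+1 - t = (i - t).+1)%N by rewrite subSn.
move: (rA (c l) (i.+1 - t)%N); rewrite {1}E => h.
move: {h} (phi (c l))`_(i.+1 - t) h.
apply: (@idprod_min R R^o _ _ [set z : R | ideal_mul m (J i) (z * (phi (a l))`_t)]).
  split=> /= [|r x y hx hy]; first by rewrite mul0r; exact: (ideal0 iM).
  rewrite mulrDl -[r *: x]/(r * x) -mulrA; exact (idealD iM (idealM r iM hx) hy).
move=> r x mr mx /=; rewrite -[r *: x]/(r * x) -mulrA; apply: ideal_mul_in => //.
by have := mnJ _ _ _ _ mx (JJa l t); rewrite subnK.
Qed.

End Rees.

(** * Generators from composition series, linear dependence *)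

Section LengthTools.
Variables (R : comNzRingType) (V : lmodType R).

Lemma has_length_lift (A B : set V) n : has_length A B n ->
  exists2 E, gen_by n E & A = sadd B E.
Proof.
elim: n A => [|n IH] A.
  move=> /has_length0[-> sB]; exists [set 0]; first exact: gen_by_zero.
  rewrite eqEsubset; split; first by apply: saddl; exact: submod_zero.
  by apply: sadd_min => // _ ->; exact: submod0.
move=> /has_lengthS[A' [sA sA' [A'A nAA'] mx] /IH[E gE eA']].
have /existsNP[x /not_implyP[Ax nA'x]] := nAA'.
have sx := span_submod [set x].
exists (sadd (submod_span [set x]) E).
  by rewrite -addn1 addnC; apply: gen_by_add => //; exact: gen_by1.
have sE : submod E by apply: fin_gen_submod; exists n.
have sub : sadd A' (submod_span [set x]) `<=` A by apply: sadd_min => //; exact: span1_sub.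
have [E1|<-] := mx _ (sadd_submod sA' sx) (saddl sx) sub.
  by case: nA'x; rewrite -E1; apply: (saddr sA'); exact: sub_span.
rewrite eA' eqEsubset; split.
  move=> _ [_ [b Bb [e Ee <-]] [y xy <-]]; exists b => //; exists (y + e); last by rewrite [y + e]addrC addrA.
  by exists y => //; exists e.
move=> _ [b Bb [_ [y xy [e Ee <-]] <-]]; exists (b + e); first by exists b => //; exists e.
by exists y => //; rewrite addrAC addrA.
Qed.

(** Lifting a composition series of A/mA gives n elements that generate A by Nakayama;
    [has_length_gens] excludes fewer. *)
Lemma mu_length (m : set R) (A : set V) n : noetherian R -> local_with m -> fin_gen A ->
  has_length A (idprod m A) n -> mu A = n.
Proof.
move=> noeth loc fA hn; have sA := fin_gen_submod fA.
have s1 := idprod_submod m A.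
have [E gE eA] := has_length_lift hn.
have sE : submod E by apply: fin_gen_submod; exists n.
have EA : E = A.
  rewrite eqEsubset; split; first by rewrite eA; exact: saddr.
  by apply: (nakayama noeth loc fA sE); rewrite saddC -eA.
have le k : gen_by k A -> (n <= k)%N.
  move=> gA; have [j jk hj] := has_length_gens noeth loc s1 gA (@subset_refl _ _).
  suff e' : sadd (idprod m A) A = A by rewrite e' in hj; rewrite (has_length_uniq hn hj).
  by rewrite eqEsubset; split; [apply: sadd_min => //; exact: idprod_sub|exact: saddr].
rewrite EA in gE.
have [h1 h2] := xgetPex 0%N (ex_intro (fun n => gen_by n A /\ forall k, gen_by k A -> (n <= k)%N) n (conj gE le)).
by apply/eqP; rewrite eqn_leq h2 // le.
Qed.

(** The submodules T + R w_0 + ... + R w_{i-1} cannot grow strictly d + 1 times. The relation is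
    solved for the last vector, so it is monic when applied to powers. *)
Lemma linear_dependence (D T : set V) d (w : nat -> V) : has_length D T d ->
  (forall i, D (w i)) ->
  exists i (r : 'I_i -> R), T (w i - \sum_(l < i) r l *: w l) /\ (i <= d)%N.
Proof.
move=> hd Dw; have [sD sT] := has_length_submod hd; have TD := has_length_sub hd.
apply: contrapT => nex.
pose U i := comb T setT (fun l : 'I_i => w l).
have sU i : submod (U i) by exact: comb_submod.
have UD i : U i `<=` D by apply: comb_min => // l r _; exact: submodZ.
have TU i : T `<=` U i by exact: comb_sub.
have nU i : (i <= d)%N -> ~ U i (w i).
  by move=> id [r _ Tr]; apply: nex; exists i, r.
have UU i : U i `<=` U i.+1.
  apply: comb_min => // l r _.
  exact: (@comb_in _ _ i.+1 T setT (fun l : 'I_i.+1 => w l) r (widen_ord (leqnSn i) l) sT).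
have Uw i : U i.+1 (w i).
  rewrite -(scale1r (w i)).
  exact: (@comb_in _ _ i.+1 T setT (fun l : 'I_i.+1 => w l) 1 ord_max sT).
have : forall i, (i <= d.+1)%N -> exists2 k, (i <= k)%N & has_length (U i) T k.
  elim=> [_|i IH id].
    have [_ [k hk]] := fin_len_split (sU 0%N) (TU _) (UD _) (ex_intro _ d hd).
    by exists k.
  have [k ik hk] := IH (ltnW id).
  have [_ [k' hk']] := fin_len_split (sU i.+1) (TU _) (UD _) (ex_intro _ d hd).
  have [le eqk] := has_length_le (sU i) (TU i) (UU i) hk' hk.
  exists k' => //; rewrite (leq_ltn_trans ik) // ltn_neqAle le andbT.
  by apply/eqP => /eqk E; apply: (nU i) => //; rewrite E.
move=> /(_ _ (leqnn _))[k dk hk].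
have [le _] := has_length_le (sU d.+1) (TU _) (UD _) hd hk.
by have := leq_trans dk le; rewrite ltnn.
Qed.

End LengthTools.

(** * Powers of m and multiplication by a polynomial whose coefficients generate m *)

Section Powers.
Variables (R : comNzRingType) (m : set R).
Hypotheses (noeth : noetherian R) (loc : local_with m) (dim1 : has_dim (R^o : lmodType R) 1).
Hypothesis hreg : exists2 y, m y & regular_elt y.

Let im := max_ideal loc.
Notation mp := (ideal_pow m).
Let imp i : ideal (mp i) := ideal_pow_ideal m i.

Lemma max_pow1 r : m r -> mp 1 r. Proof. by rewrite ideal_pow1. Qed.

Lemma max_powS i r s : m r -> mp i s -> mp i.+1 (r * s).
Proof. exact: ideal_mul_in. Qed.

(** The elements killed by the positive part of the associated graded ring vanish in large degree:
    with J_i as below, stabilization gives J_{i+1} inside m J_i, and m J_i lies in m^(i+2) by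
    definition. *)
Lemma socle_vanish : exists i0, forall i, (i0 <= i)%N -> forall w, mp i w ->
  (forall r, m r -> mp i.+2 (r * w)) -> mp i.+1 w.
Proof.
pose J i := [set w | mp i w /\ forall r, m r -> mp i.+2 (r * w)].
have [|||D hD] := @rees_family R m noeth im J.
- move=> i; split; first by split=> [|r _]; rewrite ?mulr0; exact: (ideal0 (imp _)).
  move=> r x y [mx hx] [my hy]; split; first exact (idealD (imp _) (idealM r (imp _) mx) my).
  move=> s ms; rewrite mulrDr -[r *: x]/(r * x) mulrCA.
  exact (idealD (imp _) (idealM r (imp _) (hx _ ms)) (hy _ ms)).
- by move=> i x [].
- move=> i r x mr [mx hx]; split; first exact: max_powS.
  by move=> s ms; apply: max_powS => //; exact: hx.
exists D.+1 => -[//|i] Di w mw hw.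
have : ideal_mul m (J i) w by apply: hD.
by apply: (@idprod_min R R^o _ _ _ (imp i.+2)) => r x mr [_ hx]; exact: hx.
Qed.

Lemma artin_rees y : m y -> exists D, forall n x, (D <= n)%N -> mp n (y * x) ->
  exists2 z, mp (n - D) z & y * x = y * z.
Proof.
move=> my; pose J i := [set w | mp i w /\ exists x, w = y * x].
have [|||D hD] := @rees_family R m noeth im J.
- move=> i; split; first by split; [exact: (ideal0 (imp _))|exists 0; rewrite mulr0].
  move=> r w w' [mw [x ew]] [mw' [x' ew']]; split.
    exact (idealD (imp _) (idealM r (imp _) mw) mw').
  by exists (r * x + x'); rewrite -[r *: w]/(r * w) ew ew'; ring.
- by move=> i w [].
- by move=> i r w mr [mw [x ew]]; split; [exact: max_powS|exists (r * x); rewrite ew; ring].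
exists D => n x Dn; rewrite -{1}(subnK Dn).
have iY j : ideal [set w | exists2 z, mp j z & w = y * z].
  split; first by exists 0; [exact: (ideal0 (imp _))|rewrite mulr0].
  move=> r _ _ [z mz ->] [z' mz' ->]; exists (r * z + z').
    exact (idealD (imp _) (idealM r (imp _) mz) mz').
  by rewrite -[r *: _]/(r * (y * z)); ring.
suff H k : J (k + D)%N `<=` [set w | exists2 z, mp k z & w = y * z].
  by move=> mx; apply: H; split=> //; exists x.
elim: k => [|k IH]; first by move=> _ [_ [z ->]]; exists z.
apply: subset_trans (hD (k + D)%N (leq_addl _ _)) _.
apply: (@idprod_min R R^o _ _ _ (iY k.+1)) => r w mr /IH[z mz ->]; exists (r * z); first exact: max_powS.
by rewrite -[r *: _]/(r * (y * z)); ring.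
Qed.

(** This is m^(j+t) : m^t = m^j for large j. For t = 1, Artin-Rees with a regular y first places w
    in m^i0, and [socle_vanish] then raises the exponent one at a time up to j. The general case
    iterates this. *)
Lemma ratliff_rush : exists j1, forall j, (j1 <= j)%N -> forall t w,
  (forall v, mp t v -> mp (j + t) (v * w)) -> mp j w.
Proof.
have [i0 hi0] := socle_vanish; have [y my ry] := hreg; have [D hD] := artin_rees my.
have step j w : (D + i0 <= j)%N -> (forall r, m r -> mp j.+1 (r * w)) -> mp j w.
  move=> Dj hw.
  have [|z mz /eqP] := hD j.+1 w _ (hw _ my); first by apply: leqW; apply: leq_trans Dj; exact: leq_addr.
  rewrite -subr_eq0 -mulrBr => /eqP /ry /eqP; rewrite subr_eq0 => /eqP ez; rewrite -ez in mz.
  suff H k : (i0 + k <= j)%N -> mp (i0 + k) w.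
    have i0j : (i0 <= j)%N by apply: leq_trans Dj; exact: leq_addl.
    by rewrite -(subnKC i0j); apply: H; rewrite subnKC.
  elim: k => [_|k IH ikj].
    by apply: ideal_pow_dec mz; rewrite addn0; lia.
  rewrite addnS; apply: hi0; [exact: leq_addr|apply: IH; lia|].
  by move=> r mr; apply: (@ideal_pow_dec _ _ _ j.+1); [lia|exact: hw].
exists (D + i0)%N => j Dj; elim=> [|t IH] w hw.
  by have := hw 1 I; rewrite addn0 mul1r.
apply: IH => v mv; apply: step; first exact: (leq_trans Dj (leq_addr _ _)).
move=> r mr; rewrite mulrA -addnS; apply: hw; exact: max_powS.
Qed.

Section GenericElement.
Variable x : {poly R}.
Hypothesis mx : forall i, m x`_i.
Hypothesis genx : forall A : set R, ideal A -> (forall i, A x`_i) -> m `<=` A.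

Definition coefs_in (I : set R) (p : {poly R}) : Prop := forall i, I p`_i.

Lemma coefs_inD I p q : ideal I -> coefs_in I p -> coefs_in I q -> coefs_in I (p + q).
Proof. by move=> iI hp hq i; rewrite coefD; exact: idealD. Qed.

Lemma coefs_inB I p q : ideal I -> coefs_in I p -> coefs_in I q -> coefs_in I (p - q).
Proof. by move=> iI hp hq i; rewrite coefB; exact: idealB. Qed.

Lemma coefs_inZ I r p : ideal I -> coefs_in I p -> coefs_in I (r *: p).
Proof. by move=> iI hp i; rewrite coefZ; exact: idealM. Qed.

Lemma coefs_in_mulr I p q : ideal I -> coefs_in I p -> coefs_in I (p * q).
Proof.
move=> iI hp i; rewrite coefM; apply: (@submod_sum R R^o _ _ _ _ iI) => j _.
by apply: idealMr.
Qed.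

Lemma coefs_in_powM i j p q : coefs_in (mp i) p -> coefs_in (mp j) q -> coefs_in (mp (i + j)) (p * q).
Proof.
move=> hp hq k; rewrite coefM; apply: (@submod_sum R R^o _ _ _ _ (imp _)) => l _.
exact: ideal_pow_mul.
Qed.

Let mx1 : coefs_in (mp 1) x. Proof. by move=> i; exact: max_pow1. Qed.

Lemma coefs_in_genericM i p : coefs_in (mp i) p -> coefs_in (mp i.+1) (x * p).
Proof. by move=> hp; rewrite -add1n; exact: coefs_in_powM. Qed.

(* McCoy's argument: the product of [u] with the top coefficient of [x] that does
   not kill it has smaller degree and is still annihilated by [x]. *)
Lemma mccoy i0 : (forall i, (i0 <= i)%N -> forall w, mp i w ->
    (forall r, m r -> mp i.+2 (r * w)) -> mp i.+1 w) ->
  forall n i (u : {poly R}), (i0 <= i)%N -> (size u <= n)%N -> coefs_in (mp i) u -> coefs_in (mp i.+2) (x * u) ->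
  coefs_in (mp i.+1) u.
Proof.
move=> hi0; elim=> [|n IH] i u i0i su mu mxu.
  by move: su; rewrite leqn0 size_poly_eq0 => /eqP -> j; rewrite coef0; exact: (ideal0 (imp _)).
suff key t : forall l, (size x <= l + t)%N -> coefs_in (mp i.+2) (x`_l *: u).
  move=> j; apply: hi0 => // r mr.
  have iA : ideal [set r | mp i.+2 (r * u`_j)].
    have i2 := imp i.+2.
    split=> [|a b c hb hc]; first by rewrite /mkset mul0r; exact: ideal0.
    rewrite /mkset mulrDl -[a *: b]/(a * b) -mulrA; exact (idealD i2 (idealM a i2 hb) hc).
  apply: (genx iA) => // l; have := key (size x) l (leq_addl _ _) j.
  by rewrite coefZ.
elim: t => [|t IHt] l xl.
  rewrite addn0 in xl; move=> j; rewrite (nth_default 0 xl) scale0r coef0.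
  exact: (ideal0 (imp _)).
have top : mp i.+2 (x`_l * u`_n).
  have := mxu (l + n)%N; rewrite coefM.
  have ll : (l < (l + n).+1)%N by rewrite ltnS leq_addr.
  rewrite (bigD1 (Ordinal ll)) //= addKn => h.
  apply: (@submodK R R^o _ _ _ (imp i.+2)); last by rewrite addrC; exact: h.
  apply: (@submod_sum R R^o _ _ _ _ (imp i.+2)) => -[a /= al] /eqP/eqP nal.
  have [lta|lta|eqa] := ltngtP a l; last by case/eqP: nal; apply: val_inj.
    rewrite (nth_default 0 (_ : (size u <= l + n - a)%N)) ?mulr0; first exact (ideal0 (imp i.+2)).
    by apply: leq_trans su _; lia.
  by have := IHt a _ (l + n - a)%N; rewrite coefZ; apply; lia.
pose u' := x`_l *: (u - u`_n *: 'X^n).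
have su' : (size u' <= n)%N.
  apply: leq_trans (size_scale_leq _ _) _; apply/leq_sizeP => j.
  rewrite coefB coefZ coefXn leq_eqVlt => /orP[/eqP <-|nj]; first by rewrite eqxx mulr1 subrr.
  by rewrite gtn_eqF // mulr0 subr0 nth_default //; exact: leq_trans su nj.
have eu : x`_l *: u = u' + (x`_l * u`_n) *: 'X^n.
  by rewrite /u' scalerBr scalerA subrK.
have muX : coefs_in (mp i.+2) ((x`_l * u`_n) *: 'X^n).
  by move=> j; rewrite coefZ; exact: (idealMr _ (imp _)).
have mu' : coefs_in (mp i.+1) u'.
  move=> j; rewrite coefZ; apply: max_powS => //; rewrite coefB; apply: (idealB (imp _)) => //.
  by rewrite coefZ; exact: (idealMr _ (imp _)).
have mxu' : coefs_in (mp i.+3) (x * u').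
  have -> : x * u' = x`_l *: (x * u) - x * ((x`_l * u`_n) *: 'X^n).
    by rewrite -[u'](addrK ((x`_l * u`_n) *: 'X^n)) -eu mulrBr -scalerAr.
  apply: (coefs_inB (imp _)); last exact: coefs_in_genericM.
  by move=> j; rewrite coefZ; exact: max_powS.
rewrite eu; apply: (coefs_inD (imp _)) => //.
by apply: (IH i.+1) => //; exact: leqW.
Qed.

(** By [ratliff_rush] it is enough to treat vu for v in m^i0. Its coefficients start in m^i0, where
    [mccoy] applies and raises the exponent step by step to i0 + j. *)
Lemma kernel_bound : exists j0, forall j u, (j0 <= j)%N -> coefs_in (mp j.+1) (x * u) -> coefs_in (mp j) u.
Proof.
have [i0 hi0] := socle_vanish; have [j1 hj1] := ratliff_rush.
exists j1 => j u j1j mxu w; apply: (hj1 _ j1j i0) => v mv.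
suff H k : (k <= j)%N -> coefs_in (mp (i0 + k)) (v *: u).
  by have := H j (leqnn _) w; rewrite coefZ addnC.
elim: k => [_ l|k IH kj]; first by rewrite addn0 coefZ; exact: (idealMr _ (imp _)).
rewrite addnS; apply: (mccoy hi0 (n := size (v *: u))) => //; first exact: leq_addr.
  by apply: IH; exact: ltnW.
move=> l; rewrite -scalerAr coefZ; apply: (@ideal_pow_dec _ _ _ (i0 + j.+1)); first by lia.
exact: ideal_pow_mul.
Qed.

(** I[X] truncated to degree below n; unlike I[X]/J[X], the truncated quotient has finite length, n
    times that of I/J. *)
Definition PN n (I : set R) : set {poly R} := [set p : {poly R} | (size p <= n)%N /\ coefs_in I p].

Lemma PN_submod n I : ideal I -> submod (PN n I).
Proof.
move=> iI; split; first by split; [rewrite size_poly0|move=> i; rewrite coef0; exact: ideal0].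
move=> r p q [sp hp] [sq hq]; split; last by apply: coefs_inD => //; exact: coefs_inZ.
apply: leq_trans (size_polyD _ _) _; rewrite geq_max sq andbT.
exact: leq_trans (size_scale_leq _ _) sp.
Qed.

Lemma PN_length n (I J : set R) rho : ideal I -> ideal J -> has_length (I : set R^o) J rho ->
  has_length (PN n I) (PN n J) (n * rho).
Proof.
move=> iI iJ h; have sJ := PN_submod n iJ; have JI := has_length_sub h.
have -> : PN n I = comb (PN n J) I (fun i : 'I_n => 'X^i : {poly R}).
  rewrite eqEsubset; split.
    move=> p [sp hp]; exists (fun i => p`_i) => //.
    rewrite -(poly_def n (fun i => p`_i)) (_ : \poly_(i < n) p`_i = p) ?subrr; first exact: submod0.
    by apply/polyP => j; rewrite coef_poly; case: ltnP => // nj; rewrite nth_default //; exact: leq_trans nj.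
  apply: comb_min; first exact: PN_submod.
    by move=> p [sp hp]; split=> // i; exact: JI.
  move=> i r Ir; split; last by move=> j; rewrite coefZ; exact: idealMr.
  by apply: leq_trans (size_scale_leq _ _) _; rewrite size_polyXn.
apply: (comb_length (I := J)) => //.
  move=> i r Jr; split; last by move=> j; rewrite coefZ; exact: idealMr.
  by apply: leq_trans (size_scale_leq _ _) _; rewrite size_polyXn.
move=> r _ [_ hr] i; have := hr i.
rewrite coef_sum (bigD1 i) //= coefZ coefXn eqxx mulr1 big1 ?addr0 // => j nji.
by rewrite coefZ coefXn -val_eqE in nji *; rewrite eq_sym (negbTE nji) mulr0.
Qed.

Let vx := size x.

Definition mulx_image n I L : set {poly R} :=
  [set q : {poly R} | (size q <= n + vx)%N /\ exists2 p, PN n I p & coefs_in L (q - x * p)].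

Lemma size_mulx n (p : {poly R}) : (size p <= n)%N -> (size (x * p)%R <= n + vx)%N.
Proof.
move=> sp; apply: leq_trans (size_polyMleq _ _) _.
by apply: leq_trans (leq_pred _) _; rewrite addnC leq_add2r.
Qed.

Lemma mulx_image_submod n I L : ideal I -> ideal L -> submod (mulx_image n I L).
Proof.
move=> iI iL; have sP := PN_submod n iI; split.
  split; first by rewrite size_poly0.
  by exists 0; [exact: submod0|rewrite mulr0 subr0 => i; rewrite coef0; exact: ideal0].
move=> r q q' [sq [p Pp hp]] [sq' [p' Pp' hp']]; split.
  apply: leq_trans (size_polyD _ _) _; rewrite geq_max sq' andbT.
  exact: leq_trans (size_scale_leq _ _) sq.
exists (r *: p + p'); first exact (submodD sP (submodZ r sP Pp) Pp').
rewrite mulrDr -scalerAr opprD addrACA -scalerBr.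
by apply: coefs_inD => //; exact: coefs_inZ.
Qed.

(** Modulo L, the image of x is the truncated I[X] divided by the kernel of x. That kernel lies in
    J[X] by hypothesis, so the image has length at least n rho. *)
Lemma mulx_count n (I J L : set R) (D : set {poly R}) rho k :
  ideal I -> ideal J -> ideal L -> has_length (I : set R^o) J rho ->
  (forall u, coefs_in I u -> coefs_in L (x * u) -> coefs_in J u) ->
  mulx_image n I L `<=` D -> has_length D (PN (n + vx) L) k ->
  exists2 d, (d + n * rho <= k)%N & has_length D (mulx_image n I L) d.
Proof.
move=> iI iJ iL hIJ ker TD hD.
have sT := mulx_image_submod n iI iL; have sPL := PN_submod (n + vx) iL.
have sPI := PN_submod n iI; have sPJ := PN_submod n iJ.
have PT : PN (n + vx) L `<=` mulx_image n I L.
  move=> p [sp hp]; split=> //; exists 0; first exact: submod0.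
  by rewrite mulr0 subr0.
have [d [t [hd ht ek]]] := has_length_split sT PT TD hD.
exists d => //; rewrite ek leq_add2l.
pose K := [set u | PN n I u /\ coefs_in L (x * u)].
have sK : submod K.
  split; first by split; [exact: submod0|rewrite mulr0 => i; rewrite coef0; exact: ideal0].
  move=> r p q [Pp hp] [Pq hq]; split; first exact (submodD sPI (submodZ r sPI Pp) Pq).
  by rewrite mulrDr -scalerAr; apply: coefs_inD => //; exact: coefs_inZ.
have KJ : K `<=` PN n J by move=> u [[su hu] hxu]; split=> //; exact: ker.
have JI : PN n J `<=` PN n I by exact: has_length_sub (PN_length n iI iJ hIJ).
have hK : has_length (PN n I) K t.
  apply: (@has_length_rel _ _ _ (fun q p => coefs_in L (q - x * p)) _ _ _ _ _ _ _ _ _ _ _ ht) => //.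
  - move=> r q q' p p' h h'; rewrite mulrDr -scalerAr opprD addrACA -scalerBr.
    by apply: coefs_inD => //; exact: coefs_inZ.
  - by move=> u [].
  - by move=> q [_ [p Pp hp]]; exists p.
  - move=> p Pp; exists (x * p); last by rewrite subrr => i; rewrite coef0; exact: ideal0.
    split; first by apply: size_mulx; case: Pp.
    by exists p => //; rewrite subrr => i; rewrite coef0; exact: ideal0.
  - move=> q p [sq _] Pp h; split=> [[_ hq]|[_ hxp]].
      by split=> //; rewrite -(subKr q (x * p)); exact: coefs_inB.
    by split=> //; rewrite -(subrK (x * p) q); exact: coefs_inD.
by have [] := has_length_quot_le sPJ KJ JI hK (PN_length n iI iJ hIJ).
Qed.

(** Multiplication by x is injective from (m^i/m^(i+1))[X] to the next degree. Truncation gives n h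
    <= (n + size x) h' for every n, and n > h' size x forces h <= h'. *)
Lemma hilbert_mono i0 i h h' : (forall i, (i0 <= i)%N -> forall w, mp i w ->
    (forall r, m r -> mp i.+2 (r * w)) -> mp i.+1 w) -> (i0 <= i)%N ->
  has_length (mp i : set R^o) (mp i.+1) h -> has_length (mp i.+1 : set R^o) (mp i.+2) h' ->
  (h <= h')%N.
Proof.
move=> hi0 i0i hh hh'; have H n : (n * h <= (n + vx) * h')%N.
  have ker u : coefs_in (mp i) u -> coefs_in (mp i.+2) (x * u) -> coefs_in (mp i.+1) u.
    exact: (mccoy hi0 i0i (leqnn _)).
  have TD : mulx_image n (mp i) (mp i.+2) `<=` PN (n + vx) (mp i.+1).
    move=> q [sq [p [_ hp] hq]]; split=> //; rewrite -(subrK (x * p) q).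
    apply: (coefs_inD (imp _)); last exact: coefs_in_genericM.
    by move=> j; apply: (@ideal_pow_dec _ _ _ i.+2); [exact: leqnSn|exact: hq].
  have [d le _] := mulx_count (imp _) (imp _) (imp _) hh ker TD (PN_length _ (imp _) (imp _) hh').
  exact: leq_trans (leq_addl _ _) le.
rewrite leqNgt; apply/negP => lt; have := H (vx * h').+1.
have : ((vx * h').+1 * h'.+1 <= (vx * h').+1 * h)%N by rewrite leq_mul2l lt orbT.
nia.
Qed.

(* For large j, multiplication by x on (m/m^(j+1))[X] has a cokernel that is
   not larger than its kernel, namely (m^j/m^(j+1))[X]; the cokernel maps onto
   (m/m^2)[X], so the remaining part of the cokernel is torsion over R[X]. *)
Lemma generic_square j h : (forall u, coefs_in (mp j.+1) (x * u) -> coefs_in (mp j) u) -> (0 < j)%N ->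
  has_length (mp 1 : set R^o) (mp 2) h -> has_length (mp j : set R^o) (mp j.+1) h ->
  fin_len (mp 1 : set R^o) (mp j) ->
  forall g, mp 2 g -> exists f u, [/\ f \is monic, coefs_in m u & coefs_in (mp j.+1) (g *: f - x * u)].
Proof.
move=> ker j0 h1 hj [lam hlam] g mg.
(* l(m^2/m^(j+1)) = l(m/m^j) because the Hilbert function takes the same value h at 1 and at j; this
   is what minimal multiplicity supplies. *)
have hjj : has_length (mp 2 : set R^o) (mp j.+1) lam.
  have h2 := has_length_trans hlam hj.
  have s2 : mp j.+1 `<=` mp 2 by exact: ideal_pow_dec.
  have s1 : mp 2 `<=` mp 1 by exact: ideal_pow_dec.
  have [a [b [ha hb e]]] := has_length_split (imp 2) s2 s1 h2.
  by have -> : lam = b by have := has_length_uniq ha h1; lia.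
(* The count will give d + n lam <= (n + size x) lam, so d <= lam size x < n; the n polynomials g,
   gX, ..., gX^(n-1) are then more than d. *)
pose n := (vx * lam).+1.
have TD : mulx_image n (mp 1) (mp j.+1) `<=` PN (n + vx) (mp 2).
  move=> q [sq [p [_ hp] hq]]; split=> //; rewrite -(subrK (x * p) q).
  apply: (coefs_inD (imp _)); last exact: coefs_in_genericM.
  by move=> i; apply: (@ideal_pow_dec _ _ _ j.+1) => //; exact: hq.
have [d le hd] := mulx_count (imp _) (imp _) (imp _) hlam (fun u _ => ker u) TD (PN_length _ (imp _) (imp _) hjj).
have dn : (d < n)%N by rewrite mulnDl in le; rewrite ltnS; lia.
(* A family indexed by all naturals is required; clamping the exponent keeps degrees bounded, and
   the relation stops at i <= d < n, before the clamp acts. *)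
pose w i : {poly R} := g *: 'X^(minn i n.-1).
have Dw i : PN (n + vx) (mp 2) (w i).
  split; last by move=> l; rewrite coefZ; exact: (idealMr _ (imp _)).
  apply: leq_trans (size_scale_leq _ _) _; rewrite size_polyXn; rewrite /n /=.
  by have := geq_minr i (vx * lam); lia.
have [i [r [[_ [p [_ hp] hq]] id]]] := linear_dependence hd Dw.
have wE l : (l <= i)%N -> w l = g *: 'X^l.
  by move=> li; rewrite /w (minn_idPl _) // /n /=; lia.
exists ('X^i - \sum_(l < i) r l *: 'X^l), p; split.
- rewrite monicE lead_coefDl ?lead_coefXn // size_polyN size_polyXn ltnS.
  apply: leq_trans (size_sum _ _ _) _; apply/bigmax_leqP => l _.
  by apply: leq_trans (size_scale_leq _ _) _; rewrite size_polyXn.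
- by move=> l; have := hp l; rewrite ideal_pow1.
- move: hq; rewrite wE // (eq_bigr (fun l : 'I_i => g *: (r l *: 'X^l))); last first.
    by move=> l _; rewrite wE ?(ltnW (ltn_ord l)) // !scalerA mulrC.
  by rewrite -scaler_sumr -scalerBr.
Qed.

End GenericElement.
End Powers.

(** * The Hilbert function of m and its limit *)

Section MinimalMultiplicity.
Variables (R : comNzRingType) (m : set R).
Hypotheses (noeth : noetherian R) (loc : local_with m) (dim1 : has_dim (R^o : lmodType R) 1).
Hypothesis hreg : exists2 y, m y & regular_elt y.

Let im := max_ideal loc.
Notation mp := (ideal_pow m).
Let imp i : ideal (mp i) := ideal_pow_ideal m i.

Lemma generic_linear_form : exists x : {poly R}, (forall i, m x`_i) /\
  forall A : set R, ideal A -> (forall i, A x`_i) -> m `<=` A.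
Proof.
have [n [g eg]] := noeth im; exists (Poly (codom g)).
have mg i : m (g i) by rewrite eg; exact: (@span_in R R^o).
split=> [i|A iA hA].
  rewrite coef_Poly; have [si|si] := ltnP i (size (codom g)).
    by have /codomP[j ->] := mem_nth 0 si.
  by rewrite nth_default //; exact: ideal0.
rewrite eg; apply: (@span_range_sub R R^o _ _ _ iA) => i.
by have := hA (index (g i) (codom g)); rewrite coef_Poly nth_index // codom_f.
Qed.

Lemma fin_len_max_pow i : fin_len (setT : set R^o) (mp i).
Proof.
have [y my ry] := hreg.
have ryi : regular_elt (y ^+ i).
  by elim: i => [|i IH] z; rewrite ?mul1r // exprS -mulrA => /ry/IH.
have mpy : mp i (y ^+ i).
  elim: i {ryi} => [//|i IH]; rewrite exprS; exact: max_powS.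
have [|//] := fin_len_split (C := (mp i : set R^o)) (imp i) _ (@subsetT _ _) (fin_len_regular noeth loc dim1 ryi).
by move=> z /pidealP[r ->]; exact (idealM r (imp i) mpy).
Qed.

Lemma fin_len_max_powS i j : (i <= j)%N -> fin_len (mp i : set R^o) (mp j).
Proof.
move=> ij; have sub : mp j `<=` mp i by exact: ideal_pow_dec.
by have [_] := fin_len_split (C := (mp i : set R^o)) (imp i) sub (@subsetT _ _) (fin_len_max_pow j).
Qed.

(** For a regular y in m, m^(i+1) contains y m^i, and l(m^i/y m^i) = l(R/yR) for every i. *)
Lemma hilbert_bound : exists E, forall i h, has_length (mp i : set R^o) (mp i.+1) h -> (h <= E)%N.
Proof.
have [y my ry] := hreg; have [E hE] := fin_len_regular noeth loc dim1 ry; exists E => i h hh.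
pose yA (A : set R) : set R := [set y * a | a in A].
have iyA A : ideal A -> ideal (yA A).
  move=> iA; split; first by exists 0; [exact: ideal0|rewrite mulr0].
  move=> r _ _ [a Aa <-] [b Ab <-]; exists (r * a + b); first exact (idealD iA (idealM r iA Aa) Ab).
  by rewrite -[r *: _]/(r * (y * a)); ring.
have [a ha] := fin_len_max_pow i.
have hya : has_length (yA setT : set R^o) (yA (mp i)) a.
  apply: (@has_length_rel R R^o R^o (fun u v => v = y * u)) ha.
  - by move=> r u u' _ _ -> ->; rewrite -[r *: u]/(r * u) -[r *: (y * u : R^o)]/(r * (y * u)); ring.
  - exact: (iyA setT (@submodT R R^o)).
  - by move=> _ [u mu <-]; exists u.
  - by move=> u _; exists (y * u) => //; exists u.
  - by move=> _ [u _ <-]; exists u.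
  - move=> u _ _ _ ->; split=> [mu|[u' mu' /eqP]]; first by exists u.
    by rewrite -subr_eq0 -mulrBr => /eqP/ry/eqP; rewrite subr_eq0 => /eqP <-.
have eT : yA setT = pideal y.
  rewrite eqEsubset; split=> z; first by move=> [u _ <-]; apply/pidealP; exists u; rewrite mulrC.
  by move=> /pidealP[u ->]; exists u => //; rewrite mulrC.
rewrite eT in hya; have h1 := has_length_trans hE hya.
have yim : yA (mp i) `<=` mp i by move=> _ [u mu <-]; exact: (idealM _ (imp i)).
have yimS : yA (mp i) `<=` mp i.+1 by move=> _ [u mu <-]; exact: max_powS.
have [a' [b [ha' hb e]]] := has_length_split (imp i : submod (mp i : set R^o)) yim (@subsetT _ _) h1.
have eb : b = E by have := has_length_uniq ha ha'; lia.
rewrite eb in hb.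
have S1 : mp i.+1 `<=` mp i by exact: ideal_pow_dec.
by have [] := has_length_quot_le (imp i.+1 : submod (mp i.+1 : set R^o)) yimS S1 hb hh.
Qed.

(** From i0 on the Hilbert function is nondecreasing and bounded, so it stays at its maximum once
    that is reached. *)
Lemma hilbert_eventually_const : exists h i1, forall i, (i1 <= i)%N ->
  has_length (mp i : set R^o) (mp i.+1) h.
Proof.
have [H hH] := choice (fun i => fin_len_max_powS (leqnSn i)).
have [E hE] := hilbert_bound; have [i0 hi0] := socle_vanish noeth loc.
have [x [mx gx]] := generic_linear_form.
pose P n := `[< exists2 i, (i0 <= i)%N & H i = n >].
have exP : exists n, P n by exists (H i0); apply/asboolP; exists i0.
have bP n : P n -> (n <= E)%N by move=> /asboolP[i _ <-]; exact: hE (hH i).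
case: (ex_maxnP exP bP) => h /asboolP[i1 i01 e1] maxh.
have mono i : (i0 <= i)%N -> (H i <= H i.+1)%N.
  move=> i0i; exact: (hilbert_mono loc mx gx hi0 i0i (hH i) (hH i.+1)).
exists h, i1 => i i1i; suff <- : H i = h by [].
apply/eqP; rewrite eqn_leq; apply/andP; split.
  by apply: maxh; apply/asboolP; exists i => //; exact: leq_trans i1i.
elim: i i1i => [|i IH]; first by rewrite leqn0 => /eqP <-; rewrite e1.
rewrite leq_eqVlt => /orP[/eqP <-|]; first by rewrite e1.
rewrite ltnS => i1i; apply: leq_trans (IH i1i) _; apply: mono; exact: leq_trans i1i.
Qed.

Lemma idprod_setT (I : set R) : ideal I -> idprod I (setT : set R^o) = I.
Proof. by move=> iI; rewrite -[LHS]/(ideal_mul I setT) ideal_mulC; exact: (@idprodT R R^o). Qed.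

Lemma minmult_hilbert : minimal_multiplicity m ->
  exists h i1, [/\ mu (m : set R^o) = h, has_length (mp 1 : set R^o) (mp 2) h &
    forall i, (i1 <= i)%N -> has_length (mp i : set R^o) (mp i.+1) h].
Proof.
move=> [d [dd]]; rewrite (has_dim_uniq dd dim1) => lim.
have [h [i1 hi1]] := hilbert_eventually_const.
have [h1 hh1] := fin_len_max_powS (leqnSn 1).
have emp2 : mp 2 = idprod m (m : set R^o).
  rewrite -[RHS]/(ideal_mul m m) -[LHS]/(ideal_mul m (mp 1)) ideal_pow1 //.
have muE : mu (m : set R^o) = h1.
  apply: (mu_length noeth loc (noeth im)); rewrite -emp2.
  by move: hh1; rewrite ideal_pow1.
suff e : h1 = h by exists h, i1; rewrite muE e; split=> //; rewrite -e.
have [C hC] := fin_len_max_pow i1.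
have hl n : has_length (setT : set R^o) (mp (i1 + n)) (C + n * h).
  elim: n => [|n IH]; first by rewrite mul0n !addn0.
  have := has_length_trans IH (hi1 _ (leq_addr n i1)).
  by rewrite -addnS mulSn -addnA [(n * h + h)%N]addnC.
have half : (0 < 2^-1 :> rat) by [].
have [n1 hn1] := lim _ half.
(* As l(R/m^(i1+k)) = C + kh, its quotient by i1 + k differs from h by |C - i1 h|/(i1 + k) < 1/2. It
   is also within 1/2 of h1, so the two integers coincide. *)
pose k := (n1 + 2 * C + 2 * i1 * h + i1 + 1)%N.
have := hn1 (i1 + k)%N; rewrite /k => /(_ ltac:(lia)); rewrite -/k.
rewrite idprod_setT // (len_eq (hl k)) (_ : 1`! = 1%N) // mul1r expr1 muE.
have k0 : (0 < (i1 + k)%:R :> rat) by rewrite ltr0n /k; lia.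
rewrite ltr_distl ltr_pdivrMr // ltrBlDr => /andP[lo hi].
have lo1 : ((2 * h1 * (i1 + k) < 2 * (C + k * h) + (i1 + k))%N).
  rewrite -(ltr_nat rat) !natrM [in X in _ < X]natrD !natrM.
  move: lo; rewrite -ltrBlDr ltr_pdivlMr //; lra.
have hi1' : ((2 * (C + k * h) < (2 * h1 + 1) * (i1 + k))%N).
  rewrite -(ltr_nat rat) !natrM [(2 * h1 + 1)%:R]natrD natrM.
  move: hi; move: (C + k * h)%:R (i1 + k)%:R (h1%:R) => a b c.
  nra.
have [lt|lt|//] := ltngtP h1 h.
  have e : h = (h1 + (h - h1.+1) + 1)%N by lia.
  move: hi1'; rewrite e /k; nia.
have e : h1 = (h + (h1 - h.+1) + 1)%N by lia.
move: lo1; rewrite e /k; nia.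
Qed.

End MinimalMultiplicity.

(** * Minimal multiplicity makes m principal over B = m : m *)

Section PrincipalMaximalIdeal.
Variables (R : comNzRingType) (m : set R) (Q : comUnitAlgType R).
Hypotheses (noeth : noetherian R) (loc : local_with m) (dim1 : has_dim (R^o : lmodType R) 1).
Hypothesis hQ : total_fractions Q.
Hypothesis hreg : exists2 y, m y & regular_elt y.

Let im := max_ideal loc.
Notation mp := (ideal_pow m).
Let imp i : ideal (mp i) := ideal_pow_ideal m i.

Definition endo_max : set Q := [set b | forall w, m w -> exists2 u, m u & w *: b = u%:A].
Notation B := endo_max.
Let M : set Q := [set r%:A | r in m].

Lemma endo_max_subalg : subalg B.
Proof.
split; last split.
- split=> [w mw|r x y hx hy w mw]; first by exists 0; [exact: ideal0|rewrite scaler0 scale0r].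
  have [u mu eu] := hx _ mw; have [v mv ev] := hy _ mw; exists (r * u + v).
    exact (idealD im (idealM r im mu) mv).
  by rewrite scalerDr scalerA mulrC -scalerA eu ev algD alg_scale.
- by move=> w mw; exists w.
- move=> x y hx hy w mw; have [u mu eu] := hx _ mw; have [v mv ev] := hy _ mu; exists v => //.
  by rewrite scalerAl eu mulr_algl.
Qed.

Let sB : submod B. Proof. by case: endo_max_subalg. Qed.
Let B1 : B 1. Proof. by case: endo_max_subalg => _ []. Qed.
Let BM x y : B x -> B y -> B (x * y). Proof. by case: endo_max_subalg => _ [_]; apply. Qed.
Let Bbase r : B r%:A. Proof. exact (submodZ r sB B1). Qed.

Lemma lattice_endo_max : lattice B.
Proof.
split=> //; first by exists 1; [exact: regular1|exact: Bbase].
by have [y my ry] := hreg; exists y => // x /(_ _ my)[u _ ->]; exact: base_alg.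
Qed.

Let sM : submod M.
Proof.
split; first by exists 0; [exact: ideal0|rewrite scale0r].
move=> r _ _ [a ma <-] [b mb <-]; exists (r * a + b); first exact (idealD im (idealM r im ma) mb).
by rewrite algD -alg_scale.
Qed.

Let lM : lattice M.
Proof.
split=> //; first by have [y my ry] := hreg; exists y => //; exists y.
by exists 1; [exact: regular1|move=> _ [r _ <-]; rewrite scale1r; exact: base_alg].
Qed.

Let MB_M b x : B b -> M x -> M (b * x).
Proof. by move=> hb [r mr <-]; have [u mu eu] := hb _ mr; exists u => //; rewrite -eu mulrC mulr_algl. Qed.

Let MB : M `<=` B. Proof. by move=> _ [r mr <-]; exact: Bbase. Qed.

(** Fix a regular y0 in m. By [generic_square], with F the product of the monic polynomials attached
    to generators of m, F y w is congruent to x u_w modulo a high power of m for each w in m; put b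
    = u_{y0}/y0. Cancelling x by [kernel_bound] makes w u_{y0} congruent to y0 u_w, so w b has
    coefficients in m and b has coefficients in B. *)
Lemma generic_generator : minimal_multiplicity m ->
  exists2 x : {poly R}, (forall i, m x`_i) & forall y, m y ->
  exists (F : {poly R}) (b : nat -> Q) (N : nat), [/\ F \is monic, forall i, B (b i),
    forall i, (N <= i)%N -> b i = 0 &
    forall k, exists2 u, mp 2 u & (F`_k * y)%:A = \sum_(a < k.+1) x`_a *: b (k - a)%N + u%:A].
Proof.
move=> hmm; have [h [i1 [_ h1 hi1]]] := minmult_hilbert noeth loc dim1 hreg hmm.
have [x [mx gx]] := generic_linear_form noeth loc; exists x => // y my.
have [j0 hj0] := kernel_bound noeth loc hreg mx gx.
have [y0 my0 ry0] := hreg; have uy0 := regular_unit hQ ry0.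
have [a0 ha0] := max_pow_regular noeth loc dim1 ry0.
have div t z : mp (t + a0) z -> exists2 z', mp t z' & z = y0 * z'.
  rewrite ideal_powD; move: z; apply: (@idprod_min R R^o _ _ [set z | exists2 z', mp t z' & z = y0 * z']).
    split; first by exists 0; [exact: (ideal0 (imp t))|rewrite mulr0].
    move=> r _ _ [z mz ->] [z' mz' ->]; exists (r * z + z'); first exact (idealD (imp t) (idealM r (imp t) mz) mz').
    by rewrite -[r *: _]/(r * (y0 * z)); ring.
  move=> r s mr /ha0/pidealP[s' ->]; exists (r * s'); first exact (idealMr s' (imp t) mr).
  by rewrite -[r *: _]/(r * (s' * y0)); ring.
(* As m^a0 lies in y0 R, an error in m^(j+1) = m^(t+a0) can be divided by y0 with quotient in m^t,
   inside m^2. The summands j0 and i1 put j in the range of [kernel_bound] and of the stable Hilbert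
   function. *)
pose t := (j0 + i1 + 3)%N; pose j := (t + a0).-1.
have ej : j.+1 = (t + a0)%N by rewrite /j prednK // /t; lia.
have jj0 : (j0 <= j)%N by rewrite /j /t; lia.
have jpos : (0 < j)%N by rewrite /j /t; lia.
have ji1 : (i1 <= j)%N by rewrite /j /t; lia.
pose L := mp j.+1; have iL : ideal L by exact: imp.
have hsq := generic_square loc mx (fun u => hj0 j u jj0) jpos h1 (hi1 _ ji1) (fin_len_max_powS noeth loc dim1 hreg jpos).
have [n [g eg]] := noeth im.
have mg i : m (g i) by rewrite eg; exact: (@span_in R R^o).
have exl l : exists fu : {poly R} * {poly R}, [/\ fu.1 \is monic, coefs_in m fu.2 & coefs_in L ((y * g l) *: fu.1 - x * fu.2)].
  have [|f [u [h1' h2 h3]]] := hsq (y * g l); last by exists (f, u).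
  exact (max_powS my (max_pow1 loc (mg l))).
have [fu hfu] := choice exl.
pose F := \prod_l (fu l).1.
have mF : F \is monic by apply: monic_prod => l _; case: (hfu l).
pose W := [set w : R | exists2 u, coefs_in m u & coefs_in L ((y * w) *: F - x * u)].
have iW : ideal W.
  split; first by exists 0 => [i|]; [rewrite coef0; exact: ideal0|rewrite !mulr0 scale0r subr0 => i; rewrite coef0; exact: ideal0].
  move=> r w w' [u mu hu] [u' mu' hu']; exists (r *: u + u'); first exact (coefs_inD im (coefs_inZ r im mu) mu').
  have -> : (y * (r *: (w : R^o) + w')) *: F - x * (r *: u + u') =
      r *: ((y * w) *: F - x * u) + ((y * w') *: F - x * u').
    rewrite -[r *: (w : R^o)]/(r * w) -!mul_polyC !polyCM polyCD polyCM; ring.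
  exact (coefs_inD iL (coefs_inZ r iL hu) hu').
have mW : m `<=` W.
  rewrite eg; apply: (@span_range_sub R R^o _ _ _ iW) => l.
  have [h1' h2 h3] := hfu l; pose G := \prod_(l' | l' != l) (fu l').1.
  have eF : F = (fu l).1 * G by rewrite /F (bigD1 l).
  exists ((fu l).2 * G); first exact: coefs_in_mulr.
  have -> : (y * g l) *: F - x * ((fu l).2 * G) = ((y * g l) *: (fu l).1 - x * (fu l).2) * G.
    by rewrite eF mulrBl scalerAl mulrA.
  exact: coefs_in_mulr.
have [u0 mu0 hu0] := mW _ my0.
have Lt k z : coefs_in L k -> exists2 z', mp t z' & k`_z = y0 * z' by move=> hk; apply: div; rewrite -ej; exact: hk.
pose b i : Q := y0%:A^-1 * (u0`_i)%:A.
have y0b i : y0 *: b i = (u0`_i)%:A by rewrite -[LHS]mulr_algl mulVKr.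
have t2 : (2 <= t)%N by rewrite /t; lia.
exists F, b, (size u0); split=> //.
- move=> i w mw; have [u mu hu] := mW _ mw.
  have : coefs_in L (y0 *: u - w *: u0).
    apply: (hj0 j.+1); first exact: leqW.
    have -> : x * (y0 *: u - w *: u0) = w *: ((y * y0) *: F - x * u0) - y0 *: ((y * w) *: F - x * u).
      by rewrite -!mul_polyC !polyCM; ring.
    by apply: (coefs_inB (imp j.+2)) => k; rewrite coefZ; [exact (max_powS mw (hu0 k))|exact (max_powS my0 (hu k))].
  move=> hk; have [z' mz'] := Lt _ i hk; rewrite coefB !coefZ => e.
  have mz1 : m z' by move: (ideal_pow_dec (ltnW t2) mz'); rewrite ideal_pow1.
  exists (u`_i - z'); first exact: idealB.
  apply: (regular_scale_inj hQ ry0); rewrite scalerA mulrC -scalerA y0b !alg_scale; congr (_ %:A).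
  by rewrite mulrBr -e opprB addrC subrK.
- by move=> i si; rewrite /b nth_default // scale0r mulr0.
- move=> k; have [z' mz'] := Lt _ k hu0; rewrite coefB coefZ => e.
  exists z'; first exact: (ideal_pow_dec t2 mz').
  apply: (regular_scale_inj hQ ry0); rewrite scalerDr !alg_scale -e algB addrC.
  have -> : y0 *: \sum_(a < k.+1) x`_a *: b (k - a)%N = ((x * u0)`_k)%:A.
    rewrite coefM alg_sum scaler_sumr; apply: eq_bigr => a _.
    by rewrite scalerA mulrC -scalerA y0b alg_scale.
  by rewrite subrK; congr (_ %:A); ring.
Qed.

Definition endo_ideal (b : set Q) : Prop :=
  [/\ submod b, b `<=` B & forall x y, B x -> b y -> b (x * y)].

(** M/bM is generated over B by one element coming from m. For b = M this reads M = zB + M^2, and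
    Nakayama removes M^2. *)
Definition cyclic_mod (b : set Q) : Prop :=
  exists2 z, m z & forall y, m y -> sadd (qscale z%:A B) (qmul b M) y%:A.

Let sbM b : submod (qmul b M). Proof. exact: qmul_submod. Qed.
Let szB z : submod (qscale z%:A B). Proof. exact: qscale_submod. Qed.

Let qmulM_stable b x y : endo_ideal b -> B x -> qmul b M y -> qmul b M (x * y).
Proof.
move=> [sb bB hb] Bx; move: y.
apply: (@qmul_min R Q _ _ [set y | qmul b M (x * y)] (submod_mull x (sbM b))) => u v bu Mv /=.
by rewrite mulrA; apply: qmul_in => //; exact: hb.
Qed.

(* As in Gauss' lemma: compare coefficients at the last x_i outside bM plus the
   last b_s outside b. *)
Lemma cyclic_mod_max (b : set Q) : minimal_multiplicity m -> endo_ideal b -> ~ b 1 -> M `<=` b ->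
  (forall b', endo_ideal b' -> b `<=` b' -> ~ b' 1 -> b' `<=` b) -> cyclic_mod b.
Proof.
move=> hmm ib nb1 Mb maxb; have [sb bB hb] := ib.
have [x mx hx] := generic_generator hmm.
have inv u : B u -> ~ b u -> exists2 v, B v & b (1 - v * u).
  move=> Bu nbu.
  have ib' : endo_ideal (sadd b (qscale u B)).
    split; first by apply: sadd_submod => //; exact: qscale_submod.
      by apply: sadd_min => // _ [v Bv <-]; exact: BM.
    move=> v _ Bv [w bw [_ [c Bc <-] <-]]; exists (v * w); first exact: hb.
    by exists (u * (v * c)); [apply: qscale_in; exact: BM|ring].
  have : sadd b (qscale u B) 1.
    apply: contrapT => n1; apply: nbu; apply: (maxb _ ib') => //.
      by apply: saddl; exact: qscale_submod.
    by apply: (saddr sb); exists 1; rewrite ?mulr1.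
  move=> [w bw [_ [v Bv <-] e]]; exists v => //.
  by rewrite -e [v * u]mulrC addrK.
have M2 u : mp 2 u -> qmul b M u%:A.
  move: u; apply: (@idprod_min R R^o _ _ [set u : R | qmul b M u%:A]).
    split; first by rewrite /mkset scale0r; exact: submod0.
    by move=> r u v hu hv; rewrite /mkset algD -[r *: u]/(r * u) -alg_scale; exact (submodD (sbM b) (submodZ r (sbM b) hu) hv).
  move=> r s mr ms; rewrite /mkset -[r *: s]/(r * s) algM; apply: qmul_in; first by apply: Mb; exists r.
  by exists s => //; rewrite -(ideal_pow1 im).
have [allx|] := pselect (forall i, qmul b M (x`_i)%:A).
  exists 0; first exact: ideal0.
  move=> y my; apply: (saddr (szB 0)); have [F [bb [N [mF Bb _ he]]]] := hx _ my.
  have [u mu] := he (size F).-1; rewrite -[F`__]/(lead_coef F) (monicP mF) mul1r => ->.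
  apply: (submodD (sbM b)); last exact: M2.
  by apply: (submod_sum (sbM b)) => a _; rewrite -mulr_algl mulrC; exact: qmulM_stable.
move=> /existsNP[i1 ni1].
pose P i := `[< ~ qmul b M (x`_i)%:A >].
have exP : exists i, P i by exists i1; apply/asboolP.
have bP i : P i -> (i <= size x)%N.
  move=> /asboolP ni; rewrite leqNgt; apply/negP => lt; apply: ni.
  by rewrite nth_default ?(ltnW lt) // scale0r; exact: submod0.
case: (ex_maxnP exP bP) => i /asboolP nxi maxi.
have big a : (i < a)%N -> qmul b M (x`_a)%:A.
  by move=> ia; apply: contrapT => na; have := maxi a (asboolT na); rewrite leqNgt ia.
exists x`_i => // y my.
have [F [bb [N [mF Bb bN he]]]] := hx _ my.
pose d := (size F).-1.
have Fd : F`_d = 1 by have /monicP := mF.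
have term0 a k : (i < a)%N -> qmul b M (x`_a *: bb k).
  by move=> ia; rewrite -mulr_algl mulrC; apply: qmulM_stable => //; exact: big.
have term1 a k : b (bb k) -> qmul b M (x`_a *: bb k).
  by move=> hk; rewrite -mulr_algl mulrC; apply: qmul_in => //; exists x`_a.
have [allb|] := pselect (forall k, b (bb k)).
  apply: (saddr (szB _)); have [u mu] := he d; rewrite Fd mul1r => ->.
  apply: (submodD (sbM b)); last exact: M2.
  by apply: (submod_sum (sbM b)) => a _; exact: term1.
move=> /existsNP[s1 ns1].
pose P' k := `[< ~ b (bb k) >].
have exP' : exists k, P' k by exists s1; apply/asboolP.
have bP' k : P' k -> (k <= N)%N.
  move=> /asboolP nk; rewrite leqNgt; apply/negP => lt; apply: nk.
  by rewrite bN ?(ltnW lt) //; exact: submod0.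
case: (ex_maxnP exP' bP') => s /asboolP nbs maxs.
have bigs k : (s < k)%N -> b (bb k).
  by move=> sk; apply: contrapT => nk; have := maxs k (asboolT nk); rewrite leqNgt sk.
have coefk k : exists2 v, qmul b M v & (F`_k * y)%:A =
    (if (i <= k)%N && (k - i <= s)%N then x`_i *: bb (k - i)%N else 0) + v + 
    \sum_(a < k.+1 | (a < i)%N) x`_a *: bb (k - a)%N.
  have [u mu ->] := he k.
  have [ik|ki] := leqP i k; last first.
    exists u%:A; first exact: M2.
    rewrite add0r addrC; congr (_ + _); apply: eq_bigl => a.
    by rewrite (leq_trans (ltn_ord a)).
  rewrite (bigID (fun a : 'I_k.+1 => (a < i)%N)) /=.
  have ik' : (i < k.+1)%N by rewrite ltnS.
  rewrite [X in _ + X + _](bigD1 (Ordinal ik')) /= ?ltnn //.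
  set T := \sum_(a | _) _ ; set T' := \sum_(a | _) _.
  have hT' : qmul b M T'.
    apply: (submod_sum (sbM b)) => a /andP[h1 h2]; apply: term0.
    by rewrite ltn_neqAle leqNgt h1 andbT eq_sym -val_eqE in h2 *.
  case: ifP => hs.
    exists (T' + u%:A); first exact (submodD (sbM b) hT' (M2 _ mu)).
    by rewrite [LHS]addrC addrA; ring.
  exists (x`_i *: bb (k - i)%N + T' + u%:A); last by ring.
  apply: (submodD (sbM b)); last exact: M2.
  apply: (submodD (sbM b)) => //; apply: term1; apply: bigs.
  by rewrite ltnNge hs.
have low k : (i + s <= k)%N -> qmul b M (\sum_(a < k.+1 | (a < i)%N) x`_a *: bb (k - a)%N).
  by move=> isk; apply: (submod_sum (sbM b)) => a ai; apply: term1; apply: bigs; lia.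
(* If deg F < i + s, the coefficient at i + s vanishes and x_i b_s, hence x_i, falls into bM, a
   contradiction. If deg F > i + s, the leading coefficient puts y into bM. In case of equality y is
   x_i b_s modulo bM. *)
have [lt|lt|e] := ltngtP d (i + s)%N.
- have [v hv] := coefk (i + s)%N; rewrite nth_default; last first.
    by move: lt; rewrite /d; case: (size F).
  rewrite mul0r scale0r leq_addr addKn leqnn /= => e0.
  have hxs : qmul b M (x`_i *: bb s).
    have -> : x`_i *: bb s = - (v + \sum_(a < (i + s).+1 | (a < i)%N) x`_a *: bb (i + s - a)%N).
      by apply/eqP; rewrite -addr_eq0 addrA -e0.
    by apply: (submodN (sbM b)); apply: (submodD (sbM b)) => //; exact: low.
  case: nxi; have [w Bw hw] := inv _ (Bb s) nbs.
  have -> : (x`_i)%:A = w * (x`_i *: bb s) + (1 - w * bb s) * (x`_i)%:A.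
    by rewrite -[x`_i *: bb s]mulr_algl; ring.
  apply: (submodD (sbM b)); first exact: qmulM_stable.
  by apply: qmul_in => //; exists x`_i.
- have [v hv] := coefk d; rewrite Fd mul1r ifF => [->|]; last by lia.
  apply: (saddr (szB _)); rewrite add0r; apply: (submodD (sbM b)) => //; apply: low; exact: ltnW.
- have [v hv] := coefk d; rewrite Fd mul1r e leq_addr addKn leqnn /= => ->.
  exists (x`_i *: bb s); first by exists (bb s) => //; rewrite mulr_algl.
  exists (v + \sum_(a < (i + s).+1 | (a < i)%N) x`_a *: bb (i + s - a)%N); last by rewrite addrA.
  by apply: (submodD (sbM b)) => //; exact: low.
Qed.

(** Chinese remaindering with z = e2 z1 + e1 z2, congruent to z1 modulo b1 M and to z2 modulo b2 M.
    Expanding (e1 + e2)^2 y leaves a multiple of z and terms of b1 b2 M, which lie in bM. *)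
Lemma cyclic_mod_comaximal (b b1 b2 : set Q) e1 e2 :
  endo_ideal b -> endo_ideal b1 -> endo_ideal b2 -> b1 e1 -> b2 e2 -> e1 + e2 = 1 ->
  (forall x y, b1 x -> b2 y -> b (x * y)) -> cyclic_mod b1 -> cyclic_mod b2 -> cyclic_mod b.
Proof.
move=> ib ib1 ib2 be1 be2 e12 hb [z1 mz1 h1] [z2 mz2 h2].
have [sb bB _] := ib; have [_ b1B _] := ib1; have [_ b2B _] := ib2.
have Be1 := b1B _ be1; have Be2 := b2B _ be2.
have [u1 mu1 eu1] := Be2 _ mz1; have [u2 mu2 eu2] := Be1 _ mz2.
pose z := u1 + u2.
have ez : z%:A = e2 * z1%:A + e1 * z2%:A by rewrite algD -eu1 -eu2 -[z1 *: e2]mulr_algl -[z2 *: e1]mulr_algl; congr (_ + _); rewrite mulrC.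
exists z; first exact: idealD.
have sZ := sadd_submod (szB z) (sbM b).
have aux c d d' w : B d -> (forall x, c x -> b (d' * x)) -> qmul c M w -> qmul b M (d * d' * w).
  move=> Bd hc; move: w.
  apply: (@qmul_min R Q _ _ [set w | qmul b M (d * d' * w)] (submod_mull _ (sbM b))) => p q cp Mq /=.
  rewrite -mulrA; apply: qmulM_stable => //; rewrite mulrA; apply: qmul_in => //; exact: hc.
have be12 : b (e1 * e2) by exact: hb.
have Mz i : m i -> M i%:A by move=> mi; exists i.
move=> y my.
have [_ [c1 Bc1 <-] [n1 hn1 ey1]] := h1 _ my; have [_ [c2 Bc2 <-] [n2 hn2 ey2]] := h2 _ my.
have id (Y Z1 Z2 p1 p2 : Q) : (e1 + e2) ^+ 2 * Y = (e2 * Z1 + e1 * Z2) * (e2 * p1 + e1 * p2) +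
   (e2 * e2 * (Y - Z1 * p1) + e1 * e1 * (Y - Z2 * p2) + (e1 * e2) * (2%:R * Y - p1 * Z2 - p2 * Z1)) by ring.
have en1 : n1 = y%:A - z1%:A * c1 by rewrite -ey1 addrC addKr.
have en2 : n2 = y%:A - z2%:A * c2 by rewrite -ey2 addrC addKr.
rewrite en1 in hn1; rewrite en2 in hn2.
move: (id y%:A z1%:A z2%:A c1 c2); rewrite e12 expr1n mul1r -ez => ->.
apply: (submodD sZ).
  apply: saddl => //; apply: qscale_in; apply: (submodD sB); exact: BM.
apply: (saddr (szB z)); apply: (submodD (sbM b)).
  apply: (submodD (sbM b)).
    by apply: (aux b1 e2 e2 _ Be2 _ hn1) => x hx; rewrite mulrC; exact: hb.
  exact: (aux b2 e1 e1 _ Be1 (fun x hx => hb _ x be1 hx) hn2).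
apply: qmul_in => //; apply: (submodB sM); [apply: (submodB sM)|].
- by rewrite mulr_natl; apply: (submodD sM); exact: Mz.
- by apply: MB_M => //; exact: Mz.
- by apply: MB_M => //; exact: Mz.
Qed.

(** Nakayama with nilpotence of G on M modulo N in place of a radical condition. One generator u of
    G is removed at a time: induction gives M inside N + uM, which is iterated until u^a M falls
    into N. *)
Lemma nilpotent_nakayama k (G N : set Q) : gen_by k G -> G `<=` B -> submod N ->
  (forall g x, G g -> N x -> N (g * x)) ->
  (forall g, G g -> exists a, forall x, M x -> N (g ^+ a * x)) ->
  M `<=` sadd N (qmul G M) -> M `<=` N.
Proof.
elim: k G N => [|k IH] G N gG GB sN stN nil MN.
  apply: subset_trans MN _; apply: sadd_min => //; rewrite (gen_by0 gG).
  by apply: qmul_min => // x y -> _; rewrite mul0r; exact: submod0.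
have [G' gG' [u eG]] := gen_byS gG.
have sG' : submod G' by apply: fin_gen_submod; exists k.
have s1 := span_submod [set u].
have Gu : G u by rewrite eG; apply: (saddr sG'); exact: sub_span.
have G'G : G' `<=` G by rewrite eG; exact: saddl.
have suM := qscale_submod u sM; have sN' := sadd_submod sN suM.
have MN' : M `<=` sadd N (qscale u M).
  apply: (IH G') => //.
  - exact: subset_trans GB.
  - move=> g _ Gg [x Nx [_ [y My <-] <-]]; exists (g * x); first by apply: stN => //; exact: G'G.
    exists (u * (g * y)); last by ring.
    by apply: qscale_in; apply: MB_M => //; apply: GB; exact: G'G.
  - by move=> g Gg; have [a ha] := nil _ (G'G _ Gg); exists a => x Mx; apply: saddl => //; exact: ha.
  - apply: subset_trans MN _; have sS := sadd_submod sN' (qmul_submod G' M).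
    apply: sadd_min => //; first by apply: subset_trans (saddl (qmul_submod _ _)); exact: saddl.
    apply: qmul_min => // g x; rewrite eG => -[g' G'g' [_ /span1P[r ->] <-]] Mx.
    rewrite mulrDl; apply: (submodD sS).
      by apply: (saddr sN'); exact: qmul_in.
    apply: (saddl (qmul_submod _ _)); apply: (saddr sN); exists (r *: x); first exact: submodZ.
    by rewrite -scalerAr scalerAl.
have [a ha] := nil _ Gu.
have step i : M `<=` sadd N (qscale (u ^+ i) M).
  elim: i => [|i IHi]; first by rewrite expr0 qscale1; exact: saddr.
  have sNi := sadd_submod sN (qscale_submod (u ^+ i.+1) sM).
  move=> x /IHi[y Ny [_ [z Mz <-] <-]]; apply: (submodD sNi).
    by apply: saddl => //; exact: qscale_submod.
  have [y' Ny' [_ [z' Mz' <-] <-]] := MN' _ Mz.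
  rewrite mulrDr mulrA -exprSr; apply: (submodD sNi); last by apply: (saddr sN); exact: qscale_in.
  apply: saddl; first exact: qscale_submod.
  elim: i {IHi sNi Mz} => [|i IHi]; first by rewrite mul1r.
  by rewrite exprS -mulrA; exact: stN.
move=> x /(step a)[y Ny [_ [z Mz <-] <-]]; apply: (submodD sN) => //; exact: ha.
Qed.

(* Take a maximal counterexample c inside a maximal ideal n.  A monic relation
   among the powers of u in n, modulo c, reads u^a e in c with e outside n; if
   u^a is not in c, then c + u^a B and c + eB are comaximal and larger.  So n is
   nilpotent modulo c. *)
Lemma cyclic_mod_all (b : set Q) : minimal_multiplicity m -> endo_ideal b -> M `<=` b -> cyclic_mod b.
Proof.
move=> hmm ib0 Mb0; apply: contrapT => nc0.
pose P c := [/\ endo_ideal c, M `<=` c & ~ cyclic_mod c].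
have fB := lattice_fin_gen noeth hQ lattice_endo_max.
have [||c [[ic Mc nc] maxc]] := @noetherian_max R noeth Q B P fB.
- by move=> A [[sA AB _] _ _].
- by exists b.
have [sc cB hc] := ic.
have better c' : endo_ideal c' -> c `<=` c' -> ~ (c' `<=` c) -> cyclic_mod c'.
  move=> ic' cc' ncc'; apply: contrapT => nc'; apply: ncc'.
  suff -> : c' = c by [].
  by apply: maxc => //; split=> //; exact: subset_trans cc'.
have nc1 : ~ c 1.
  move=> c1; apply: nc; exists 0; first exact: ideal0.
  move=> y my; apply: (saddr (szB 0)); rewrite -[y%:A]mul1r; apply: qmul_in => //.
  by exists y.
pose P' d := [/\ endo_ideal d, c `<=` d & ~ d 1].
have [||n [[inn cn nn1] maxn]] := @noetherian_max R noeth Q B P' fB.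
- by move=> A [[sA AB _] _ _].
- by exists c; split.
have [sn nB hn] := inn.
have Mn := subset_trans Mc cn.
have cycn : cyclic_mod n.
  apply: cyclic_mod_max => // d id nd nd1; suff -> : d = n by [].
  by apply: maxn => //; split=> //; exact: subset_trans nd.
have lc : lattice c by apply: (lattice_sandwich lM lattice_endo_max).
have [dl hdl] := lattice_fin_len noeth loc dim1 hQ lc lattice_endo_max cB.
have BX u i : B u -> B (u ^+ i).
  by move=> Bu; elim: i => [|i IHi]; [exact: B1|rewrite exprS; exact: BM].
have nil u : n u -> exists a, c (u ^+ a).
  move=> nu; have Bu := nB _ nu.
  have [i [r [cr _]]] := linear_dependence hdl (fun i => BX u i Bu).
  pose r' (l : nat) : R := if insub l is Some j then - r j else 1.
  have r'E (l : 'I_i) : r' l = - r l by rewrite /r' valK.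
  have r'i : r' i = 1 by rewrite /r' insubF // ltnn.
  have csum : c (\sum_(l < i.+1) r' l *: u ^+ l).
    rewrite big_ord_recr /= r'i scale1r addrC (eq_bigr (fun l : 'I_i => - (r l *: u ^+ l))); last first.
      by move=> l _; rewrite r'E scaleNr.
    by rewrite sumrN.
  (* Take the least a whose coefficient in the monic relation is a unit. Lower terms have
     coefficients in m and lie in c, so u^a e is in c, where e is a unit plus a multiple of u and
     hence outside n. *)
  have exa : exists a, (a <= i)%N && ~~ `[< m (r' a) >].
    exists i; rewrite leqnn /=; apply/asboolPn; rewrite r'i; exact: (max_proper loc).
  case: (ex_minnP exa) => a /andP[ai nma0] mina; have nma : ~ m (r' a) by exact/asboolPn.
  have [v ev] := local_unit noeth loc nma.
  have cm l : m (r' l) -> c (r' l *: u ^+ l).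
    move=> ml; rewrite -mulr_algl mulrC; apply: hc; first exact: BX.
    by apply: Mc; exists (r' l).
  pose t := \sum_(l < i.+1 | (a < l)%N) r' l *: u ^+ (l - a.+1).
  have Bt : B t by apply: (submod_sum sB) => l _; apply: (submodZ _ sB); exact: BX.
  pose e := (r' a)%:A + u * t.
  have Be : B e by apply: (submodD sB) => //; exact: BM.
  have ce : c (u ^+ a * e).
    have ai' : (a < i.+1)%N by rewrite ltnS.
    have [s1 Bs1 es] : exists2 s1, c s1 & \sum_(l < i.+1) r' l *: u ^+ l = s1 + u ^+ a * e.
      exists (\sum_(l < i.+1 | (l < a)%N) r' l *: u ^+ l).
        apply: (submod_sum sc) => l la; apply: cm; apply: contrapT => nml.
        have : (a <= l)%N by apply: mina; rewrite -ltnS ltn_ord /=; exact/asboolPn.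
        by rewrite leqNgt la.
      rewrite (bigID (fun l : 'I_i.+1 => (l < a)%N)) /=; congr (_ + _).
      rewrite (bigD1 (Ordinal ai')) /= ?ltnn // /e mulrDr; congr (_ + _).
        by rewrite -[LHS]mulr_algl mulrC.
      rewrite /t mulrA mulr_sumr; apply: eq_big => l.
        by rewrite -leqNgt ltn_neqAle eq_sym -val_eqE andbC.
      rewrite -leqNgt -val_eqE => /= /andP[al nla].
      have lal : (a < l)%N by rewrite ltn_neqAle eq_sym nla.
      rewrite -scalerAr; congr (_ *: _); rewrite -exprSr -exprD; congr (_ ^+ _); lia.
    have -> : u ^+ a * e = \sum_(l < i.+1) r' l *: u ^+ l - s1 by rewrite es addrC addKr.
    exact (submodB sc csum Bs1).
  have [p [q [Bp Bq e1]]] : exists p q, [/\ B p, B q & p * u + q * e = 1].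
    exists (- (v%:A * t)), v%:A; split=> //.
      by apply: (submodN sB); exact: BM.
    have -> : - (v%:A * t) * u + v%:A * e = v%:A * (r' a)%:A by rewrite /e; ring.
    by rewrite -algM ev scale1r.
  have nne : ~ n e.
    by move=> ne; apply: nn1; rewrite -e1; apply: (submodD sn); apply: hn.
  have [p' [q' [Bp' Bq' e1']]] : exists p q, [/\ B p, B q & p * u ^+ a + q * e = 1].
    elim: (a) => [|a' [p' [q' [Bp' Bq' e']]]].
      by exists 1, 0; split; rewrite ?mul1r ?mul0r ?addr0 //; exact: submod0.
    exists (p' * p), (p' * u ^+ a' * q + q'); split; first exact: BM.
      by apply: (submodD sB) => //; apply: BM => //; apply: BM => //; exact: BX.
    have -> : p' * p * u ^+ a'.+1 + (p' * u ^+ a' * q + q') * e = p' * u ^+ a' * (p * u + q * e) + q' * e.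
      by rewrite exprSr; ring.
    by rewrite e1 mulr1.
  exists a; apply: contrapT => nca; apply: nc.
  have ext w : B w -> endo_ideal (sadd c (qscale w B)) /\ c `<=` sadd c (qscale w B).
    move=> Bw; split; last by apply: saddl; exact: qscale_submod.
    split; first by apply: sadd_submod => //; exact: qscale_submod.
      by apply: sadd_min => // _ [w' Bw' <-]; exact: BM.
    move=> w' _ Bw' [w1 cw1 [_ [d Bd <-] <-]]; exists (w' * w1); first exact: hc.
    by exists (w * (w' * d)); [apply: qscale_in; exact: BM|ring].
  have gain w : B w -> ~ c w -> cyclic_mod (sadd c (qscale w B)).
    move=> Bw ncw; have [h1 h2] := ext _ Bw; apply: better => // sub; apply: ncw; apply: sub.
    by apply: (saddr sc); exists 1; rewrite ?mulr1.
  apply: (@cyclic_mod_comaximal c (sadd c (qscale (u ^+ a) B)) (sadd c (qscale e B)) (p' * u ^+ a) (q' * e)) => //.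
  - by have [] := ext _ (BX u a Bu).
  - by have [] := ext _ Be.
  - by apply: (saddr sc); exists p' => //; rewrite mulrC.
  - by apply: (saddr sc); exists q' => //; rewrite mulrC.
  - move=> _ _ [w1 cw1 [_ [d1 Bd1 <-] <-]] [w2 cw2 [_ [d2 Bd2 <-] <-]].
    have -> : (w1 + u ^+ a * d1) * (w2 + e * d2) =
       (w2 + e * d2) * w1 + u ^+ a * d1 * w2 + d1 * d2 * (u ^+ a * e) by ring.
    apply: (submodD sc); [apply: (submodD sc)|]; apply: hc => //.
    + by apply: (submodD sB); [exact: cB|exact: BM].
    + by apply: BM => //; exact: BX.
    + exact: BM.
  - by apply: gain => //; exact: BX.
  - by apply: gain => // ce'; apply: nne; exact: cn.
(* Elements of n are nilpotent modulo c, so M = zB + nM improves to M = zB + cM, against the choice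
   of c. *)
have [z mz hz] := cycn; apply: nc; exists z => // y my.
have fn : fin_gen n by apply: (noetherian_submod noeth fB).
have [k gn] := fn.
have sN := sadd_submod (szB z) (sbM c).
suff : M `<=` sadd (qscale z%:A B) (qmul c M) by apply; exists y.
apply: (nilpotent_nakayama gn nB sN).
- move=> g _ ng [_ [d Bd <-] [w hw <-]]; have Bg := nB _ ng; exists (z%:A * (g * d)); first by apply: qscale_in; exact: BM.
  by exists (g * w); [exact: qmulM_stable|ring].
- move=> g ng; have [a ha] := nil _ ng; exists a => x Mx.
  by apply: (saddr (szB z)); exact: qmul_in.
- move=> _ [r mr <-]; have [p hp [q hq e]] := hz _ mr; exists p; last by exists q.
  exact: saddl.
Qed.

Lemma principal_max : minimal_multiplicity m ->
  exists z, [/\ m z, regular_elt z & M = qscale z%:A B].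
Proof.
move=> hmm.
have iM : endo_ideal M by split=> //; move=> x y; exact: MB_M.
have [z mz hz] := cyclic_mod_all hmm iM (@subset_refl _ M).
have Mz : M z%:A by exists z.
have zBM : qscale z%:A B `<=` M by move=> _ [b Bb <-]; rewrite mulrC; exact: MB_M.
have eM : M = qscale z%:A B.
  apply/seteqP; split=> //.
  have fM := lattice_fin_gen noeth hQ lM.
  apply: (nakayama noeth loc fM (szB z)) => _ [y my <-].
  have [p hp [q hq <-]] := hz _ my.
  exists p => //; exists q => //; move: q hq.
  apply: (@qmul_min R Q _ _ (idprod m M) (span_submod _)) => _ w [r mr <-] Mw.
  by rewrite mulr_algl; exact: idprod_in.
have [y0 my0 ry0] := hreg; have uy0 := regular_unit hQ ry0.
exists z; split=> //; apply: (unit_regular hQ).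
have : M y0%:A by exists y0.
rewrite eM => -[b _ e]; by move: uy0; rewrite -e unitrM => /andP[].
Qed.

End PrincipalMaximalIdeal.

(** * Ulrich ideals when m = zB *)

Section UlrichMinimalMultiplicity.
Variables (R : comNzRingType) (m : set R) (Q : comUnitAlgType R).
Hypotheses (noeth : noetherian R) (loc : local_with m) (dim1 : has_dim (R^o : lmodType R) 1).
Hypothesis hQ : total_fractions Q.
Hypothesis hreg : exists2 y, m y & regular_elt y.
Variable z : R.
Hypotheses (mz : m z) (rz : regular_elt z).
Notation B := (@endo_max R m Q).
Hypothesis mzB : [set r%:A | r in m] = qscale z%:A B.

Let im := max_ideal loc.

(** As I lies in m, B = m : m lies in R : I = A, so mA = zBA = zA; the colength of z is the same on
    the lattices A and B. *)
Lemma ulrich_length_endo I a (A : set Q) n (f : 'I_n -> Q) : ulrich_data m I a A f ->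
  has_length B (qscale z%:A B) n.+1.
Proof.
move=> hU; have [[ma ra iI Im] [[sA [A1 AM]] n0] AP [Af genf] indf] := hU.
have BA : B `<=` A.
  by move=> x Bx; apply/(ulrich_colonP hQ hU) => r /Im/Bx[u mu ->]; exact: base_alg.
have lA := ulrich_lattice hU.
have defA : A = submod_span (range (fcons 1 f)).
  apply/seteqP; split; first by move=> x /(ulrich_span hU) ?; apply/span_rangeP.
  apply: span_range_sub => // i; rewrite /fcons; by case: (unlift ord0 i).
have mA : idprod m A = qscale z%:A A.
  apply/seteqP; split.
    apply: idprod_min; first exact: qscale_submod.
    move=> r x mr Ax; have : [set r%:A | r in m] (r%:A : Q) by exists r.
    by rewrite mzB => -[b Bb e]; exists (b * x); [apply: AM => //; exact: BA|rewrite mulrA e mulr_algl].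
  by move=> _ [x Ax <-]; rewrite mulr_algl; exact: idprod_in.
have [_] : mu A = n.+1 /\ has_length A (idprod m A) n.+1.
  apply: (mu_eq noeth loc defA) => r; rewrite [in idprod _ _]defA.
  move=> /(idprod_span im)[t mt et] i; rewrite -(subrK (t i) (r i)).
  apply: (idealD im) => //; apply: Im; move: i.
  apply: (@ulrich_indep _ _ _ hQ _ _ _ _ _ hU (fun i => r i - t i) 0); first exact: ideal0.
  by under eq_bigr do rewrite scalerBl; rewrite sumrB et subrr scale0r.
rewrite mA; exact: (lattice_index noeth loc dim1 hQ rz lA (lattice_endo_max Q loc hreg)).
Qed.

(** A generating family of B/R of least size is a basis over R/m, since a relation with a unit
    coefficient would let a vector be dropped. If it were empty, then B = R and m = zR, so (R : m)/R
    would be generated by z^-1, against N > 1. *)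
Lemma max_ulrich_data N : has_length (socle_over m (@base R Q)) (@base R Q) N -> (1 < N)%N ->
  exists n (f : 'I_n -> Q), ulrich_data m m z B f.
Proof.
move=> socR N1; have sb := @base_submod R Q; have [sB [B1 _]] := endo_max_subalg Q loc.
have [n0 [e eB]] := lattice_fin_gen noeth hQ (lattice_endo_max Q loc hreg).
pose P n := `[< exists f : 'I_n -> Q, (forall i, B (f i)) /\
  forall x, B x -> exists r : 'I_n -> R, base (x - \sum_i r i *: f i) >].
have exP : exists n, P n.
  exists n0; apply/asboolP; exists e; split; first by move=> i; rewrite eB; exact: span_in.
  move=> x; rewrite eB => /span_rangeP[r ->]; exists r; rewrite subrr; exact: submod0.
case: (ex_minnP exP) => n /asboolP[f [Bf genf]] minn.
exists n, f; split=> //.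
- by split.
- split; first exact: (endo_max_subalg Q loc).
  rewrite lt0n; apply/eqP => n00; move: N1; rewrite ltnNge => /negP; apply.
  have Bb x : B x -> base x.
    by move=> /genf[r]; rewrite big1 ?subr0 // => i; exfalso; case: i => i; rewrite n00.
  have uz := regular_unit hQ rz.
  pose E := submod_span [set (z%:A : Q)^-1].
  have EN : idprod m E `<=` @base R Q.
    apply: idprod_min => // r _ mr /span1P[s ->]; rewrite scalerA mulrC -scalerA.
    apply: (submodZ s sb); have : [set r%:A | r in m] (r%:A : Q) by exists r.
    rewrite mzB => -[b Bb' e']; rewrite -[r *: _]mulr_algl -e' mulrAC divrr // mul1r; exact: Bb.
  have [j j1 hj] := has_length_gens noeth loc sb (gen_by1 _) EN.
  have -> : N = j; last exact: j1.
  apply: (has_length_uniq socR); suff <- : sadd (@base R Q) E = socle_over m (@base R Q) by [].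
  apply/seteqP; split.
    apply: sadd_min; first exact: socle_over_submod.
      by move=> _ [s _ <-] r mr; rewrite alg_scale; exact: base_alg.
    by move=> x Ex r mr; apply: EN; exact: idprod_in.
  move=> w /(_ _ mz)[s _ es]; apply: (saddr sb); apply/span1P; exists s.
  by apply: (mulrI uz); rewrite mulr_algl -es -scalerAr mulrV // .
- move=> x; split.
    move=> Bx; have : [set r%:A | r in m] (z%:A * x) by rewrite mzB; exact: qscale_in.
    by move=> [r mr er]; exists r => //; rewrite er mulr_algl.
  move=> [r mr er]; have : [set r%:A | r in m] (r%:A : Q) by exists r.
  rewrite mzB => -[b Bb e']; suff -> : x = b by [].
  by apply: (mulrI (regular_unit hQ rz)); rewrite e' mulr_algl.
- move=> r hr i; apply: contrapT => nmi.
  have [v ev] := local_unit noeth loc nmi.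
  have n1 : n = n.-1.+1 by rewrite prednK //; case: (n) i {hr minn nmi ev} => [[]|].
  suff /minn : P n.-1 by rewrite {1}n1 ltnn.
  clear minn; case: n f Bf genf r hr i nmi ev n1 => [|n] // f Bf genf r hr i nmi ev _ /=.
  apply/asboolP; exists (fun j => f (lift i j)); split=> // x /genf[t ht].
  exists (fun j => t (lift i j) - t i * v * r (lift i j)).
  have -> : x - \sum_j (t (lift i j) - t i * v * r (lift i j)) *: f (lift i j) =
      (x - \sum_j t j *: f j) + (t i * v) *: \sum_j r j *: f j.
    rewrite (bigD1_ord i) //= [\sum_(j < n.+1) r j *: _](bigD1_ord i) //=.
    under eq_bigr do rewrite scalerBl -scalerA.
    have id (p q r1 s : Q) : p - (q - r1) = p - (s + q) + (s + r1) by ring.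
    by rewrite sumrB -scaler_sumr scalerDr scalerA -(mulrA (t i)) ev mulr1; exact: id.
  exact (submodD sb ht (submodZ _ sb hr)).
Qed.

End UlrichMinimalMultiplicity.

(* Modulo c, every element outside c is a unit times a power of a. *)
Lemma ideals_chain (R : comNzRingType) (m c : set R) (a : R) : noetherian R -> local_with m ->
  has_dim (R^o : lmodType R) 1 -> ideal c -> (exists2 t, c t & regular_elt t) ->
  m = ideal_add (pideal a) c ->
  forall I J, ideal I -> ideal J -> c `<=` I -> c `<=` J -> I `<=` J \/ J `<=` I.
Proof.
move=> noeth loc dim1 ic [d cd rd] em.
have [N hN] := max_pow_regular noeth loc dim1 rd.
have ma : m a by rewrite em; exists a; [exact: pideal_gen|exists 0; [exact: ideal0|rewrite addr0]].
have aN : c (a ^+ N).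
  have /hN/pidealP[r ->] : ideal_pow m N (a ^+ N); last exact (idealM r ic cd).
  elim: N {hN} => [//|N IH]; rewrite exprS; exact: (@idprod_in R R^o).
have dec y : ~ c y -> exists i v, ~ m v /\ c (y - v * a ^+ i).
  move=> ncy; apply: contrapT => nex.
  have step i : exists v, c (y - v * a ^+ i).
    elim: i => [|i [v hv]]; first by exists y; rewrite expr0 mulr1 subrr; exact: ideal0.
    have : m v by apply: contrapT => nmv; apply: nex; exists i, v.
    rewrite em => -[_ /pidealP[r ->] [s cs es]]; exists r.
    have -> : y - r * a ^+ i.+1 = (y - v * a ^+ i) + s * a ^+ i by rewrite -es exprS; ring.
    exact (idealD ic hv (idealMr (a ^+ i) ic cs)).
  have [v hv] := step N; apply: ncy; rewrite -(subrK (v * a ^+ N) y).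
  exact (idealD ic hv (idealM v ic aN)).
move=> I J iI iJ cI cJ; have [|/existsNP[x /not_implyP[Ix nJx]]] := pselect (I `<=` J); first by left.
right=> y Jy; have [/cI//|ncy] := pselect (c y).
have [|i [u [nmu hu]]] := dec x; first by move=> /cJ.
have [j [v [nmv hv]]] := dec y ncy.
have pow (H : set R) w k t : ideal H -> c `<=` H -> H w -> ~ m t -> c (w - t * a ^+ k) -> H (a ^+ k).
  move=> iH cH Hw nmt /cH hw; have [s es] := local_unit noeth loc nmt.
  have -> : a ^+ k = s * (w - (w - t * a ^+ k)).
    by rewrite opprB addrC subrK mulrA es mul1r.
  exact (idealM s iH (idealB iH Hw hw)).
have mono (H : set R) k l t w : ideal H -> c `<=` H -> (k <= l)%N -> H (a ^+ k) -> c (w - t * a ^+ l) -> H w.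
  move=> iH cH kl Hk /cH hw; rewrite -(subrK (t * a ^+ l) w) -(subnK kl) exprD mulrA.
  rewrite -(subnK kl) exprD mulrA in hw.
  exact (idealD iH hw (idealM _ iH Hk)).
have [ij|ji] := leqP i j.
  exact: (mono I i j v y iI cI ij (pow I x i u iI cI Ix nmu hu) hv).
by case: nJx; exact: (mono J j i u x iJ cJ (ltnW ji) (pow J y j v iJ cJ Jy nmv hv) hu).
Qed.

(** * The three assertions and the case of minimal multiplicity *)

Theorem theorem5p5 (R : comNzRingType) (m : set R)
    (Q : comUnitAlgType R) (K : set Q)
    (hR : cm_local_ring m)
    (hdim : has_dim R^o 1%N)
    (hQ : total_fractions Q)
    (hK : fractional_canonical_ideal m K)
    (hGGL : ggl_ring m)
    (hnG : ~ gorenstein R) :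
  [/\ [set I | ulrich_ideal m I /\ conductor K `<` I] =
        [set ideal_add (pideal a) (conductor K) | a in
           [set a | m a /\ exists b, m b /\
              conductorQ K = [set (a * b)%:A * s | s in adjoin K]]]
      /\ ((exists I, ulrich_ideal m I /\ conductor K `<` I) ->
            ulrich_ideal m (conductor K)),
      forall I : set R, ulrich_ideal m I -> conductor K `<=` I ->
        mu (I : set R^o) = (cm_type m R^o).+1,
      [set I | ulrich_ideal m I /\ conductor K `<=` I] =
        [set I : set R | ulrich_ideal m I /\ mu (I : set R^o) <> 2%N]
    & minimal_multiplicity m ->
        (forall I J, ulrich_ideal m I -> ulrich_ideal m J ->
           I `<=` J \/ J `<=` I) /\
        ulrich_ideal m (conductor K) /\
        (forall I, ulrich_ideal m I -> conductor K `<=` I)].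
Proof.
have [noeth [loc cmR]] := hR.
have depR : has_depth m R^o 1.
  case: cmR => [/(_ 1)/eqP|[d [dd ddim]]]; first by rewrite oner_eq0.
  by rewrite (has_dim_uniq hdim ddim).
have [x mx rx] := regular_seq1 depR.1.
have hreg : exists2 x, m x & regular_elt x by exists x.
have [sK [bK [intK [W [cW [f [injf rf]]]]]]] := hK.
have rxW (y : W) : x *: y = 0 -> y = 0.
  move=> xy; apply: injf; apply: (regular_scale_inj hQ rx).
  by rewrite linear0 scaler0 -linearZ xy linear0.
have socK := (socle_transport hQ 1 sK injf rf mx rx).1 (canonical_socle noeth loc hdim cW mx rxW).
have lK : lattice K.
  split=> //; first by exists 1; [exact: regular1|apply: bK; exact: base_alg].
  apply: (fin_gen_bounded hQ); rewrite -rf; have [[n [g eg]] _] := cW.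
  exists n, (f \o g); apply/seteqP; split.
    move=> _ [w _ <-]; have : setT w by []. rewrite eg => /span_rangeP[r ->].
    by apply/span_rangeP; exists r; rewrite linear_sum; apply: eq_bigr => i _; rewrite linearZ.
  move=> _ /span_rangeP[r ->]; exists (\sum_i r i *: g i) => //.
  by rewrite linear_sum; apply: eq_bigr => i _; rewrite linearZ.
have [L [k [e [c [[lL RL socL] [ic cm Le] genL indL cL]]]]] := ggl_normal_form noeth loc hdim hQ hGGL hnG.
(* The statement concerns K, whereas the normal form describes L. Since they differ by a unit,
   [adjoin_eq] and [conductorQ_eq] allow S and the conductor to be computed from L. *)
have [u uu eK] := canonical_unique noeth loc hdim hQ hreg lK lL socK socL.
have eS : adjoin K = adjoin L.
  apply: (adjoin_eq noeth loc hdim hQ lL RL socL ic Le indL cL uu eK) => //.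
  by rewrite -[1]scale1r; apply: bK; exact: base_alg.
have eC : conductorQ K = [set r%:A | r in c].
  by rewrite /conductorQ eS; exact: (conductorQ_eq ic Le indL cL).
have -> : conductor K = c.
  apply/seteqP; split=> r; rewrite /conductor /preimage /= eC; first by move/(alg_memP hQ).
  by move=> cr; exists r.
have socR := length_socle_base noeth loc hdim hQ hreg lL RL socL ic cm Le genL indL cL.
(* R is embedded as [base], so that its type becomes the length of (R : m)/R, known from [socR]. *)
have [incl eincl] : exists g : {linear R^o -> Q}, forall r, g r = r%:A.
  apply: (@linear_exists R R^o Q (fun r => r%:A)) => r s t.
  by rewrite -[r *: s]/(r * s) algD alg_scale.
have -> : cm_type m R^o = k.+2.
  apply: (cm_type_eq noeth loc hdim cW depR mx rx).
  apply/(socle_transport hQ k.+2 (base_submod Q) _ _ mx rx (f := incl)) => //.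
    by move=> r s; rewrite !eincl => /(alg_inj hQ).
  by apply/seteqP; split=> [_ [r _ <-]|_ [r _ <-]]; [rewrite eincl; exact: base_alg|exists r].
have [s [Ss genS indS]] := adjoin_basis noeth loc hdim hQ lL RL socL ic cm Le genL indL cL.
rewrite eC eS.
pose S := adjoin L.
have hS : subalg S by exact: adjoin_subalg.
have lS : lattice S by exact: (lattice_adjoin lL ic Le indL cL).
have creg := conductor_regular lL Le indL.
have k0 : (0 < k.+2)%N by [].
have cS r y : c r -> S y -> exists2 t, c t & r *: y = t%:A.
  move=> cr Sy; suff [t ct <-] : [set r%:A | r in c] (r *: y) by exists t.
  rewrite -(conductorQ_eq ic Le indL cL) => w Sw.
  have : conductorQ L r%:A by rewrite (conductorQ_eq ic Le indL cL); exists r.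
  by rewrite -[r *: y]mulr_algl -mulrA; apply; exact: (adjoinM Sy Sw).
have colonS y : (forall r, c r -> base (r *: y)) -> S y.
  move=> h; rewrite /S -(base_colon_conductor noeth loc hdim hQ lL RL socL ic Le indL cL) => _ [r cr <-].
  by rewrite mulrC mulr_algl; exact: h.
have data I : ulrich_ideal m I -> exists a (A : set Q) n (g : 'I_n -> Q), ulrich_data m I a A g.
  exact: (ulrich_ideal_data noeth loc hQ hreg).
have mu_above I a A n (g : 'I_n -> Q) : ulrich_data m I a A g -> c `<=` I -> mu (I : set R^o) = k.+3.
  exact: (above_mu noeth loc hdim hQ k0 ic creg Ss genS indS cS colonS socR).
have factor I a A n (g : 'I_n -> Q) : ulrich_data m I a A g -> c `<=` I -> c <> I ->
    exists b, [/\ m b, [set r%:A | r in c] = [set (a * b)%:A * y | y in S]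
           & I = ideal_add (pideal a) c].
  exact: (above_factor noeth loc hdim hQ hS k0 ic creg Ss genS indS cS colonS socR).
have cU a b : m b -> [set r%:A | r in c] = [set (a * b)%:A * y | y in S] -> ulrich_ideal m c.
  move=> mb eab; apply: (ulrich_data_ideal noeth loc hdim hQ).
  exact: (conductor_ulrich_data loc hQ hS k0 ic cm creg Ss genS indS cS mb eab).
have above_c I a A n (g : 'I_n -> Q) : ulrich_data m I a A g -> (1 < n)%N -> c `<=` I.
  exact: (ulrich_above_conductor noeth loc hdim hQ lL RL socL cL).
split.
- split; last first.
    move=> [I [/data[a [A [n [g hU]]]] [cI nIc]]].
    have [|b [mb eab _]] := factor _ _ _ _ _ hU cI; last exact: cU eab.
    by move=> eI; apply: nIc; rewrite eI.
  apply/seteqP; split=> I.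
    move=> [/data[a [A [n [g hU]]]] [cI nIc]].
    have [|b [mb eab ->]] := factor _ _ _ _ _ hU cI; first by move=> eI; apply: nIc; rewrite eI.
    have [[ma _ _ _] _ _ _ _] := hU.
    by exists a => //; split=> //; exists b.
  move=> [a [ma [b [mb eab]]] <-]; split.
    apply: (ulrich_data_ideal noeth loc hdim hQ).
    exact: (factor_ulrich_data loc hQ hS k0 ic cm creg Ss genS indS cS ma eab).
  exact: (conductor_proper noeth loc hQ hS lS ic creg mb eab).
- by move=> I /data[a [A [n [g hU]]]] cI; exact: mu_above hU cI.
- apply/seteqP; split=> I [uI hI]; split=> //; have [a [A [n [g hU]]]] := data _ uI.
    by rewrite (mu_above _ _ _ _ _ hU hI).
  (* mu(I) = n + 1 with n positive, so mu(I) <> 2 leaves n > 1. *)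
  apply: (above_c _ _ _ _ _ hU); move: hI; rewrite (ulrich_mu noeth loc hQ hU).
  by have [_ [_ n0] _ _ _] := hU; case: n n0 {g hU} => [|[]].
- move=> hmm; have [z [mz rz ez]] := principal_max noeth loc hdim hQ hreg hmm.
  have [nm [g hm]] := max_ulrich_data noeth loc hQ hreg mz rz ez socR isT.
  have below I : ulrich_ideal m I -> c `<=` I.
    move=> /data[a [A [n [g' hU]]]]; apply: (above_c _ _ _ _ _ hU).
    (* m is itself an Ulrich ideal containing c, so its rank is k + 2; through l(B/zB) every Ulrich
       ideal has that rank, which exceeds 1. *)
    have h1 := ulrich_length_endo noeth loc hdim hQ hreg mz rz ez hm.
    have [en] := has_length_uniq (ulrich_length_endo noeth loc hdim hQ hreg mz rz ez hU) h1.
    have := mu_above _ _ _ _ _ hm cm; rewrite (ulrich_mu noeth loc hQ hm).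
    by rewrite en => -[->].
  have um : ulrich_ideal m m by exact: (ulrich_data_ideal noeth loc hdim hQ hm).
  have idl I : ulrich_ideal m I -> ideal I by move=> [[[h _] _] _].
  (* [above_factor] needs c <> m. If c = m, each Ulrich ideal contains m and hence equals it. *)
  have [ec|nc] := pselect (c = m).
    split; last by rewrite ec in below *.
    move=> I J uI uJ; left; have [a [A [n [g' hU]]]] := (data _ uI).
    have [[_ _ _ Im] _ _ _ _] := hU; rewrite ec in below.
    exact: subset_trans Im (below _ uJ).
  have [b [mb eab em]] := factor _ _ _ _ _ hm cm nc.
  split; last by split=> //; exact: cU eab.
  move=> I J uI uJ; apply: (ideals_chain noeth loc hdim ic creg em) => //;
    by [exact: idl|exact: below].
Qed.
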